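(* Let $(b,o,c)$ be a magnetic Schrödinger graph over $(X,m)$ whose form $Q$ is positive and closable on $\ell^2$. Assume $c$ is form bounded with bounds $M>0$ and $C\ge0$. Then for all $$p\in I=\left[2\frac{M+1}{M}-2\frac{\sqrt{M+1}}{M},\;2\frac{M+1}{M}+2\frac{\sqrt{M+1}}{M}\right]$$ and all $t\ge0$, the operator $S_2(t)$ is bounded as an operator on $\ell^p$ and $$\|S_2(t)\|_{p,p}\le e^{-D_pt},$$ where $D_p=\left(C_p-M(1-C_p)\right)\lambda_2-C(1-C_p)$ and $C_p=4\frac{p-1}{p^2}$. In particular, $S_2$ extends consistently to strongly continuous semigroups $S_p$ on $\ell^p$ for $p\in I$.
   Context: $X$ is a discrete set, $m:X\to(0,\infty)$ (extended to a measure), $C_c(X)$ the finitely supported complex functions on $X$, $\ell^p=\ell^p(X,m)$. A graph $b$ over $(X,m)$ is a symmetric $b:X\times X\to[0,\infty)$ with zero diagonal and $\sum_yb(x,y)<\infty$ for all $x$; a magnetic potential is $o:X\times X\to\{z\in\mathbb C:|z|=1\}$ with $o(x,y)=\overline{o(y,x)}$; an electric potential is $c:X\to\mathbb R$. The triple $(b,o,c)$ is called a magnetic Schrödinger graph over $(X,m)$. With $\nabla_of(x,y)=f(x)-o(x,y)f(y)$, its form on $C_c(X)$ is $$Q(\varphi,\psi)=\tfrac12\sum_{X\times X}b\,\nabla_o\varphi\,\overline{\nabla_o\psi}+\sum_Xc\,\varphi\overline\psi .$$ $Q$ is positive if $Q(\varphi):=Q(\varphi,\varphi)\ge0$ for all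 $\varphi\in C_c(X)$. The closure is also denoted $Q$, $H_2$ is the associated positive self-adjoint operator on $\ell^2$, $\lambda_2=\inf\sigma(H_2)$, and $S_2(t)=e^{-tH_2}$. $c$ is form bounded with bounds $M,C\ge0$ if $\|\sqrt{c_-/m}\,\varphi\|_2^2\le MQ(\varphi)+C\|\varphi\|_2^2$ for all $\varphi\in C_c(X)$, where $c_-=-(c\wedge0)$. $\|T\|_{p,p}$ is the operator norm on $\ell^p$ (of the extension of $T$ from $\ell^2\cap\ell^p$). Consistent extension means $S_p(t)=S_2(t)$ on $\ell^2\cap\ell^p$ for all $t\ge0$. *)

(* Defs.v *)
From HB Require Import structures.
From mathcomp Require Import all_boot all_order all_algebra.
From mathcomp Require Import all_classical all_reals all_analysis.
From mathcomp Require Import complex.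

Set Implicit Arguments.
Unset Strict Implicit.
Unset Printing Implicit Defensive.

Import Order.TTheory GRing.Theory Num.Theory.
Import numFieldNormedType.Exports.

Local Open Scope classical_set_scope.
Local Open Scope ring_scope.

Notation cmod := Normc.normc.

(* [esum] is meant for nonnegative terms: a real family is summed through its
   positive and negative parts and a complex one through its real and imaginary
   parts. These are the unconditional sums as soon as the family is absolutely
   summable, which is the case wherever they are used below. *)
Section sums.
Context {R : realType} {T : choiceType}.

Definition rsum (f : T -> R) : R :=
  fine (\esum_(x in [set: T]) (Num.max (f x) 0)%:E) -
  fine (\esum_(x in [set: T]) (Num.max (- f x) 0)%:E).

Definition csum (f : T -> R[i]) : R[i] :=
  Complex (rsum (fun x => complex.Re (f x))) (rsum (fun x => complex.Im (f x))).

End sums.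

Section lp.
Context {R : realType} {X : choiceType}.
Variable m : X -> R.
Implicit Types (p : R) (f g h : X -> R[i]) (T : (X -> R[i]) -> X -> R[i]).

Definition lpnorm p f : \bar R :=
  poweR (\esum_(x in [set: X]) (m x * powR (cmod (f x)) p)%:E) p^-1.

Definition lp p : set (X -> R[i]) := [set f | (lpnorm p f < +oo)%E].

Definition l2dot f g : R[i] := csum (fun x => (m x)%:C%C * f x * conjc (g x)).

Definition lp_cvg p (u : nat -> X -> R[i]) f : Prop :=
  lpnorm p (u n \- f) @[n --> \oo] --> (0 : \bar R)%E.

(* Operators on $\ell^p$ are represented by maps on all functions [X -> R[i]];
   only their values on [lp p] are meaningful. *)
Definition bounded_operator p T : Prop :=
  [/\ forall f, lp p f -> lp p (T f),
      forall (a : R[i]) f g, lp p f -> lp p g ->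
        T (fun x => a * f x + g x) = (fun x => a * T f x + T g x)
    & exists K : R, forall f, lp p f -> (lpnorm p (T f) <= K%:E * lpnorm p f)%E].

Definition opnorm p T : \bar R :=
  ereal_sup [set lpnorm p (T f) | f in [set f | (lpnorm p f <= 1)%E]].

Definition C0_semigroup p (S : R -> (X -> R[i]) -> X -> R[i]) : Prop :=
  [/\ forall t, 0 <= t -> bounded_operator p (S t),
      forall f, lp p f -> S 0 f = f,
      forall s t, 0 <= s -> 0 <= t -> forall f, lp p f -> S (s + t) f = S s (S t f)
    & forall f, lp p f -> lpnorm p (S t f \- f) @[t --> 0^'+] --> (0 : \bar R)%E].

(* Unbounded operators on $\ell^2$ are represented by their graphs:
   [A f h] means that [f] belongs to the domain of [A] and that [A f = h]. *)
Definition resolvent_set (A : (X -> R[i]) -> (X -> R[i]) -> Prop) : set R[i] :=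
  [set z | exists2 T, bounded_operator 2 T &
    (forall g, lp 2 g -> A (T g) (fun x => g x + z * T g x)) /\
    (forall f h, A f h -> T (fun x => h x - z * f x) = f)].

Definition spectrum (A : (X -> R[i]) -> (X -> R[i]) -> Prop) : set R[i] :=
  ~` resolvent_set A.

(* [S t] is $e^{-tA}$: [S] is the strongly continuous semigroup on $\ell^2$
   with generator $-A$, domains included. *)
Definition exp_semigroup (A : (X -> R[i]) -> (X -> R[i]) -> Prop)
    (S : R -> (X -> R[i]) -> X -> R[i]) : Prop :=
  C0_semigroup 2 S /\
  forall f h, lp 2 f -> lp 2 h ->
    (A f h <->
     lpnorm 2 (fun x => (t^-1)%:C%C * (S t f x - f x) + h x) @[t --> 0^'+]
       --> (0 : \bar R)%E).

End lp.

Record magnetic_schrodinger_graph (R : realType) (X : choiceType) := MSGraph {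
  edge : X -> X -> R;
  magn : X -> X -> R[i];
  elec : X -> R;
  edge_ge0 : forall x y, 0 <= edge x y;
  edge_sym : forall x y, edge x y = edge y x;
  edge_diag : forall x, edge x x = 0;
  edge_summable : forall x, (\esum_(y in [set: X]) (edge x y)%:E < +oo)%E;
  magn_cmod : forall x y, cmod (magn x y) = 1;
  magn_conj : forall x y, magn x y = conjc (magn y x)
}.

Section form.
Context {R : realType} {X : choiceType}.
Variables (m : X -> R) (G : magnetic_schrodinger_graph R X).
Implicit Types (f g h : X -> R[i]).

Definition Cc : set (X -> R[i]) := [set f | finite_set [set x | f x != 0]].

Definition nabla f (xy : X * X) : R[i] := f xy.1 - magn G xy.1 xy.2 * f xy.2.

Definition Q f g : R[i] :=
  2^-1 * csum (fun xy : X * X =>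
           (edge G xy.1 xy.2)%:C%C * nabla f xy * conjc (nabla g xy))
  + csum (fun x => (elec G x)%:C%C * f x * conjc (g x)).

(* [Q f f] is real. *)
Definition qform f : R := complex.Re (Q f f).

Definition form_positive : Prop := forall f, Cc f -> 0 <= qform f.

Definition Q_cauchy (u : nat -> X -> R[i]) : Prop :=
  forall e : R, 0 < e -> exists N : nat,
    forall i j, (N <= i)%N -> (N <= j)%N -> `|qform (u i \- u j)| < e.

Definition form_closable : Prop :=
  forall u : nat -> X -> R[i], (forall n, Cc (u n)) ->
    lp_cvg m 2 u (fun=> 0) -> Q_cauchy u -> qform (u n) @[n --> \oo] --> (0 : R).

Definition closure_approx (u : nat -> X -> R[i]) f : Prop :=
  [/\ forall n, Cc (u n), Q_cauchy u & lp_cvg m 2 u f].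

Definition closure_dom : set (X -> R[i]) :=
  [set f | lp m 2 f /\ exists u, closure_approx u f].

(* For a positive closable form the limit exists and does not depend on the
   approximating sequences, so [Qbar] takes its only possible value. *)
Definition Qbar f g : R[i] :=
  xget 0 [set z | exists u v, [/\ closure_approx u f, closure_approx v g &
    cmod (Q (u n) (v n) - z) @[n --> \oo] --> (0 : R)]].

Definition H2 f h : Prop :=
  [/\ closure_dom f, lp m 2 h &
      forall g, closure_dom g -> Qbar f g = l2dot m h g].

(* The spectrum of a self-adjoint operator is real. *)
Definition lambda2 : R := inf [set r : R | spectrum m H2 (r%:C)%C].

Definition elec_neg (x : X) : R := - Num.min (elec G x) 0.

Definition form_bounded (M C : R) : Prop :=
  forall f, Cc f ->
    let g : X -> R[i] := fun x => (Num.sqrt (elec_neg x / m x))%:C%C * f x in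
    (lpnorm m 2 g ^+ 2 <= (M * qform f)%R%:E + C%:E * lpnorm m 2 f ^+ 2)%E.

End form.

(* Main.v *)
Require Import Defs.
From HB Require Import structures.
From mathcomp Require Import all_boot all_order all_algebra.
From mathcomp Require Import all_classical all_reals all_analysis.
From mathcomp Require Import complex ring lra.

(* The resolvent of $H_2$ is approximated by its Galerkin solutions $u_K$ on finite sets $K$.
   Testing the equation of $u_K$ against $u_K|u_K|^{p-2}$, the pointwise Stroock-Varopoulos
   inequality bounds the form below by
   $C_pQ(v)+(1-C_p)\sum c|v|^2$ with $v=u_K|u_K|^{p/2-1}$, and form boundedness of $c$
   together with $Q\ge\lambda_2$ turns this into $D_p\|u_K\|_p^p$; hence
   $\|(H_2+\alpha)^{-1}g\|_p\le(\alpha+D_p)^{-1}\|g\|_p$ by Young's inequality and Fatou's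
   lemma.  Euler's formula $S_2(t)=\lim_n(1+\frac tnH_2)^{-n}$ transfers the bound to the
   semigroup, which extends to $\ell^p$ by density of finitely supported functions. *)

(** The detour through finite sets is forced by the test function: for a general $u$ in the domain
    of $H_2$, $u|u|^{p-2}$ may fail to lie in the form domain, whereas $u_K|u_K|^{p-2}$ vanishes
    outside $K$ and is admissible in the equation of $u_K$. The endpoints of $I$ are the roots of
    $Mp^2=4(M+1)(p-1)$, so $I$ is where $C_p-M(1-C_p)\ge0$; this sign is what permits replacing
    $Q(v)$ by its lower bound $\lambda_2\|v\|_2^2$. That lower bound has itself to be extracted from
    the definition of $\lambda_2$ as the infimum of a spectrum: a lower bound of the form that is a
    resolvent point can be increased. No growth bound is part of the definition of $S_2$, so the
    local boundedness on which Euler's formula rests comes from the uniform boundedness principle.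
    Throughout, sesquilinear forms are represented by their real parts; the imaginary part is
    recovered by replacing $g$ with $ig$. *)

Set Implicit Arguments.
Unset Strict Implicit.
Unset Printing Implicit Defensive.

Import Order.TTheory GRing.Theory Num.Theory.
Import numFieldNormedType.Exports.

Local Open Scope classical_set_scope.
Local Open Scope ring_scope.

(** * The norm of $\ell^p$ *)

Section lp_norm.
Variable R : realType.

Lemma ler_sum_mem (T : choiceType) (F : T -> R) (s s' : seq T) : uniq s -> uniq s' ->
  (forall x, 0 <= F x) -> \sum_(x <- s' | x \in s) F x <= \sum_(x <- s) F x.
Proof.
move=> us us' F0; rewrite [leRHS](bigID (fun x => x \in s')) /=.
rewrite -big_filter -[X in _ <= X + _]big_filter.
rewrite (perm_big [seq i <- s | i \in s'])/=; last first.
  by apply: uniq_perm; rewrite ?filter_uniq// => x; rewrite !mem_filter andbC.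
by rewrite lerDl sumr_ge0.
Qed.

(** The bridge from extended sums to real numbers: every later estimate on a norm or a sum is a
    uniform bound on sums over duplicate-free lists. *)
Lemma esum_leP (T : choiceType) (a : T -> R) (B : R) :
  (forall x, 0 <= a x) ->
  (\esum_(x in [set: T]) (a x)%:E <= B%:E)%E <->
  (forall s : seq T, uniq s -> \sum_(x <- s) a x <= B).
Proof.
move=> a0; split=> [h s us|h].
  rewrite -lee_fin; apply: le_trans h; apply: ereal_sup_ubound.
  exists [set` s]; first by split=> //; exact: finite_seq.
  by rewrite -fsbig_seq// sumEFin.
apply: ge_ereal_sup => _ [A [fA _] <-].
by rewrite fsbig_finite//= sumEFin lee_fin; apply: h; exact: finmap.fset_uniq.
Qed.

Variables (X : choiceType) (m : X -> R).
Hypothesis m_gt0 : forall x, 0 < m x.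
Notation V := (X -> R[i]).

Lemma cmod_ge0 (z : R[i]) : 0 <= cmod z.
Proof. by case: z => a b /=; exact: sqrtr_ge0. Qed.

Lemma cmodB (z w : R[i]) : cmod (z - w) = cmod (w - z).
Proof. by rewrite -opprB normcN. Qed.

Lemma cmod_real (a : R) : cmod (a%:C%C) = `|a|.
Proof. by rewrite /= expr0n addr0 sqrtr_sqr. Qed.

Lemma lpnorm_leP (p : R) (f : V) (B : R) : 0 < p -> 0 <= B ->
  (lpnorm m p f <= B%:E)%E <->
  (forall s : seq X, uniq s -> \sum_(x <- s) m x * cmod (f x) `^ p <= B `^ p).
Proof.
move=> p0 B0.
have t0 x : 0 <= m x * cmod (f x) `^ p by rewrite mulr_ge0 ?powR_ge0// ltW.
rewrite -esum_leP// /lpnorm; set S := esum _ _.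
have S0 : (0 <= S)%E by apply: esum_ge0 => x _; rewrite lee_fin.
have pV0 : 0 <= p^-1 by rewrite invr_ge0 ltW.
have pN0 : p != 0 by rewrite gt_eqF.
have aux (y : \bar R) : (0 <= y)%E -> y \in `[0%E, +oo%E] by rewrite in_itv/= leey andbT.
split=> h.
- have := @gt0_ler_poweR R p (ltW p0) (poweR S p^-1) B%:E (aux _ (poweR_ge0 _ _)).
  by rewrite -poweRrM mulVf// poweRe1// poweR_EFin; apply=> //; apply: aux; rewrite lee_fin.
- have /= := @gt0_ler_poweR R p^-1 pV0 S _ (aux _ S0) _ h.
  by rewrite -powRrM mulfV// powRr1//; apply; apply: aux; rewrite lee_fin powR_ge0.
Qed.

(** [fine] sends [+oo] to 0, so this is the norm only on [lp m p]; hence estimates below are stated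
    together with membership. *)
Definition nrm p f : R := fine (lpnorm m p f).

Lemma nrm_ge0 p f : 0 <= nrm p f.
Proof. by rewrite /nrm fine_ge0// poweR_ge0. Qed.

Lemma lpE p f : lp m p f -> lpnorm m p f = (nrm p f)%:E.
Proof.
by move=> h; rewrite /nrm fineK// ge0_fin_numE// poweR_ge0.
Qed.

Lemma nrm_leP (p : R) (f : V) (B : R) : 0 < p -> 0 <= B ->
  (lp m p f /\ nrm p f <= B) <->
  (forall s : seq X, uniq s -> \sum_(x <- s) m x * cmod (f x) `^ p <= B `^ p).
Proof.
move=> p0 B0; rewrite -lpnorm_leP//; split=> [[/lpE-> //]|h].
have lf : lp m p f by rewrite /lp/=; apply: le_lt_trans h _; rewrite ltry.
by split=> //; rewrite -lee_fin -lpE.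
Qed.

Lemma nrm_sum (p : R) (f : V) (s : seq X) : 0 < p -> lp m p f -> uniq s ->
  \sum_(x <- s) m x * cmod (f x) `^ p <= nrm p f `^ p.
Proof.
move=> p0 lf; have [+ _] := @nrm_leP p f (nrm p f) p0 (nrm_ge0 _ _); apply; split=> //.
Qed.

Lemma nrm_le_sub (p : R) (f g : V) (k : R) : 0 < p -> 0 <= k -> lp m p g ->
  (forall x, cmod (f x) <= k * cmod (g x)) -> lp m p f /\ nrm p f <= k * nrm p g.
Proof.
move=> p0 k0 lg fg; apply/nrm_leP => //; first by rewrite mulr_ge0 ?nrm_ge0.
move=> s us; rewrite powRM ?nrm_ge0//.
apply: (@le_trans _ _ (k `^ p * \sum_(x <- s) m x * cmod (g x) `^ p)).
  rewrite mulr_sumr; apply: ler_sum => x _.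
  rewrite mulrCA ler_wpM2l ?(ltW (m_gt0 x))// -powRM ?cmod_ge0//.
  by rewrite ge0_ler_powR ?(ltW p0)// nnegrE ?mulr_ge0 ?cmod_ge0.
by rewrite ler_wpM2l ?powR_ge0// nrm_sum.
Qed.

(** Convexity of $t\mapsto t^p$ at $a/u$ and $b/v$ with weights $u/(u+v)$ and $v/(u+v)$. Summed over
    points, with $u$ and $v$ in the role of the two norms, it gives Minkowski's inequality without
    Hölder's. *)
Lemma powR_conv (p a b u v : R) : 1 <= p -> 0 <= a -> 0 <= b -> 0 < u -> 0 < v ->
  (a + b) `^ p <= (u + v) `^ p * (u / (u + v) * (a / u) `^ p + v / (u + v) * (b / v) `^ p).
Proof.
move=> p1 a0 b0 u0 v0.
have uv : 0 < u + v by rewrite addr_gt0.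
have t01 : 0 <= u / (u + v) <= 1.
  by rewrite divr_ge0 ?(ltW u0, ltW uv)//= ler_pdivrMr// mul1r lerDl ltW.
have au : 0 <= a / u by rewrite divr_ge0// ltW.
have bv : 0 <= b / v by rewrite divr_ge0// ltW.
have -> : (a + b) = (u + v) * (u / (u + v) * (a / u) + v / (u + v) * (b / v)).
  by field; rewrite !gt_eqF.
rewrite powRM ?(ltW uv)//; last first.
  by rewrite addr_ge0 ?mulr_ge0 ?invr_ge0// ltW.
rewrite ler_wpM2l ?powR_ge0//.
have [/= i01 ti]: exists i : {i01 R}, i%:inum = u / (u + v).
  case/andP: t01 => t0 t1.
  by exists (Itv01 t0 t1).
have e : unstable.onem (u / (u + v)) = v / (u + v).
  by rewrite /unstable.onem; field; rewrite gt_eqF.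
have := @convex_powR R p p1 i01 (a / u) (b / v).
rewrite !inE /= !in_itv /= !andbT => /(_ au bv).
rewrite -e -ti; exact.
Qed.

Lemma lpD p f g : 1 <= p -> lp m p f -> lp m p g ->
  lp m p (f + g) /\ nrm p (f + g) <= nrm p f + nrm p g.
Proof.
move=> p1 lf lg; have p0 : 0 < p by rewrite (lt_le_trans _ p1).
(* Strict upper bounds of the norms serve as denominators, since the norms themselves may vanish;
   they are released at the end. *)
have main u v : nrm p f < u -> nrm p g < v -> lp m p (f + g) /\ nrm p (f + g) <= u + v.
  move=> fu gv.
  have u0 : 0 < u by rewrite (le_lt_trans _ fu)// nrm_ge0.
  have v0 : 0 < v by rewrite (le_lt_trans _ gv)// nrm_ge0.
  have uv : 0 < u + v by rewrite addr_gt0.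
  have au h w : 0 < w -> lp m p h -> nrm p h < w -> forall s, uniq s ->
      \sum_(x <- s) m x * (cmod (h x) / w) `^ p <= 1.
    move=> w0 lh hw s us.
    rewrite (eq_bigr (fun x => w^-1 `^ p * (m x * cmod (h x) `^ p))); last first.
      by move=> x _; rewrite powRM ?cmod_ge0 ?invr_ge0 ?(ltW w0)//; ring.
    rewrite -mulr_sumr.
    apply: (@le_trans _ _ (w^-1 `^ p * nrm p h `^ p)).
      by rewrite ler_wpM2l ?powR_ge0// nrm_sum.
    rewrite -powRM ?nrm_ge0 ?invr_ge0 ?(ltW w0)//.
    have one : 1 = 1 `^ p :> R by rewrite powR1.
    rewrite [leRHS]one {one}.
    rewrite ge0_ler_powR ?(ltW p0)// ?nnegrE ?mulr_ge0 ?nrm_ge0 ?invr_ge0 ?(ltW w0)//.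
    by rewrite mulrC ler_pdivrMr// mul1r ltW.
  apply/nrm_leP => //; first exact: ltW.
  move=> s us.
  apply: (@le_trans _ _ ((u + v) `^ p *
      (u / (u + v) * (\sum_(x <- s) m x * (cmod (f x) / u) `^ p) +
       v / (u + v) * (\sum_(x <- s) m x * (cmod (g x) / v) `^ p)))).
    rewrite !mulr_sumr -big_split/= mulr_sumr; apply: ler_sum => x _.
    rewrite (mulrCA (u / _)) (mulrCA (v / _)) -mulrDr mulrCA ler_wpM2l ?(ltW (m_gt0 x))//.
    apply: (@le_trans _ _ ((cmod (f x) + cmod (g x)) `^ p)); last by rewrite powR_conv ?cmod_ge0.
    rewrite ge0_ler_powR ?(ltW p0)// ?nnegrE ?addr_ge0 ?cmod_ge0//.
    exact: le_normcD.
  rewrite -[leRHS]mulr1 ler_wpM2l ?powR_ge0//.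
  apply: (@le_trans _ _ (u / (u + v) * 1 + v / (u + v) * 1)).
    by apply: lerD; rewrite ler_wpM2l ?divr_ge0 ?(ltW u0, ltW v0, ltW uv)// au.
  by rewrite !mulr1 -mulrDl divff// gt_eqF.
have lt1 (a : R) : a < a + 1 by rewrite ltrDl.
split; first by have [] := main _ _ (lt1 _) (lt1 _).
apply/ler_addgt0Pr => e e0.
have e2 (a : R) : a < a + e / 2 by rewrite ltrDl divr_gt0.
have [_] := main _ _ (e2 _) (e2 _); move/le_trans; apply.
by rewrite addrACA -splitr.
Qed.

Lemma lpZ p (a : R[i]) f : 0 < p -> lp m p f ->
  lp m p (a *: f) /\ nrm p (a *: f) = cmod a * nrm p f.
Proof.
move=> p0 lf.
have [l1 n1] : lp m p (a *: f) /\ nrm p (a *: f) <= cmod a * nrm p f.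
  by apply: nrm_le_sub => // [|x]; [exact: cmod_ge0|rewrite fctE Normc.normcM].
split=> //; apply/eqP; rewrite eq_le n1/=.
have [->|a0] := eqVneq a 0; first by rewrite Normc.normc0 mul0r nrm_ge0.
have ca : 0 < cmod a.
  rewrite lt_neqAle cmod_ge0 andbT eq_sym; apply: contra_neq a0; exact: Normc.eq0_normc.
rewrite mulrC -ler_pdivlMr// mulrC -Normc.normcV.
have [] // := @nrm_le_sub p f (a *: f) (cmod a^-1) p0 (cmod_ge0 _) l1.
by move=> x; rewrite fctE -Normc.normcM/= mulrA mulVf// mul1r.
Qed.

Lemma lp0 p : 0 < p -> lp m p (0 : V) /\ nrm p 0 = 0.
Proof.
move=> p0; have [|l h] := (@nrm_leP p 0 0 p0 (lexx 0)).2.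
  move=> s _; rewrite big1// => x _.
  by rewrite Normc.normc0 powR0 ?gt_eqF ?mulr0.
by split=> //; apply/eqP; rewrite eq_le h nrm_ge0.
Qed.

Lemma lpN p f : 0 < p -> lp m p f -> lp m p (- f) /\ nrm p (- f) = nrm p f.
Proof.
move=> p0 lf; have [h1 h2] := lpZ (-1) p0 lf.
by rewrite -scaleN1r h2 normcN Normc.normc1 mul1r.
Qed.

Lemma lpB p f g : 1 <= p -> lp m p f -> lp m p g ->
  lp m p (f - g) /\ nrm p (f - g) <= nrm p f + nrm p g.
Proof.
move=> p1 lf lg; have [l <-] := lpN (lt_le_trans ltr01 p1) lg.
exact: lpD.
Qed.

(** Each point has positive mass, so a single term of the sum already controls $|f(x)|$. This turns
    norm convergence into pointwise convergence, for any exponent. *)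
Lemma nrm_pt p f x : 0 < p -> lp m p f -> cmod (f x) <= (m x) `^ (- p^-1) * nrm p f.
Proof.
move=> p0 lf; have := @nrm_sum p f [:: x] p0 lf isT; rewrite big_seq1 => h.
have mp : 0 < m x `^ p^-1 by rewrite powR_gt0.
rewrite powRN mulrC ler_pdivlMr//.
have e (y : R) : 0 <= y -> y = (y `^ p) `^ p^-1.
  by move=> y0; rewrite -powRrM mulfV ?gt_eqF// powRr1.
rewrite [leRHS]e ?nrm_ge0//.
have -> : cmod (f x) * m x `^ p^-1 = (m x * cmod (f x) `^ p) `^ p^-1.
  rewrite powRM ?powR_ge0 ?(ltW (m_gt0 x))// -e ?cmod_ge0//; exact: mulrC.
by rewrite ge0_ler_powR ?invr_ge0 ?(ltW p0) ?nnegrE ?mulr_ge0 ?powR_ge0 ?(ltW (m_gt0 x)).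
Qed.

Lemma nrm_eq0 p f : 0 < p -> lp m p f -> nrm p f = 0 -> f = 0.
Proof.
move=> p0 lf h; apply/funext => x; apply: Normc.eq0_normc; apply/eqP.
by rewrite eq_le cmod_ge0 andbT; have := nrm_pt x p0 lf; rewrite h mulr0.
Qed.

End lp_norm.

(** * Limits, completeness and density in $\ell^p$ *)

Section lp_limits.
Variables (R : realType) (X : choiceType) (m : X -> R).
Hypothesis m_gt0 : forall x, 0 < m x.
Notation V := (X -> R[i]).

Lemma dist0P (u : nat -> R) : (forall n, 0 <= u n) ->
  (u n @[n --> \oo] --> (0 : R)) <->
  (forall e, 0 < e -> exists N, forall n, (N <= n)%N -> u n < e).
Proof.
move=> u0; split=> [h e e0|h].
  have [N _ H] := (cvgr0Pnorm_lt _).1 h e e0.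
  by exists N => n Nn; have := H n Nn; rewrite /= ger0_norm.
apply/cvgr0Pnorm_lt => e e0; have [N H] := h e e0.
by exists N => // n /= Nn; rewrite ger0_norm// H.
Qed.

Lemma le_cvg_to (T : Type) (F : set_system T) {FF : ProperFilter F} (u v : T -> R) (a b : R) :
  u n @[n --> F] --> a -> v n @[n --> F] --> b -> (\forall n \near F, u n <= v n) -> a <= b.
Proof.
move=> ua vb uv; rewrite -subr_ge0; apply: (cvgr_to_ge (cvgB vb ua)).
by apply: filterS uv => n; rewrite subr_ge0.
Qed.

Lemma cvg0_sq (T : Type) (F : set_system T) {FF : Filter F} (u v : T -> R) :
  (forall n, 0 <= u n) -> (forall n, u n <= v n) ->
  v n @[n --> F] --> (0 : R) -> u n @[n --> F] --> (0 : R).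
Proof.
move=> u0 uv h; apply: (squeeze_cvgr _ (cvg_cst 0) h).
by apply: nearW => n; rewrite u0 uv.
Qed.

Lemma cvg0D (a b : nat -> R) : a n @[n --> \oo] --> (0 : R) ->
  b n @[n --> \oo] --> (0 : R) -> a n + b n @[n --> \oo] --> (0 : R).
Proof. by move=> ha hb; rewrite -[0 in X in _ --> X](addr0 0); exact: cvgD. Qed.

Lemma cvg_dist0 (a : nat -> R) (l : R) : a n @[n --> \oo] --> l ->
  `|a n - l| @[n --> \oo] --> (0 : R).
Proof. by move=> h; apply/norm_cvg0P/subr_cvg0. Qed.

Lemma cvg0Z (k : R) (a : nat -> R) : a n @[n --> \oo] --> (0 : R) ->
  k * a n @[n --> \oo] --> (0 : R).
Proof. by move=> ha; rewrite -[0 in X in _ --> X](mulr0 k); exact: cvgMr. Qed.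

Lemma cmod_dist (z w : R[i]) : `|cmod z - cmod w| <= cmod (z - w).
Proof.
have h (a b : R[i]) : cmod a - cmod b <= cmod (a - b).
  by rewrite lerBlDr (le_trans _ (le_normcD _ _))// subrK.
by rewrite ler_norml h andbT lerNl opprB cmodB h.
Qed.

Lemma cmod_cvg (T : Type) (F : set_system T) {FF : Filter F} (u : T -> R[i]) z :
  cmod (u n - z) @[n --> F] --> (0 : R) -> cmod (u n) @[n --> F] --> cmod z.
Proof.
move=> h; apply/subr_cvg0/norm_cvg0P; apply: cvg0_sq h => n //.
exact: cmod_dist.
Qed.

Lemma cvg_powR (T : Type) (F : set_system T) {FF : ProperFilter F} (u : T -> R) (l p : R) :
  0 < p -> (forall n, 0 <= u n) ->
  u n @[n --> F] --> l -> u n `^ p @[n --> F] --> l `^ p.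
Proof.
move=> p0 u0 h.
have : 0 <= l.
  by apply: (cvgr_to_ge h); exact: nearW.
rewrite le_eqVlt => /predU1P[l0|l0].
  (* At the limit 0 the power may fail to be differentiable, so continuity is checked by hand with
     threshold $e^{1/p}$. *)
  rewrite -l0 powR0 ?gt_eqF//; apply/cvgr0Pnorm_lt => e e0.
  have e1 : 0 < e `^ p^-1 by rewrite powR_gt0.
  move: h; rewrite -l0 => /cvgr0Pnorm_lt/(_ _ e1); apply: filterS => n.
  rewrite !ger0_norm ?powR_ge0// => lt.
  have := @gt0_ltr_powR R p p0 (u n) (e `^ p^-1).
  rewrite !nnegrE -powRrM mulVf ?gt_eqF// powRr1 ?(ltW e0)//.
  by apply=> //; exact: ltW.
suff c : {for l, continuous (fun x : R => x `^ p)} by exact: (cvg_comp _ _ h c).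
apply/differentiable_continuous/derivable1_diffP.
by have [] := is_derive1_powR p l0.
Qed.

Lemma cvg_bigsum (T : Type) (F : set_system T) {FF : Filter F} (I : Type) (s : seq I)
  (u : I -> T -> R) (l : I -> R) :
  (forall i, u i n @[n --> F] --> l i) ->
  \sum_(i <- s) u i n @[n --> F] --> \sum_(i <- s) l i.
Proof.
move=> h; elim: s => [|i s IH].
  by under eq_fun do rewrite big_nil; rewrite big_nil; exact: cvg_cst.
by under eq_fun do rewrite big_cons; rewrite big_cons; exact: cvgD.
Qed.

(** Fatou's lemma for sums: finite sums converge under pointwise convergence, and bounds on all of
    them bound the norm. *)
Lemma lp_fatou (T : Type) (F : set_system T) {FF : ProperFilter F} p (u : T -> V) f
  (B : T -> R) (b : R) : 0 < p -> (forall n, lp m p (u n)) ->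
  (\forall n \near F, nrm m p (u n) <= B n) -> B n @[n --> F] --> b ->
  (forall x, cmod (u n x - f x) @[n --> F] --> (0 : R)) ->
  lp m p f /\ nrm m p f <= b.
Proof.
move=> p0 lu uB Bb uf.
have b0 : 0 <= b.
  apply: (cvgr_to_ge Bb); apply: filterS uB => n.
  exact: le_trans (nrm_ge0 _ _ _).
apply/(nrm_leP m_gt0) => // s us.
(* [B n] is nonnegative only near [F], while [cvg_powR] wants a family that is nonnegative
   everywhere. *)
have Bb' : `|B n| @[n --> F] --> b.
  by rewrite -[b]ger0_norm//; exact: cvg_norm.
have h1 : \sum_(x <- s) m x * cmod (u n x) `^ p @[n --> F] -->
   \sum_(x <- s) m x * cmod (f x) `^ p.
  apply: cvg_bigsum => x; apply: cvgMr; apply: cvg_powR => //.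
    by move=> n; exact: cmod_ge0.
  exact: cmod_cvg.
apply: (le_cvg_to h1 (cvg_powR p0 (fun n => normr_ge0 (B n)) Bb')).
apply: filterS uB => n un; apply: (le_trans (nrm_sum m_gt0 p0 (lu n) us)).
rewrite ge0_ler_powR ?(ltW p0)// ?nnegrE ?nrm_ge0//.
exact: le_trans (ler_norm _).
Qed.

Lemma nrm_cvg_pt (T : Type) (F : set_system T) {FF : Filter F} p (u : T -> V) f x :
  0 < p -> (forall n, lp m p (u n - f)) ->
  nrm m p (u n - f) @[n --> F] --> (0 : R) ->
  cmod (u n x - f x) @[n --> F] --> (0 : R).
Proof.
move=> p0 lu h.
apply: (@cvg0_sq _ _ _ _ (fun n => m x `^ (- p^-1) * nrm m p (u n - f))).
- by move=> n; exact: cmod_ge0.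
- by move=> n; exact: (nrm_pt m_gt0 x p0 (lu n)).
- by rewrite -(mulr0 (m x `^ (- p^-1))); apply: cvgMr.
Qed.

Lemma cauchy_real (r : nat -> R) :
  (forall e, 0 < e -> exists N, forall i j, (N <= i)%N -> (N <= j)%N -> `|r i - r j| < e) ->
  exists l : R, r n @[n --> \oo] --> l.
Proof.
move=> h; apply/cvg_ex/cauchy_cvgP/cauchy_ballP => e e0.
have [N H] := h e e0.
exists (r @` [set n | (N <= n)%N], r @` [set n | (N <= n)%N]) => /=.
  by split; exists N => // n /= Nn; exists n.
move=> [a b] /= [[i Ni <-] [j Nj <-]]; rewrite /ball/=.
exact: H.
Qed.

Lemma cmod_le (z : R[i]) : cmod z <= `|complex.Re z| + `|complex.Im z|.
Proof.
case: z => a b /=.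
have h : a ^+ 2 + b ^+ 2 <= (`|a| + `|b|) ^+ 2.
  rewrite sqrrD !real_normK ?num_real// lerD2r lerDl.
  by rewrite mulrn_wge0// mulr_ge0.
by rewrite -(ger0_norm (addr_ge0 (normr_ge0 a) (normr_ge0 b))) -sqrtr_sqr ler_wsqrtr.
Qed.

Lemma Re_le_cmod (z : R[i]) : `|complex.Re z| <= cmod z.
Proof.
by case: z => a b /=; rewrite -sqrtr_sqr ler_wsqrtr// lerDl sqr_ge0.
Qed.

Lemma Im_le_cmod (z : R[i]) : `|complex.Im z| <= cmod z.
Proof.
by case: z => a b /=; rewrite -sqrtr_sqr ler_wsqrtr// lerDr sqr_ge0.
Qed.

Lemma Re_dist (z w : R[i]) : `|complex.Re z - complex.Re w| <= cmod (z - w).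
Proof. by rewrite -raddfB; exact: Re_le_cmod. Qed.

Lemma Im_dist (z w : R[i]) : `|complex.Im z - complex.Im w| <= cmod (z - w).
Proof. by rewrite -raddfB; exact: Im_le_cmod. Qed.

Definition nrm_cauchy p (u : nat -> V) := forall e : R, 0 < e ->
  exists N, forall i j, (N <= i)%N -> (N <= j)%N -> nrm m p (u i - u j) < e.

Lemma lp_complete p (u : nat -> V) : 1 <= p -> (forall n, lp m p (u n)) ->
  nrm_cauchy p u -> exists2 f, lp m p f & nrm m p (u n - f) @[n --> \oo] --> (0 : R).
Proof.
move=> p1 lu cu; have p0 : 0 < p by rewrite (lt_le_trans _ p1).
have cpt x e : 0 < e -> exists N, forall i j, (N <= i)%N -> (N <= j)%N -> cmod (u i x - u j x) < e.
  move=> e0; have mx : 0 < m x `^ (- p^-1) by rewrite powR_gt0.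
  have [N H] := cu _ (divr_gt0 e0 mx).
  exists N => i j Ni Nj; have [lij _] := lpB m_gt0 p1 (lu i) (lu j).
  apply: le_lt_trans (nrm_pt m_gt0 x p0 lij) _.
  by rewrite mulrC -ltr_pdivlMr//; exact: H.
have hpt x : exists z : R[i], cmod (u n x - z) @[n --> \oo] --> (0 : R).
  have [a ha] : exists l : R, complex.Re (u n x) @[n --> \oo] --> l.
    apply: cauchy_real => e /(cpt x)[N H]; exists N => i j Ni Nj.
    by apply: le_lt_trans (H i j Ni Nj); rewrite -raddfB; exact: Re_le_cmod.
  have [b hb] : exists l : R, complex.Im (u n x) @[n --> \oo] --> l.
    apply: cauchy_real => e /(cpt x)[N H]; exists N => i j Ni Nj.
    by apply: le_lt_trans (H i j Ni Nj); rewrite -raddfB; exact: Im_le_cmod.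
  exists (Complex a b).
  apply: (@cvg0_sq _ _ _ _ (fun n => `|complex.Re (u n x) - a| + `|complex.Im (u n x) - b|)).
  - by move=> n; exact: cmod_ge0.
  - by move=> n; case: (u n x) => c d; exact: cmod_le.
  - rewrite -(addr0 (0 : R)); apply: cvgD; apply/norm_cvg0P/subr_cvg0 => //.
have [f hf] := choice hpt.
(* Fatou in [j] for [u n - u j] upgrades the pointwise limit to a norm limit. *)
have key e : 0 < e -> exists N, forall n, (N <= n)%N -> lp m p (u n - f) /\ nrm m p (u n - f) <= e.
  move=> e0; have [N H] := cu _ e0; exists N => n Nn.
  apply: (@lp_fatou _ \oo _ p (fun j => u n - u j) (u n - f) (fun=> e) e p0).
  - by move=> j; have [] := lpB m_gt0 p1 (lu n) (lu j).
  - by exists N => // j /= Nj; rewrite ltW// H.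
  - exact: cvg_cst.
  - move=> x; apply: cvg0_sq (hf x) => j; first exact: cmod_ge0.
    have -> : (u n - u j) x - (u n - f) x = f x - u j x by rewrite !fctE; ring.
    by rewrite cmodB.
have [N H] := key 1 ltr01; have [lN _] := H N (leqnn N).
have lf : lp m p f.
  by have [] := lpB m_gt0 p1 (lu N) lN; rewrite subKr.
exists f => //; apply/dist0P => [n|e e0]; first exact: nrm_ge0.
have e2 : 0 < e / 2 by rewrite divr_gt0.
have [N' H'] := key _ e2; exists N' => n Nn; have [_ h] := H' n Nn.
by rewrite (le_lt_trans h)// ltr_pdivrMr// ltr_pMr// ltr1n.
Qed.

Lemma lpnorm_cvg0 (T : Type) (F : set_system T) {FF : Filter F} p (h : T -> V) :
  (\forall t \near F, lp m p (h t)) ->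
  (lpnorm m p (h t) @[t --> F] --> (0 : \bar R)%E) <->
  (nrm m p (h t) @[t --> F] --> (0 : R)).
Proof.
move=> lh; split=> [/fine_cvgP[] //|hh].
apply/fine_cvgP; split=> //; apply: filterS lh => t lt.
by rewrite lpE.
Qed.

Lemma CcP (f : V) : Cc f <-> exists2 s : seq X, uniq s & forall x, x \notin s -> f x = 0.
Proof.
split=> [ff|[s us h]].
  exists (finmap.enum_fset (fset_set [set x | f x != 0])); first exact: finmap.fset_uniq.
  move=> x; rewrite in_fset_set// => xs; apply/eqP; apply: contraNT xs.
  by move=> fx; rewrite inE.
apply: (@sub_finite_set _ _ [set` s]); last exact: finite_seq.
move=> x /= fx; apply: contraTT fx => xs; rewrite h ?eqxx//.
Qed.

Lemma Cc_sub (f g : V) : Cc f -> (forall x, f x = 0 -> g x = 0) -> Cc g.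
Proof.
move=> cf fg; apply: (sub_finite_set _ cf) => x /=; apply: contra_neq; exact: fg.
Qed.

Lemma CcD (f g : V) : Cc f -> Cc g -> Cc (f + g).
Proof.
move=> cf cg; apply: (@sub_finite_set _ _ ([set x | f x != 0] `|` [set x | g x != 0])).
  move=> x /=; have [fx|] := eqVneq (f x) 0; last by left.
  have [gx|] := eqVneq (g x) 0; last by right.
  by rewrite fctE fx gx addr0 eqxx.
by rewrite finite_setU.
Qed.

Lemma CcZ (a : R[i]) (f : V) : Cc f -> Cc (a *: f).
Proof. by move=> cf; apply: (Cc_sub cf) => x fx; rewrite fctE fx scaler0. Qed.

Lemma Cc0 : Cc (0 : V).
Proof. by apply/CcP; exists [::]. Qed.

Lemma CcB (f g : V) : Cc f -> Cc g -> Cc (f - g).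
Proof. by move=> cf cg; apply: CcD => //; rewrite -scaleN1r; exact: CcZ. Qed.

Lemma Cc_lp p (f : V) : 0 < p -> Cc f -> lp m p f.
Proof.
move=> p0 /CcP[s us hs].
set B := \sum_(x <- s) m x * cmod (f x) `^ p.
have t0 x : 0 <= m x * cmod (f x) `^ p by rewrite mulr_ge0 ?powR_ge0 ?(ltW (m_gt0 _)).
have B0 : 0 <= B by apply: sumr_ge0.
have [|//] := (@nrm_leP _ _ _ m_gt0 p f (B `^ p^-1) p0 (powR_ge0 _ _)).2 .
move=> s' us'; rewrite -powRrM mulVf ?gt_eqF// powRr1//.
rewrite (bigID (fun x => x \in s))/= [X in _ + X]big1 ?addr0; last first.
  by move=> x /hs ->; rewrite Normc.normc0 powR0 ?gt_eqF ?mulr0.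
exact: ler_sum_mem.
Qed.

(** [g] is the truncation of [f] to a list whose partial sum is within $(e/2)^p$ of the supremum; a
    list disjoint from it can be appended without exceeding that supremum, so it carries at most
    this mass. *)
Lemma Cc_dense p (f : V) (e : R) : 0 < p -> lp m p f -> 0 < e ->
  exists g, [/\ Cc g, forall x, cmod (g x) <= cmod (f x), lp m p (f - g) &
   nrm m p (f - g) < e].
Proof.
move=> p0 lf e0.
have t0 x : 0 <= m x * cmod (f x) `^ p by rewrite mulr_ge0 ?powR_ge0 ?(ltW (m_gt0 _)).
set A := [set \sum_(x <- s) m x * cmod (f x) `^ p | s in [set s : seq X | uniq s]].
have A0 : A !=set0 by exists (\sum_(x <- [::]) m x * cmod (f x) `^ p), [::].
have ubA : has_sup A.
  split=> //; exists (nrm m p f `^ p) => _ [s us <-]; exact: nrm_sum.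
have d0 : 0 < (e / 2) `^ p by rewrite powR_gt0// divr_gt0.
have [_ [s us <-] hs] := sup_adherent d0 ubA.
pose g : V := fun x => if x \in s then f x else 0.
exists g.
have [] : lp m p (f - g) /\ nrm m p (f - g) <= e / 2.
  apply/(nrm_leP m_gt0) => //; first by rewrite ltW// divr_gt0.
  move=> s' us'.
  have -> : \sum_(x <- s') m x * cmod ((f - g) x) `^ p =
     \sum_(x <- [seq x <- s' | x \notin s]) m x * cmod (f x) `^ p.
    rewrite big_filter [RHS]big_mkcond/=; apply: eq_bigr => x _.
    rewrite !fctE /g; case: ifP => /= _; last by rewrite subr0.
    by rewrite subrr Normc.normc0 powR0 ?gt_eqF ?mulr0.
  have us'' : uniq (s ++ [seq x <- s' | x \notin s]).
    rewrite cat_uniq us filter_uniq//= andbT.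
    by apply/hasPn => x; rewrite mem_filter => /andP[].
  have : \sum_(x <- s ++ [seq x <- s' | x \notin s]) m x * cmod (f x) `^ p <= sup A.
    by apply: sup_ubound; [case: ubA|exists (s ++ [seq x <- s' | x \notin s])].
  rewrite big_cat/= -lerBrDl => /le_trans; apply.
  by move: hs; rewrite ltrBlDr -ltrBlDl => /ltW.
move=> l1 n1; split=> //.
- apply/CcP; exists s => // x /negPf xs; by rewrite /g xs.
- by move=> x; rewrite /g; case: ifP => // _; rewrite Normc.normc0 cmod_ge0.
- by rewrite (le_lt_trans n1)// ltr_pdivrMr// ltr_pMr// ltr1n.
Qed.

End lp_limits.

(** * The uniform boundedness principle *)

Lemma lt2_absurd (R : realFieldType) (a b c j z : R) :
  z <= a + b -> a < j -> b < j -> z = 2 * c -> j <= c -> False.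
Proof. lra. Qed.

Section bounded_operators.
Variables (R : realType) (X : choiceType) (m : X -> R).
Hypothesis m_gt0 : forall x, 0 < m x.
Notation V := (X -> R[i]).

Lemma right0P (h : R -> V) p : (forall t, 0 < t -> lp m p (h t)) ->
  (lpnorm m p (h t) @[t --> 0^'+] --> (0 : \bar R)%E) <->
  (forall e, 0 < e -> exists2 d, 0 < d & forall t, 0 < t -> t < d -> nrm m p (h t) < e).
Proof.
move=> lh; have nl : \forall t \near 0^'+, lp m p (h t).
  by near=> t; apply: lh; near: t; exact: nbhs_right_gt.
rewrite lpnorm_cvg0//; split=> [H e e0|H].
  have [d /= d0 D] := (cvgr0Pnorm_lt _).1 H e e0; exists d => // t t0 td.
  have := D t; rewrite /= sub0r normrN gtr0_norm// => /(_ td t0).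
  by rewrite ger0_norm ?nrm_ge0.
apply/cvgr0Pnorm_lt => e e0; have [d d0 D] := H e e0.
near=> t; rewrite ger0_norm ?nrm_ge0// D//.
Unshelve. all: by end_near. Qed.

Section op.
Variable p : R.
Hypothesis p1 : 1 <= p.
Let p0 : 0 < p. Proof. exact: lt_le_trans p1. Qed.
Notation L := (lp m p).
Notation N := (nrm m p).

Lemma bounded_operatorP (T : V -> V) : bounded_operator m p T ->
  [/\ forall f, L f -> L (T f),
      forall (a : R[i]) f g, L f -> L g -> T (a *: f + g) = a *: T f + T g
    & exists2 K, 0 <= K & forall f, L f -> N (T f) <= K * N f].
Proof.
move=> [h1 h2 [K h3]]; split=> //; exists `|K| => // f lf.
have := h3 f lf; rewrite !lpE//; last exact: h1.
rewrite -EFinM lee_fin => /le_trans; apply.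
by rewrite ler_wpM2r ?nrm_ge0// ler_norm.
Qed.

Section lin.
Variable T : V -> V.
Hypothesis Tlin : forall (a : R[i]) f g, L f -> L g -> T (a *: f + g) = a *: T f + T g.

Lemma lin0 : T 0 = 0.
Proof.
have [l0 _] := @lp0 R X m m_gt0 p p0.
by have := Tlin (-1) l0 l0; rewrite scaler0 addr0 scaleN1r addNr.
Qed.

Lemma linD f g : L f -> L g -> T (f + g) = T f + T g.
Proof. by move=> lf lg; have := Tlin 1 lf lg; rewrite !scale1r. Qed.

Lemma linZ a f : L f -> T (a *: f) = a *: T f.
Proof.
move=> lf; have [l0 _] := @lp0 R X m m_gt0 p p0.
by have := Tlin a lf l0; rewrite lin0 !addr0.
Qed.

Lemma linB f g : L f -> L g -> T (f - g) = T f - T g.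
Proof.
move=> lf lg; have [lN _] := lpN m_gt0 p0 lg.
by rewrite linD// -scaleN1r linZ// scaleN1r.
Qed.
End lin.

(* Gliding hump: a state [(x, d)] promises that all later perturbations of [x] have total
   norm at most [2 d], with [d] so small that they cannot destroy [j <= N (T k x)]. *)
Lemma banach_steinhaus (T : nat -> V -> V) :
  (forall k, bounded_operator m p (T k)) ->
  (forall f, L f -> exists B, forall k, N (T k f) <= B) ->
  exists2 K, 0 <= K & forall k f, L f -> N (T k f) <= K * N f.
Proof.
move=> Tb pb; apply: contrapT => unb.
have unb' K : 0 <= K -> exists k f, L f /\ K * N f < N (T k f).
  move=> K0; apply: contrapT => h; apply: unb; exists K => // k f lf.
  rewrite leNgt; apply/negP => hh; apply: h; by exists k, f.
have TL k f : L f -> L (T k f) by have [h _ _] := Tb k; exact: h.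
have Tlin k := let: And3 _ h _ := bounded_operatorP (Tb k) in h.
have [Kb Kb0 KbP] : exists2 Kb : nat -> R, forall k, 0 <= Kb k &
   forall k f, L f -> N (T k f) <= Kb k * N f.
  have h k : exists K, 0 <= K /\ forall f, L f -> N (T k f) <= K * N f.
    by have [_ _ [K K0 KP]] := bounded_operatorP (Tb k); exists K.
  have [Kb H] := choice h; exists Kb => k; by have [] := H k.
(* The promise is conditional so that [choice] applies to every state; on invalid ones the value
   [(0, 0)] is a dummy. *)
have step (s : nat * (V * R)) : exists s' : V * R, L s.2.1 -> 0 < s.2.2 ->
   [/\ L s'.1, 0 < s'.2, s'.2 <= s.2.2 / 2, N (s'.1 - s.2.1) <= s.2.2 &
       exists k, s.1%:R <= N (T k s'.1) /\ Kb k * (2 * s'.2) <= 1].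
  case: s => j [x d] /=.
  have [lx|] := pselect (L x); last by exists (0, 0).
  have [d0|] := boolP (0 < d); last by exists (0, 0).
  have [k [f [lf hf]]] := @unb' (j%:R / d) (divr_ge0 (ler0n _ _) (ltW d0)).
  have Nf0 : 0 < N f.
    rewrite lt_neqAle nrm_ge0 andbT; apply/eqP => h.
    have f0 := nrm_eq0 m_gt0 p0 lf (esym h); move: hf.
    by rewrite f0 (lin0 (Tlin k)) (lp0 m_gt0 p0).2 mulr0 ltxx.
  pose c : R[i] := (d / N f)%:C%C; pose g : V := c *: f.
  have cc : cmod c = d / N f by rewrite cmod_real ger0_norm// divr_ge0 ?ltW.
  have [lg ng] := lpZ m_gt0 c p0 lf; rewrite -/g cc divfK ?gt_eqF// in lg ng.
  have Tg : j%:R <= N (T k g).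
    rewrite (linZ (Tlin k))// (lpZ m_gt0 c p0 (TL k _ lf)).2 cc.
    rewrite mulrAC ler_pdivlMr// -ler_pdivrMl// mulrC mulrAC; exact: ltW.
  have [l1 _] := lpD m_gt0 p1 lx lg; have [l2 _] := lpB m_gt0 p1 lx lg.
  (* As $T_k(x+g)-T_k(x-g)=2T_kg$ has norm at least $2j$, one of the two points $x\pm g$ has image
     of norm at least $j$. *)
  have [y [ly ny Ty]] : exists y, [/\ L y, N (y - x) <= d & j%:R <= N (T k y)].
    have [h|h] := leP j%:R (N (T k (x + g))).
      by exists (x + g); split=> //; rewrite addrC addKr ng.
    exists (x - g); split; [exact: l2| |].
      by rewrite addrC addKr (lpN m_gt0 p0 lg).2 ng.
    rewrite leNgt; apply/negP => h'.
    have [_ h2] := lpB m_gt0 p1 (TL k _ l1) (TL k _ l2).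
    have : N (T k (x + g) - T k (x - g)) = 2 * N (T k g).
      rewrite -(linB (Tlin k))// (_ : x + g - (x - g) = (2%:C%C : R[i]) *: g).
        by rewrite (linZ (Tlin k))// (lpZ m_gt0 _ p0 (TL k _ lg)).2 cmod_real ger0_norm.
      by apply/funext => z; rewrite !fctE /= -[_ *: _]/(_ * _) rmorph_nat; ring.
    by move=> h3; exact: lt2_absurd h2 h h' h3 Tg.
  (* Halving makes the later moves sum to at most [2 * d']; the second entry makes [T k] move by at
     most 1 under all of them. *)
  pose d' := Num.min (d / 2) (1 + 2 * Kb k)^-1.
  have K1 : 0 < 1 + 2 * Kb k by rewrite ltr_wpDr// mulr_ge0.
  exists (y, d') => _ _; split=> //=.
  - by rewrite lt_min divr_gt0//= invr_gt0.
  - by rewrite ge_min lexx.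
  exists k; split=> //.
  rewrite mulrCA mulrA; apply: (@le_trans _ _ ((2 * Kb k) * (1 + 2 * Kb k)^-1)).
    by rewrite ler_wpM2l ?mulr_ge0// ge_min lexx orbT.
  by rewrite ler_pdivrMr// mul1r lerDr.
have [st stP] := choice step.
pose s := fix s n := if n is n'.+1 then st (n', s n') else ((0, 1) : V * R).
have sP n : L (s n).1 /\ 0 < (s n).2.
  elim: n => [|n [h1 h2]]; first by split=> //=; have [] := lp0 m_gt0 p0.
  by have [] := stP (n, s n) h1 h2.
have sS n : [/\ (s n.+1).2 <= (s n).2 / 2, N ((s n.+1).1 - (s n).1) <= (s n).2 &
   exists k, n%:R <= N (T k (s n.+1).1) /\ Kb k * (2 * (s n.+1).2) <= 1].
  by have [h1 h2] := sP n; have [] := stP (n, s n) h1 h2.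
(* Subtracting the tail [2 * (s (k + n)).2] makes the bound inductive: halving releases at least the
   length of the next move. *)
have dist n k : N ((s (k + n)%N).1 - (s n).1) <= 2 * (s n).2 - 2 * (s (k + n)%N).2.
  elim: k => [|k IH].
    by rewrite !add0n !subrr (lp0 m_gt0 p0).2.
  have [h1 h2 _] := sS (k + n)%N; rewrite addSn.
  have [l1 _] := lpB m_gt0 p1 (sP (k + n).+1).1 (sP (k + n)%N).1.
  have [l2 _] := lpB m_gt0 p1 (sP (k + n)%N).1 (sP n).1.
  have [_] := lpD m_gt0 p1 l1 l2.
  rewrite addrA subrK => h3; lra.
have dist' n k : (n <= k)%N -> N ((s k).1 - (s n).1) <= 2 * (s n).2.
  move=> nk; have := dist n (k - n)%N; rewrite subnK// => /le_trans; apply.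
  have [_ h] := sP k; lra.
have dn n : (s n).2 <= 2 ^- n.
  elim: n => [|n IH]; first by rewrite expr0 invr1.
  have [h _ _] := sS n; apply: (le_trans h).
  by rewrite exprS invfM mulrC ler_wpM2l ?invr_ge0.
have dsmall (e : R) : 0 < e -> exists n, forall k, (n <= k)%N -> 2 * (s k).2 < e.
  move=> e0; have e2 : 0 < e / 2 by rewrite divr_gt0.
  have := @cvg_expr R 2^-1; rewrite ger0_norm ?invr_ge0// invf_lt1 ?ltr1n// => /(_ isT).
  move=> /cvgr0Pnorm_lt/(_ _ e2)[n _ H]; exists n => k /H /=.
  rewrite ger0_norm ?exprn_ge0 ?invr_ge0// exprVn => h.
  have := dn k; lra.
have cau : nrm_cauchy m p (fun n => (s n).1).
  move=> e e0; have e2 : 0 < e / 2 by rewrite divr_gt0.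
  have [n H] := dsmall _ e2.
  exists n => i j ni nj.
  have [l1 _] := lpB m_gt0 p1 (sP i).1 (sP n).1.
  have [l2 _] := lpB m_gt0 p1 (sP j).1 (sP n).1.
  have [_] := lpB m_gt0 p1 l1 l2.
  rewrite (_ : (s i).1 - (s n).1 - ((s j).1 - (s n).1) = (s i).1 - (s j).1); last first.
    by rewrite opprB addrA subrK.
  have := dist' n i ni; have := dist' n j nj; have := H n (leqnn n); lra.
have [x lx cx] := lp_complete m_gt0 p1 (fun n => (sP n).1) cau.
have [B HB] := pb x lx.
have close n : N (x - (s n).1) <= 2 * (s n).2.
  apply/ler_addgt0Pr => e e0.
  have [M HM] := (dist0P (fun k => nrm_ge0 m p ((s k).1 - x))).1 cx e e0.
  pose k := maxn M n.
  have := HM k (leq_maxl _ _); have := dist' n k (leq_maxr _ _).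
  have [l1 _] := lpB m_gt0 p1 (sP k).1 lx.
  have [l2 _] := lpB m_gt0 p1 (sP k).1 (sP n).1.
  have [_] := lpB m_gt0 p1 l2 l1.
  rewrite (_ : (s k).1 - (s n).1 - ((s k).1 - x) = x - (s n).1); last first.
    by rewrite opprB addrC addrA subrK.
  lra.
have B0 : 0 <= B by apply: le_trans (HB 0%N); exact: nrm_ge0.
(* The contradiction: $n\le\|T_ks_{n+1}\|\le\|T_kx\|+1\le B+1<n$. *)
pose n := Num.bound (B + 1).
have nB : B + 1 < n%:R.
  by have := @archi_boundP R (B + 1) (addr_ge0 B0 ler01).
have [_ _ [k [h1 h2]]] := sS n.
have [l1 _] := lpB m_gt0 p1 lx (sP n.+1).1.
have h3 := KbP k _ l1; have h4 := close n.+1; have h5 := HB k.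
have h6 : Kb k * N (x - (s n.+1).1) <= 1.
  by apply: le_trans h2; rewrite ler_wpM2l.
have [_] := lpB m_gt0 p1 (TL k _ lx) (TL k _ l1).
rewrite (linB (Tlin k))//; last exact: (sP n.+1).1.
rewrite subKr.
rewrite (linB (Tlin k)) in h3 => //; last exact: (sP n.+1).1.
lra.
Qed.

End op.
End bounded_operators.

(** * Euler's formula for semigroups *)

Lemma euler_arith (R : realFieldType) (K e x a b c d z : R) : 0 <= K ->
  x < e / (K + 2) -> a < e / (K + 2) -> b <= x -> c <= K * x -> d <= a + b ->
  z <= d + c -> z < e.
Proof.
move=> K0 xe ae bx cx dab zdc; have K2 : 0 < K + 2 by rewrite ltr_wpDl.
have eE : K * (e / (K + 2)) + 2 * (e / (K + 2)) = e by field; rewrite gt_eqF.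
have := ler_wpM2l K0 (ltW xe); lra.
Qed.

Section semigroups.
Variables (R : realType) (X : choiceType) (m : X -> R).
Hypothesis m_gt0 : forall x, 0 < m x.
Notation V := (X -> R[i]).
Variable p : R.
Hypothesis p1 : 1 <= p.
Let p0 : 0 < p. Proof. exact: lt_le_trans p1. Qed.
Notation L := (lp m p).
Notation N := (nrm m p).

Section semigroup.
Variable S : R -> V -> V.
Hypothesis SC0 : C0_semigroup m p S.

Lemma semig_lp t f : 0 <= t -> L f -> L (S t f).
Proof. by move=> t0; have [/(_ t t0)[+ _ _] _ _ _] := SC0; apply. Qed.

Lemma semig_lin t : 0 <= t -> forall (a : R[i]) f g, L f -> L g ->
  S t (a *: f + g) = a *: S t f + S t g.
Proof. by move=> t0; have [/(_ t t0)[_ + _] _ _ _] := SC0; apply. Qed.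

Lemma semig0 f : L f -> S 0 f = f.
Proof. by have [_ + _ _] := SC0; apply. Qed.

Lemma semigD s t f : 0 <= s -> 0 <= t -> L f -> S (s + t) f = S s (S t f).
Proof. by move=> s0 t0; have [_ _ + _] := SC0; apply. Qed.

Lemma semig_right f : L f -> forall e, 0 < e ->
  exists2 d, 0 < d & forall t, 0 < t -> t < d -> N (S t f - f) < e.
Proof.
move=> lf; have [_ _ _ h] := SC0; apply/right0P; last exact: h.
by move=> t t0; have [] := lpB m_gt0 p1 (semig_lp (ltW t0) lf) lf.
Qed.

(** Otherwise there are times $t_n\le1/(n+1)$ at which the operator norm exceeds $n+1$, although
    right continuity at 0 bounds every orbit along $t_n$; this contradicts uniform boundedness. *)
Lemma semig_bound0 : exists2 d, 0 < d & exists2 K, 1 <= K &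
  forall s f, 0 <= s -> s <= d -> L f -> N (S s f) <= K * N f.
Proof.
apply: contrapT => unb.
have unb' n : exists t : R, [/\ 0 <= t, t <= n.+1%:R^-1 &
    exists2 f, L f & n.+1%:R * N f < N (S t f)].
  apply: contrapT => h; apply: unb; exists n.+1%:R^-1; first by rewrite invr_gt0.
  exists n.+1%:R; first by rewrite ler1n.
  move=> s f s0 sn lf; rewrite leNgt; apply/negP => hh; apply: h.
  by exists s; split=> //; exists f.
have [t tP] := choice unb'.
have t0 n : 0 <= t n by have [] := tP n.
have Tb n : bounded_operator m p (S (t n)) by have [h _ _ _] := SC0; exact: h.
(* Continuity at 0 bounds all but finitely many terms by $\|f\|+1$; the finitely many others are
   simply added up. *)
have pb f : L f -> exists B, forall n, N (S (t n) f) <= B.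
  move=> lf; have [d d0 D] := semig_right lf ltr01.
  have [M _ HM] : \forall n \near \oo, n.+1%:R^-1 < d.
    have [k Hk] : exists k : nat, d^-1 < k%:R.
      exists (Num.bound d^-1); apply: archi_boundP; rewrite invr_ge0; exact: ltW.
    exists k => // n /= kn; rewrite invf_plt ?posrE//.
    by rewrite (lt_le_trans Hk)// ler_nat (leq_trans kn).
  exists (\sum_(i < M) N (S (t i) f) + (N f + 1)) => n.
  have [nM|Mn] := ltnP n M.
    rewrite (bigD1 (Ordinal nM))//= -addrA lerDl addr_ge0//.
      by apply: sumr_ge0 => i _; exact: nrm_ge0.
    by rewrite addr_ge0// nrm_ge0.
  apply: (@le_trans _ _ (N f + 1)); last first.
    by rewrite lerDr; apply: sumr_ge0 => i _; exact: nrm_ge0.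
  have [tn0|tn0] := leP (t n) 0.
    have -> : t n = 0 by apply/eqP; rewrite eq_le tn0 t0.
    by rewrite semig0// lerDl.
  have tnd : t n < d by have [_ h _] := tP n; exact: le_lt_trans h (HM n Mn).
  have [l1 _] := lpB m_gt0 p1 (semig_lp (t0 n) lf) lf.
  have [_] := lpD m_gt0 p1 l1 lf; rewrite subrK.
  have := D _ tn0 tnd; lra.
have [K K0 KP] := banach_steinhaus m_gt0 p1 Tb pb.
pose n := Num.bound K.
have [_ _ [f lf hf]] := tP n.
have := KP n f lf; rewrite leNgt => /negP; apply.
apply: le_lt_trans hf; rewrite ler_wpM2r ?nrm_ge0//.
apply: (@le_trans _ _ n%:R); last by rewrite ler_nat.
exact/ltW/archi_boundP.
Qed.

(** The semigroup law propagates the bound near 0 in steps of length [d]; [K ^+ n] suffices for [n]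
    steps because $K\ge1$. *)
Lemma semig_bound t : 0 <= t -> exists2 K, 0 <= K &
  forall s f, 0 <= s -> s <= t -> L f -> N (S s f) <= K * N f.
Proof.
move=> t0; have [d d0 [K K1 KP]] := semig_bound0.
have K0 : 0 <= K by apply: le_trans K1.
have aux n : forall s f, 0 <= s -> s <= n%:R * d -> L f -> N (S s f) <= K ^+ n * N f.
  elim: n => [|n IH] s f s0 sn lf.
    have -> : s = 0 by apply/eqP; rewrite eq_le s0 andbT; move: sn; rewrite mul0r.
    by rewrite semig0// expr0 mul1r.
  have [sd|ds] := leP s d.
    apply: le_trans (KP s f s0 sd lf) _.
    by rewrite ler_wpM2r ?nrm_ge0// ler_eXnr.
  have sd0 : 0 <= s - d by rewrite subr_ge0 ltW.
  rewrite -(subrKC d s) semigD//; last exact: ltW.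
  apply: le_trans (KP d _ (ltW d0) (lexx _) (semig_lp sd0 lf)) _.
  rewrite exprS -mulrA ler_wpM2l// IH//.
  by rewrite lerBlDr -[X in _ + X]mul1r -mulrDl -natr1 in sn *.
pose n := Num.bound (t / d).
exists (K ^+ n); first exact: exprn_ge0.
move=> s f s0 st lf; apply: aux => //; apply: (le_trans st).
rewrite -ler_pdivrMr//; apply/ltW/archi_boundP; exact: divr_ge0 (ltW d0).
Qed.

Section euler.
Variable J : R -> V -> V.
Hypothesis JL : forall h f, 0 < h -> L f -> L (J h f) /\ N (J h f) <= N f.
Hypothesis JB : forall h f g, 0 < h -> L f -> L g -> J h (f - g) = J h f - J h g.
Hypothesis JC : forall h t f, 0 < h -> 0 <= t -> L f -> J h (S t f) = S t (J h f).
Hypothesis J1 : forall f e, L f -> 0 < e ->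
  exists2 d, 0 < d & forall h, 0 < h -> h < d -> N (J h f - f) < e.
(* Elements [J h f] lie in the domain of the generator; its value there is
   [h^-1 * (J h f - f)]. *)
Hypothesis Jgen : forall h f, 0 < h -> L f -> forall e, 0 < e ->
  exists2 d, 0 < d & forall t, 0 < t -> t < d ->
    N (S t (J h f) - J h f - (t / h)%:C%C *: (J h f - f)) <= t * e.
(** The resolvent identity, in the form $J_t-1=-tJ_tH$ on the range of $J_h$, with
    $HJ_hf=h^{-1}(f-J_hf)$. *)
Hypothesis JR : forall h t f, 0 < h -> 0 < t -> L f ->
  J t (J h f) - J h f = (t / h)%:C%C *: J t (J h f - f).

Lemma iterJ h n f : 0 < h -> L f -> L (iter n (J h) f) /\ N (iter n (J h) f) <= N f.
Proof.
move=> h0 lf; elim: n => [|n [l1 n1]]; first by [].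
by have [l2 n2] := JL h0 l1; split; [exact: l2|exact: le_trans n2 n1].
Qed.

Lemma telescoping h t K n f : 0 < h -> h *+ n <= t ->
  (forall s f, 0 <= s -> s <= t -> L f -> N (S s f) <= K * N f) -> L f ->
  N (S (h *+ n) f - iter n (J h) f) <= n%:R * (K * N (S h f - J h f)).
Proof.
move=> h0 hnt KP lf; have hn0 k : 0 <= h *+ k by rewrite mulrn_wge0 ?ltW.
elim: n hnt => [|n IH] hnt.
  by rewrite mulr0n semig0//= subrr (lp0 m_gt0 p0).2 mul0r.
have hnt' : h *+ n <= t by apply: le_trans hnt; rewrite mulrSr lerDl ltW.
have lS := semig_lp (hn0 n) lf.
have [lJ _] := iterJ n h0 lf.
have lSh := semig_lp (ltW h0) lf; have [lJh _] := JL h0 lf.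
(* One telescoping step, in which [J h] and [S] are exchanged by [JC]: the old error passes through
   a contraction, the new local error through [S (h *+ n)]. *)
have -> : S (h *+ n.+1) f - iter n.+1 (J h) f =
   J h (S (h *+ n) f - iter n (J h) f) + S (h *+ n) (S h f - J h f).
  rewrite JB// (linB m_gt0 p1 (semig_lin (hn0 n)))// JC// mulrSr.
  by rewrite semigD// ?(ltW h0)//= [RHS]addrC addrA subrK.
have [l1 _] := lpB m_gt0 p1 lS lJ; have [l2 _] := lpB m_gt0 p1 lSh lJh.
have [l3 n3] := JL h0 l1.
apply: le_trans (lpD m_gt0 p1 l3 (semig_lp (hn0 n) l2)).2 _.
rewrite -natr1 mulrDl mul1r; apply: lerD; first exact: le_trans n3 (IH hnt').
exact: KP _ _ (hn0 n) hnt' l2.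
Qed.

(** Consistency and stability: on the dense range of $J_h$ the $n+1$ local errors add up to $t\cdot
    o(1)$, and uniform boundedness of $S(t)$ and of the iterates carries convergence to all of
    $\ell^p$. *)
Lemma euler_formula t f : 0 < t -> L f ->
  N (S t f - iter n.+1 (J (t / n.+1%:R)) f) @[n --> \oo] --> (0 : R).
Proof.
move=> t0 lf; have [K K0 KP] := semig_bound (ltW t0).
have hn0 n : 0 < t / n.+1%:R by rewrite divr_gt0.
have small d : 0 < d -> exists M, forall n, (M <= n)%N -> t / n.+1%:R < d.
  move=> d0; exists (Num.bound (t / d)) => n Mn.
  rewrite ltr_pdivrMr// mulrC -ltr_pdivrMr//.
  apply: lt_le_trans (archi_boundP (divr_ge0 (ltW t0) (ltW d0))) _.
  by rewrite ler_nat (leq_trans Mn).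
(* On the range of [J h] the local error is [o(t/n)]. *)
have dom h g : 0 < h -> L g -> forall e, 0 < e -> exists M, forall n, (M <= n)%N ->
   N (S t (J h g) - iter n.+1 (J (t / n.+1%:R)) (J h g)) < e.
  move=> h0 lg e e0; have [lJ _] := JL h0 lg.
  have [lk _] := lpB m_gt0 p1 lJ lg.
  (* With local tolerance [e / c], the accumulated error is $e\,tK(1+h^{-1})/c<e$; the summand 1
     makes this strict. *)
  pose c := 1 + t * (K * (1 + h^-1)).
  have c0 : 0 < c.
    by rewrite ltr_pwDl// !mulr_ge0 ?addr_ge0 ?invr_ge0 ?(ltW t0, ltW h0).
  have ec : 0 < e / c by rewrite divr_gt0.
  have [d1 d10 D1] := Jgen h0 lg ec; have [d2 d20 D2] := J1 lk ec.
  have [M1 HM1] := small _ d10; have [M2 HM2] := small _ d20.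
  exists (maxn M1 M2) => n; rewrite geq_max => /andP[/HM1 s1 /HM2 s2].
  have tn : t / n.+1%:R *+ n.+1 = t by rewrite -mulr_natr divfK.
  have := @telescoping (t / n.+1%:R) t K n.+1 (J h g) (hn0 n).
  rewrite tn => /(_ (lexx _) KP lJ) h1; apply: le_lt_trans h1 _.
  set s := t / n.+1%:R in s1 s2 *.
  have s0 : 0 < s := hn0 n.
  have e1 := D1 s s0 s1; have e2 := D2 s s0 s2.
  have [ls _] := JL s0 lJ; have lS := semig_lp (ltW s0) lJ.
  have [lsk _] := JL s0 lk.
  (* Both $S_s$ and $J_s$ agree with $1-sH$ to first order: the first bracket is the error of the
     generator, the second that of $J_s$, rewritten by the resolvent identity. *)
  have E : S s (J h g) - J s (J h g) =
     (S s (J h g) - J h g - (s / h)%:C%C *: (J h g - g)) -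
     (s / h)%:C%C *: (J s (J h g - g) - (J h g - g)).
    rewrite [X in _ = _ - X]scalerBr -JR//.
    set a := S _ _; set b := J s _; set c' := J h g; set d := _ *: _.
    by apply/funext => x; rewrite !fctE; ring.
  have [l1 n1] := lpZ m_gt0 (s / h)%:C%C p0 lk.
  have [l2 _] := lpB m_gt0 p1 lS lJ; have [l3 _] := lpB m_gt0 p1 l2 l1.
  have [l4 _] := lpB m_gt0 p1 lsk lk.
  have [l5 n5] := lpZ m_gt0 (s / h)%:C%C p0 l4.
  have [_] := lpB m_gt0 p1 l3 l5; rewrite -E n5 cmod_real.
  rewrite ger0_norm; last exact: divr_ge0 (ltW s0) (ltW h0).
  move=> h2.
  have h3 : N (S s (J h g) - J s (J h g)) <= s * ((e / c) * (1 + h^-1)).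
    apply: (le_trans h2).
    rewrite mulrDr mulr1 mulrDr; apply: lerD => //.
    by rewrite -[leLHS]mulrA ler_wpM2l ?(ltW s0)// mulrC ler_wpM2r ?invr_ge0 ?(ltW h0)// ltW.
  apply: (@le_lt_trans _ _ (n.+1%:R * (K * (s * ((e / c) * (1 + h^-1)))))).
    by rewrite ler_wpM2l// ler_wpM2l.
  have -> : n.+1%:R * (K * (s * ((e / c) * (1 + h^-1)))) = e * ((t * (K * (1 + h^-1))) / c).
    have -> : t = n.+1%:R * s by rewrite mulrC divfK.
    by ring.
  by rewrite gtr_pMr// ltr_pdivrMr// mul1r /c ltrDr.
apply/dist0P => [n|e e0]; first exact: nrm_ge0.
(* Replacing $f$ by $J_hf$ costs $K\|J_hf-f\|$ under $S_t$ and $\|J_hf-f\|$ under the contractive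
   iterates; the last share is the error on the range of $J_h$. *)
have c0 : 0 < K + 2 by rewrite ltr_wpDl.
have ec : 0 < e / (K + 2) by rewrite divr_gt0.
have [d d0 D] := J1 lf ec.
pose h := d / 2.
have h0 : 0 < h by rewrite divr_gt0.
have hd : h < d by rewrite ltr_pdivrMr// ltr_pMr// ltr1n.
have close := D h h0 hd.
have [M HM] := dom h f h0 lf _ ec; exists M => n Mn.
have [lJ _] := JL h0 lf; have [lk _] := lpB m_gt0 p1 lJ lf.
have h1 := HM n Mn.
have [li _] := iterJ n.+1 (hn0 n) lJ; have [li' _] := iterJ n.+1 (hn0 n) lf.
have [_ h2] := iterJ n.+1 (hn0 n) lk.
have iB k : iter k (J (t / n.+1%:R)) (J h f - f) =
    iter k (J (t / n.+1%:R)) (J h f) - iter k (J (t / n.+1%:R)) f.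
  elim: k => [//|k IH]; rewrite !iterS IH; apply: JB; first exact: hn0.
    exact: (iterJ k (hn0 n) lJ).1.
  exact: (iterJ k (hn0 n) lf).1.
rewrite iB in h2.
have h3 := KP t _ (ltW t0) (lexx _) lk.
rewrite (linB m_gt0 p1 (semig_lin (ltW t0)))// in h3.
have lS1 := semig_lp (ltW t0) lJ; have lS2 := semig_lp (ltW t0) lf.
have [l4 _] := lpB m_gt0 p1 lS1 lS2.
have [l5 _] := lpB m_gt0 p1 lS1 li.
have [l6 _] := lpB m_gt0 p1 li li'.
have [l7 n7] := lpD m_gt0 p1 l5 l6.
have [_] := lpB m_gt0 p1 l7 l4.
rewrite (_ : _ + _ - _ = S t f - iter n.+1 (J (t / n.+1%:R)) f); last first.
  by rewrite addrA subrK; apply/funext => x; rewrite !fctE; ring.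
exact: euler_arith K0 close h1 h2 h3 n7.
Qed.

End euler.
End semigroup.
End semigroups.

(** * Unconditional sums *)

Section sums.
Variables (R : realType) (T : choiceType).
Implicit Types (f g a b : T -> R).

Definition asum f := exists B : R, forall s : seq T, uniq s -> \sum_(x <- s) `|f x| <= B.
Definition nsum f : R := fine (\esum_(x in [set: T]) (f x)%:E).

Lemma asum_le f g : (forall x, `|f x| <= `|g x|) -> asum g -> asum f.
Proof.
move=> fg [B H]; exists B => s us; apply: le_trans (H s us).
by apply: ler_sum => x _.
Qed.

Lemma asumD f g : asum f -> asum g -> asum (fun x => f x + g x).
Proof.
move=> [B HB] [C HC]; exists (B + C) => s us.
apply: le_trans (lerD (HB s us) (HC s us)); rewrite -big_split/=.
by apply: ler_sum => x _; exact: ler_normD.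
Qed.

Lemma asumZ k f : asum f -> asum (fun x => k * f x).
Proof.
move=> [B HB]; exists (`|k| * B) => s us.
under eq_bigr do rewrite normrM.
by rewrite -mulr_sumr ler_wpM2l// HB.
Qed.

Lemma asumN f : asum f -> asum (fun x => - f x).
Proof. by apply: asum_le => x; rewrite normrN. Qed.

Lemma asumB f g : asum f -> asum g -> asum (fun x => f x - g x).
Proof. by move=> sf sg; apply: asumD => //; exact: asumN. Qed.

Lemma asum_pos f : asum f -> asum (fun x => Num.max (f x) 0).
Proof.
apply: asum_le => x; case: (leP (f x) 0) => [fx|fx]; rewrite ?normr0//.
Qed.

Lemma esum_nsum f : (forall x, 0 <= f x) -> asum f ->
  \esum_(x in [set: T]) (f x)%:E = (nsum f)%:E.
Proof.
move=> f0 [B HB]; rewrite /nsum fineK// ge0_fin_numE; last first.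
  by apply: esum_ge0 => x _; rewrite lee_fin.
apply: (@le_lt_trans _ _ B%:E); last by rewrite ltry.
apply/esum_leP => // s us; apply: le_trans (HB s us).
by apply: ler_sum => x _; exact: ler_norm.
Qed.

Lemma nsum_leP f B : (forall x, 0 <= f x) -> asum f ->
  nsum f <= B <-> (forall s, uniq s -> \sum_(x <- s) f x <= B).
Proof. by move=> f0 sf; rewrite -esum_leP// esum_nsum// lee_fin. Qed.

Lemma nsum_sum f s : (forall x, 0 <= f x) -> asum f -> uniq s ->
  \sum_(x <- s) f x <= nsum f.
Proof. by move=> f0 sf us; apply: (nsum_leP _ f0 sf).1. Qed.

Lemma nsum_ge0 f : (forall x, 0 <= f x) -> 0 <= nsum f.
Proof. by move=> f0; rewrite /nsum fine_ge0// esum_ge0// => x _; rewrite lee_fin. Qed.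

Lemma nsumD f g : (forall x, 0 <= f x) -> asum f -> (forall x, 0 <= g x) -> asum g ->
  nsum (fun x => f x + g x) = nsum f + nsum g.
Proof.
move=> f0 sf g0 sg; apply: EFin_inj.
rewrite EFinD -!esum_nsum//; last 2 first.
- by move=> x; rewrite addr_ge0.
- exact: asumD.
by rewrite -esumD// => x _; rewrite lee_fin.
Qed.

Lemma nsumZ k f : 0 <= k -> (forall x, 0 <= f x) -> asum f ->
  nsum (fun x => k * f x) = k * nsum f.
Proof.
move=> + f0 sf; rewrite le_eqVlt => /predU1P[<-|k0].
  apply/eqP; rewrite mul0r eq_le nsum_ge0 ?andbT; last by move=> x; rewrite mul0r.
  apply/nsum_leP => [x||s us]; [by rewrite mul0r|exact: asumZ|].
  by rewrite big1// => x _; rewrite mul0r.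
have kf0 x : 0 <= k * f x by rewrite mulr_ge0// ltW.
have skf := asumZ k sf.
apply/eqP; rewrite eq_le; apply/andP; split.
  apply/nsum_leP => // s us; rewrite -mulr_sumr ler_wpM2l ?(ltW k0)//; exact: nsum_sum.
rewrite mulrC -ler_pdivlMr//; apply/nsum_leP => // s us.
rewrite ler_pdivlMr// mulrC mulr_sumr; exact: nsum_sum.
Qed.

(** [rsum] is defined by the positive and negative parts, but any splitting into nonnegative
    summable families gives the same value; linearity rests on this. *)
Lemma rsum_diff a b : (forall x, 0 <= a x) -> asum a -> (forall x, 0 <= b x) -> asum b ->
  rsum (fun x => a x - b x) = nsum a - nsum b.
Proof.
move=> a0 sa b0 sb; have sf := asumB sa sb.
have sp := asum_pos sf; have sn := asum_pos (asumN sf).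
have p0 x : 0 <= Num.max (a x - b x) 0 by rewrite le_max lexx orbT.
have n0 x : 0 <= Num.max (- (a x - b x)) 0 by rewrite le_max lexx orbT.
rewrite /rsum -/(nsum _) -/(nsum (fun x => Num.max (- (a x - b x)) 0)).
apply/eqP; rewrite subr_eq addrAC eq_sym subr_eq -!nsumD//; apply/eqP; congr nsum.
apply/funext => x; case: (leP (a x - b x) 0) => h.
  by rewrite max_l ?oppr_ge0//; ring.
by rewrite max_r ?oppr_le0 ?(ltW h)//; ring.
Qed.

Lemma rsum_nsum f : (forall x, 0 <= f x) -> asum f -> rsum f = nsum f.
Proof.
move=> f0 sf; have z0 : asum (fun=> 0).
  by exists 0 => s _; rewrite big1// => x _; rewrite normr0.
have -> : f = (fun x => f x - 0) by apply/funext => x; rewrite subr0.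
rewrite rsum_diff//.
have -> : nsum (fun=> 0) = 0.
  by apply/eqP; rewrite eq_le nsum_ge0// andbT; apply/nsum_leP => // s _; rewrite big1.
by rewrite subr0; congr nsum; apply/funext => x; rewrite subr0.
Qed.

Lemma pos_neg f : f = (fun x => Num.max (f x) 0 - Num.max (- f x) 0).
Proof.
apply/funext => x; case: (leP (f x) 0) => h.
  by rewrite max_l ?oppr_ge0//; ring.
by rewrite max_r ?oppr_le0 ?(ltW h)//; ring.
Qed.

Lemma pos_ge0 f x : 0 <= Num.max (f x) 0.
Proof. by rewrite le_max lexx orbT. Qed.

Lemma rsumD f g : asum f -> asum g -> rsum (fun x => f x + g x) = rsum f + rsum g.
Proof.
move=> sf sg; rewrite (pos_neg f) (pos_neg g).
have pf := asum_pos sf; have nf := asum_pos (asumN sf).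
have pg := asum_pos sg; have ng := asum_pos (asumN sg).
have h a b : (forall x, 0 <= a x) -> (forall x, 0 <= b x) -> forall x : T, 0 <= a x + b x.
  by move=> a0 b0 x; rewrite addr_ge0.
have P := pos_ge0 f; have Q := pos_ge0 g.
have P' := pos_ge0 (fun x => - f x); have Q' := pos_ge0 (fun x => - g x).
rewrite [X in _ = X + _]rsum_diff// [X in _ = _ + X]rsum_diff//.
rewrite (_ : (fun x => _) = fun x => (Num.max (f x) 0 + Num.max (g x) 0) -
    (Num.max (- f x) 0 + Num.max (- g x) 0)); last by apply/funext => x; ring.
rewrite rsum_diff; [|exact: h|exact: asumD|exact: h|exact: asumD].
by rewrite !nsumD//; ring.
Qed.

Lemma rsumN f : asum f -> rsum (fun x => - f x) = - rsum f.
Proof.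
move=> sf; have pf := asum_pos sf; have nf := asum_pos (asumN sf).
have P := pos_ge0 f; have P' := pos_ge0 (fun x => - f x).
rewrite [in RHS](pos_neg f) rsum_diff//.
rewrite (_ : (fun x => - f x) = fun x => Num.max (- f x) 0 - Num.max (f x) 0).
  by rewrite rsum_diff// opprB.
by apply/funext => x; rewrite {1}(pos_neg f); ring.
Qed.

Lemma rsumB f g : asum f -> asum g -> rsum (fun x => f x - g x) = rsum f - rsum g.
Proof. by move=> sf sg; rewrite rsumD ?rsumN//; exact: asumN. Qed.

Lemma rsumZ k f : asum f -> rsum (fun x => k * f x) = k * rsum f.
Proof.
move=> sf; have pf := asum_pos sf; have nf := asum_pos (asumN sf).
have P := pos_ge0 f; have P' := pos_ge0 (fun x => - f x).
have pos l : 0 <= l -> rsum (fun x => l * f x) = l * rsum f.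
  move=> l0; rewrite [in RHS](pos_neg f) rsum_diff//.
  rewrite (_ : (fun x => l * f x) = fun x => l * Num.max (f x) 0 - l * Num.max (- f x) 0).
    rewrite rsum_diff.
    - by rewrite !nsumZ// mulrBr.
    - by move=> x; rewrite mulr_ge0.
    - exact: asumZ.
    - by move=> x; rewrite mulr_ge0.
    - exact: asumZ.
  by apply/funext => x; rewrite {1}(pos_neg f) mulrBr.
have [k0|k0] := leP 0 k; first exact: pos.
rewrite (_ : (fun x => k * f x) = (fun x => - ((- k) * f x))).
  by rewrite rsumN ?pos ?oppr_ge0 ?(ltW k0)// ?mulNr ?opprK//; exact: asumZ.
by apply/funext => x; rewrite mulNr opprK.
Qed.

Lemma rsum_ge0 f : (forall x, 0 <= f x) -> 0 <= rsum f.
Proof.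
move=> f0; rewrite /rsum.
rewrite [X in _ - fine X]esum1 ?subr0.
  by rewrite fine_ge0// esum_ge0// => x _; rewrite lee_fin pos_ge0.
by move=> x _; rewrite max_r// oppr_le0.
Qed.

Lemma ler_rsum f g : asum f -> asum g -> (forall x, f x <= g x) -> rsum f <= rsum g.
Proof.
move=> sf sg fg; rewrite -subr_ge0 -rsumB//.
by apply: rsum_ge0 => x; rewrite subr_ge0.
Qed.

Lemma rsum_le f B : asum f ->
  (forall s : seq T, uniq s -> \sum_(x <- s) `|f x| <= B) -> rsum f <= B.
Proof.
move=> sf H; apply: (@le_trans _ _ (rsum (fun x => `|f x|))).
  by apply: ler_rsum => //; [apply: asum_le sf => x; rewrite normr_id|move=> x; exact: ler_norm].
rewrite rsum_nsum//; last by apply: asum_le sf => x; rewrite normr_id.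
by apply/nsum_leP => //; apply: asum_le sf => x; rewrite normr_id.
Qed.

Lemma asum_supp f (s : seq T) : uniq s -> (forall x, x \notin s -> f x = 0) -> asum f.
Proof.
move=> us fs; exists (\sum_(x <- s) `|f x|) => s' us'.
rewrite (bigID (fun x => x \in s))/= [X in _ + X]big1 ?addr0; last first.
  by move=> x /fs ->; rewrite normr0.
by apply: ler_sum_mem.
Qed.

End sums.

(** * Real forms *)

Section rform.
Variables (R : realType) (V : lmodType R[i]).

(** Models the real part of a nonnegative Hermitian form: [B] is linear over real scalars only,
    while the domain [W] is a complex subspace so that $if$ remains available. *)
Record rform (W : V -> Prop) (B : V -> V -> R) : Prop := RForm {
  rfW0 : W 0;
  rfWD : forall f g, W f -> W g -> W (f + g);
  rfWZ : forall (a : R[i]) f, W f -> W (a *: f);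
  rfD : forall f g h, W f -> W g -> W h -> B (f + g) h = B f h + B g h;
  rfZ : forall (t : R) f h, W f -> W h -> B (t%:C%C *: f) h = t * B f h;
  rfC : forall f g, W f -> W g -> B f g = B g f;
  rf_ge0 : forall f, W f -> 0 <= B f f }.

Section theory.
Variables (W : V -> Prop) (B : V -> V -> R).
Hypothesis rB : rform W B.

Lemma rfWN f : W f -> W (- f).
Proof. by move=> wf; rewrite -scaleN1r; exact: rfWZ rB _ _ wf. Qed.

Lemma rfWB f g : W f -> W g -> W (f - g).
Proof. by move=> wf wg; apply: (rfWD rB) => //; exact: rfWN. Qed.

Lemma rfN f h : W f -> W h -> B (- f) h = - B f h.
Proof.
move=> wf wh; have := rfZ rB (-1) wf wh.
by rewrite rmorphN1 scaleN1r mulN1r.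
Qed.

Lemma rfB f g h : W f -> W g -> W h -> B (f - g) h = B f h - B g h.
Proof. by move=> wf wg wh; rewrite (rfD rB)// ?rfN//; exact: rfWN. Qed.

Lemma rfDr h f g : W f -> W g -> W h -> B h (f + g) = B h f + B h g.
Proof.
move=> wf wg wh; rewrite (rfC rB wh (rfWD rB wf wg)) (rfD rB)//.
by rewrite (rfC rB wf wh) (rfC rB wg wh).
Qed.

Lemma rfBr h f g : W f -> W g -> W h -> B h (f - g) = B h f - B h g.
Proof.
move=> wf wg wh; rewrite (rfC rB wh (rfWB wf wg)) rfB//.
by rewrite (rfC rB wf wh) (rfC rB wg wh).
Qed.

Lemma rfZr (t : R) h f : W f -> W h -> B h (t%:C%C *: f) = t * B h f.
Proof.
by move=> wf wh; rewrite (rfC rB wh (rfWZ rB _ wf)) (rfZ rB)// (rfC rB wf wh).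
Qed.

Lemma rf0 h : W h -> B 0 h = 0.
Proof. by move=> wh; rewrite -(subrr h) rfB// subrr. Qed.

Lemma rf_sqD f g : W f -> W g -> B (f + g) (f + g) = B f f + 2 * B f g + B g g.
Proof.
move=> wf wg; have w := rfWD rB wf wg.
by rewrite (rfD rB)// !rfDr// (rfC rB wg wf); ring.
Qed.

Lemma rf_sqB f g : W f -> W g -> B (f - g) (f - g) = B f f - 2 * B f g + B g g.
Proof.
move=> wf wg; have w := rfWB wf wg.
by rewrite rfB// !rfBr// (rfC rB wg wf); ring.
Qed.

Lemma rf_sqBC f g : W f -> W g -> B (f - g) (f - g) = B (g - f) (g - f).
Proof. by move=> wf wg; rewrite !rf_sqB// (rfC rB wf wg); ring. Qed.

Lemma rf_CS f g : W f -> W g -> B f g ^+ 2 <= B f f * B g g.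
Proof.
move=> wf wg; have a0 := rf_ge0 rB wf; have c0 := rf_ge0 rB wg.
have h (t : R) : 0 <= B f f - 2 * (t * B f g) + t ^+ 2 * B g g.
  have wt : W (t%:C%C *: g) by exact: (rfWZ rB).
  have := rf_ge0 rB (rfWB wf wt).
  by rewrite rf_sqB// !rfZr// (rfZ rB)// (mulrA t t) -expr2.
(* The form may be degenerate: if $B(g,g)=0$ the quadratic is affine in $t$, and a nonzero slope
   would make it negative at the chosen $t$. Otherwise $t$ is the minimiser. *)
have [c1|c1] := leP (B g g) 0.
  have c2 : B g g = 0 by apply/eqP; rewrite eq_le c1.
  rewrite c2 in h *; rewrite mulr0.
  have [->|b0] := eqVneq (B f g) 0; first by rewrite expr0n.
  have := h ((B f f + 1) / B f g); rewrite mulr0 divfK//; lra.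
have := h (B f g / B g g).
have -> : B f f - 2 * (B f g / B g g * B f g) + (B f g / B g g) ^+ 2 * B g g =
  (B f f * B g g - B f g ^+ 2) / B g g by field; rewrite gt_eqF.
by rewrite pmulr_lge0 ?invr_gt0// subr_ge0.
Qed.

Lemma rf_CS_sqrt f g : W f -> W g -> `|B f g| <= Num.sqrt (B f f) * Num.sqrt (B g g).
Proof.
move=> wf wg; rewrite -sqrtrM ?(rf_ge0 rB)// -sqrtr_sqr ler_wsqrtr//.
exact: rf_CS.
Qed.

Lemma rf_triangle f g : W f -> W g ->
  Num.sqrt (B (f + g) (f + g)) <= Num.sqrt (B f f) + Num.sqrt (B g g).
Proof.
move=> wf wg; have a0 := rf_ge0 rB wf; have c0 := rf_ge0 rB wg.
rewrite -[leRHS]ger0_norm ?addr_ge0// -[leRHS]sqrtr_sqr ler_wsqrtr// sqrrD !sqr_sqrtr//.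
rewrite rf_sqD// lerD2r lerD2l -[leRHS]mulr_natl ler_wpM2l//.
exact: le_trans (ler_norm _) (rf_CS_sqrt wf wg).
Qed.

End theory.
End rform.

(** * The Euclidean inner product $\mathrm{Re}(z\overline w)$ on the complex plane *)

Section rdot.
Variable R : realType.
Implicit Types z w : R[i].

Definition rdot z w : R := complex.Re z * complex.Re w + complex.Im z * complex.Im w.

Lemma rdotD z z' w : rdot (z + z') w = rdot z w + rdot z' w.
Proof. by case: z z' w => [a b] [c d] [e f]; rewrite /rdot /=; ring. Qed.

Lemma rdotZ (t : R) z w : rdot (t%:C%C * z) w = t * rdot z w.
Proof. by case: z w => [a b] [c d]; rewrite /rdot /=; ring. Qed.

Lemma rdotC z w : rdot z w = rdot w z.
Proof. by rewrite /rdot mulrC (mulrC (complex.Im z)). Qed.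

Lemma rdotii z w : rdot ('i%C * z) ('i%C * w) = rdot z w.
Proof. by case: z w => [a b] [c d]; rewrite /rdot /=; ring. Qed.

Lemma rdotzz z : rdot z z = cmod z ^+ 2.
Proof. by case: z => a b; rewrite /rdot /= sqr_sqrtr ?addr_ge0 ?sqr_ge0// !expr2. Qed.

Lemma rdot_norm z w : `|rdot z w| <= cmod z * cmod w.
Proof.
rewrite -[leRHS]ger0_norm ?mulr_ge0 ?cmod_ge0//.
rewrite -ler_sqr ?nnegrE ?normr_ge0// !real_normK ?num_real// exprMn -!rdotzz.
case: z w => [a b] [c d]; rewrite /rdot /= -subr_ge0.
rewrite (_ : _ - _ = (a * d - b * c) ^+ 2) ?sqr_ge0//; ring.
Qed.

Lemma rdot_le z w : `|rdot z w| <= cmod z ^+ 2 + cmod w ^+ 2.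
Proof.
apply: (le_trans (rdot_norm z w)); have := cmod_ge0 z; have := cmod_ge0 w.
nra.
Qed.
End rdot.

(** * The real inner product of $\ell^2$ *)

Section l2.
Variables (R : realType) (X : choiceType) (m : X -> R).
Hypothesis m_gt0 : forall x, 0 < m x.
Notation V := (X -> R[i]).
Implicit Types f g h : V.

Definition dot f g : R := rsum (fun x => m x * rdot (f x) (g x)).

Lemma Re_l2dot f g : complex.Re (l2dot m f g) = dot f g.
Proof.
congr rsum; apply/funext => x.
by case: (f x) (g x) => [a b] [c d]; rewrite /rdot /=; ring.
Qed.

(** From $\mathrm{Im}(z\overline w)=\mathrm{Re}(z\,\overline{iw})$. A complex identity valid for all
    $g$ thus reduces to its real part, tested on $g$ and $ig$. *)
Lemma Im_l2dot f g : complex.Im (l2dot m f g) = dot f ('i%C *: g).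
Proof.
congr rsum; apply/funext => x; rewrite fctE -[_ *: _]/(_ * _).
by case: (f x) (g x) => [a b] [c d]; rewrite /rdot /=; ring.
Qed.

Lemma asum_l2 f : lp m 2 f -> asum (fun x => m x * cmod (f x) ^+ 2).
Proof.
move=> lf; exists (nrm m 2 f `^ 2) => s us.
have := @nrm_sum R X m m_gt0 2%:R f s (ltr0n R 2) lf us.
move=> h; apply: le_trans h; apply: ler_sum => x _.
have t0 : 0 <= m x * cmod (f x) ^+ 2.
  by apply: mulr_ge0; [exact/ltW|exact: sqr_ge0].
by rewrite ger0_norm// powR_mulrn// cmod_ge0.
Qed.

Lemma asum_dot f g : lp m 2 f -> lp m 2 g -> asum (fun x => m x * rdot (f x) (g x)).
Proof.
move=> lf lg; apply: asum_le (asumD (asum_l2 lf) (asum_l2 lg)) => x.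
rewrite -mulrDr !normrM ler_wpM2l// [leRHS]ger0_norm; last by apply: addr_ge0; exact: sqr_ge0.
exact: rdot_le.
Qed.

Lemma dot_rform : rform (lp m 2) dot.
Proof.
have p1 : 1 <= 2 :> R by rewrite ler1n.
have p0 : 0 < 2 :> R by [].
split.
- by have [] := lp0 m_gt0 p0.
- by move=> f g lf lg; have [] := lpD m_gt0 p1 lf lg.
- by move=> a f lf; have [] := lpZ m_gt0 a p0 lf.
- move=> f g h lf lg lh; rewrite /dot -rsumD; try exact: asum_dot.
  by congr rsum; apply/funext => x; rewrite fctE rdotD mulrDr.
- move=> t f h lf lh; rewrite /dot -rsumZ; try exact: asum_dot.
  by congr rsum; apply/funext => x; rewrite fctE rdotZ mulrCA.
- by move=> f g lf lg; congr rsum; apply/funext => x; rewrite rdotC.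
- move=> f lf; apply: rsum_ge0 => x.
  by rewrite rdotzz; apply: mulr_ge0; [exact/ltW|exact: sqr_ge0].
Qed.

Lemma dot_nrm f : lp m 2 f -> dot f f = nrm m 2 f ^+ 2.
Proof.
move=> lf; have e : (fun x => m x * rdot (f x) (f x)) = fun x => m x * cmod (f x) ^+ 2.
  by apply/funext => x; rewrite rdotzz.
have t0 x : 0 <= m x * cmod (f x) ^+ 2 by apply: mulr_ge0; [exact/ltW|exact: sqr_ge0].
have sf := asum_l2 lf.
rewrite /dot e rsum_nsum//.
have pw x : m x * cmod (f x) `^ 2 = m x * cmod (f x) ^+ 2.
  by rewrite powR_mulrn ?cmod_ge0.
apply/eqP; rewrite eq_le; apply/andP; split.
  apply/nsum_leP => // s us.
  rewrite -powR_mulrn ?nrm_ge0//.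
  under eq_bigr do rewrite -pw.
  exact: nrm_sum.
rewrite -(sqr_sqrtr (nsum_ge0 t0)) ler_sqr ?nnegrE ?nrm_ge0 ?sqrtr_ge0//.
have [|_ //] := (@nrm_leP _ _ _ m_gt0 2 f (Num.sqrt (nsum (fun x => m x * cmod (f x) ^+ 2)))
  (ltr0n R 2) (sqrtr_ge0 _)).2.
move=> s us; under eq_bigr do rewrite pw.
rewrite powR_mulrn ?sqrtr_ge0// sqr_sqrtr; last exact: nsum_ge0.
exact: nsum_sum.
Qed.

Lemma dot_CS f g : lp m 2 f -> lp m 2 g -> `|dot f g| <= nrm m 2 f * nrm m 2 g.
Proof.
move=> lf lg; have := rf_CS_sqrt dot_rform lf lg.
by rewrite !dot_nrm// !sqrtr_sqr (ger0_norm (nrm_ge0 _ _ f)) (ger0_norm (nrm_ge0 _ _ g)).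
Qed.

Lemma l2dotE f g : l2dot m f g = Complex (dot f g) (dot f ('i%C *: g)).
Proof. by rewrite -Re_l2dot -Im_l2dot; case: (l2dot m f g). Qed.

End l2.

(** * The form on finitely supported functions *)

Section qform.
Variables (R : realType) (X : choiceType) (m : X -> R).
Hypothesis m_gt0 : forall x, 0 < m x.
Variable G : magnetic_schrodinger_graph R X.
Notation V := (X -> R[i]).
Implicit Types f g h : V.

Definition qd f g : R :=
  2^-1 * rsum (fun xy : X * X => edge G xy.1 xy.2 * rdot (nabla G f xy) (nabla G g xy)) +
  rsum (fun x => elec G x * rdot (f x) (g x)).

Lemma nablaZ (a : R[i]) f xy : nabla G (a *: f) xy = a * nabla G f xy.
Proof. by rewrite /nabla !fctE -![_ *: _]/(_ * _); ring. Qed.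

Lemma nablaD f g xy : nabla G (f + g) xy = nabla G f xy + nabla G g xy.
Proof. by rewrite /nabla !fctE; ring. Qed.

Lemma QE f g : Q G f g = Complex (qd f g) (qd f ('i%C *: g)).
Proof.
have h2 : (2^-1 : R[i]) = (2^-1)%:C%C by rewrite fmorphV rmorph_nat.
rewrite /Q h2 /csum /qd; simpc; congr Complex; congr (_ + _).
- congr (_ * rsum _); apply/funext => xy.
  by case: (nabla G f xy) (nabla G g xy) => [a b] [c d]; rewrite /rdot /=; ring.
- congr rsum; apply/funext => x.
  by case: (f x) (g x) => [a b] [c d]; rewrite /rdot /=; ring.
- congr (_ * rsum _); apply/funext => xy; rewrite nablaZ.
  by case: (nabla G f xy) (nabla G g xy) => [a b] [c d]; rewrite /rdot /=; ring.
- congr rsum; apply/funext => x; rewrite fctE -[_ *: _]/(_ * _).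
  by case: (f x) (g x) => [a b] [c d]; rewrite /rdot /=; ring.
Qed.

Lemma qformE f : qform G f = qd f f.
Proof. by rewrite /qform QE. Qed.

(** Only finitely many rows of [edge] meet the support of [f], and each row has finite sum [d x]. *)
Lemma asum_edge1 f : Cc f -> asum (fun xy : X * X => edge G xy.1 xy.2 * cmod (f xy.1) ^+ 2).
Proof.
move=> /CcP[s us fs].
have t0 (xy : X * X) : 0 <= edge G xy.1 xy.2 * cmod (f xy.1) ^+ 2.
  by apply: mulr_ge0; [exact: edge_ge0|exact: sqr_ge0].
pose d x := fine (\esum_(y in [set: X]) (edge G x y)%:E).
have dE x : \esum_(y in [set: X]) (edge G x y)%:E = (d x)%:E.
  rewrite /d fineK// ge0_fin_numE; first exact: edge_summable.
  by apply: esum_ge0 => y _; rewrite lee_fin edge_ge0.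
exists (\sum_(x <- s) d x * cmod (f x) ^+ 2) => t ut.
rewrite (eq_bigr (fun xy : X * X => edge G xy.1 xy.2 * cmod (f xy.1) ^+ 2)); last first.
  by move=> xy _; rewrite ger0_norm.
rewrite (bigID (fun xy : X * X => xy.1 \in s))/= [X in _ + X]big1 ?addr0; last first.
  by move=> xy /fs ->; rewrite Normc.normc0 expr0n mulr0.
(* Writing each term as a sum over its possible first coordinates allows the two sums to be
   exchanged and each row to be bounded separately. *)
rewrite (eq_bigr (fun xy : X * X => \sum_(x <- s)
    (if xy.1 == x then edge G x xy.2 * cmod (f x) ^+ 2 else 0))); last first.
  move=> xy xs; rewrite (bigD1_seq xy.1)//= eqxx big1 ?addr0// => x.
  by rewrite eq_sym => /negPf ->.
rewrite exchange_big/=; apply: ler_sum => x _.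
rewrite -big_mkcondr/= -mulr_suml ler_wpM2r ?sqr_ge0//.
rewrite -big_filter -(big_map snd xpredT (fun y => edge G x y)).
have : (\esum_(y in [set: X]) (edge G x y)%:E <= (d x)%:E)%E by rewrite dE.
move/esum_leP; apply; first by move=> y; exact: edge_ge0.
rewrite map_inj_in_uniq ?filter_uniq// => -[a b] [a' b'].
by rewrite !mem_filter/= => /andP[/andP[_ /eqP ->] _] /andP[/andP[_ /eqP ->] _] ->.
Qed.

Lemma asum_edge2 f : Cc f -> asum (fun xy : X * X => edge G xy.1 xy.2 * cmod (f xy.2) ^+ 2).
Proof.
move=> /asum_edge1[B HB]; exists B => s us.
have := HB [seq (xy.2, xy.1) | xy <- s]; rewrite big_map/=; under eq_bigr do rewrite edge_sym.
apply; rewrite map_inj_uniq// => -[a b] [c d]/= [-> ->] //.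
Qed.

Lemma cmod_nabla f xy : cmod (nabla G f xy) ^+ 2 <= 2 * (cmod (f xy.1) ^+ 2 + cmod (f xy.2) ^+ 2).
Proof.
have h : cmod (nabla G f xy) <= cmod (f xy.1) + cmod (f xy.2).
  apply: le_trans (le_normcD _ _) _.
  by rewrite normcN Normc.normcM magn_cmod mul1r.
have {h} : cmod (nabla G f xy) ^+ 2 <= (cmod (f xy.1) + cmod (f xy.2)) ^+ 2.
  by rewrite ler_sqr ?nnegrE ?addr_ge0 ?cmod_ge0.
have := sqr_ge0 (cmod (f xy.1) - cmod (f xy.2)).
rewrite sqrrB sqrrD; lra.
Qed.

Lemma asum_nabla f : Cc f -> asum (fun xy : X * X => edge G xy.1 xy.2 * cmod (nabla G f xy) ^+ 2).
Proof.
move=> cf; apply: asum_le (asumZ 2 (asumD (asum_edge1 cf) (asum_edge2 cf))) => xy.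
have e0 := edge_ge0 G xy.1 xy.2.
have s1 := sqr_ge0 (cmod (f xy.1)); have s2 := sqr_ge0 (cmod (f xy.2)).
have s3 := sqr_ge0 (cmod (nabla G f xy)).
rewrite ger0_norm; last exact: mulr_ge0.
rewrite ger0_norm; last first.
  by apply: mulr_ge0 => //; apply: addr_ge0; apply: mulr_ge0.
by rewrite -[X in _ <= 2 * X]mulrDr [leRHS]mulrCA; apply: ler_wpM2l => //; exact: cmod_nabla.
Qed.

Lemma asum_qd1 f g : Cc f -> Cc g ->
  asum (fun xy : X * X => edge G xy.1 xy.2 * rdot (nabla G f xy) (nabla G g xy)).
Proof.
move=> cf cg; apply: asum_le (asumD (asum_nabla cf) (asum_nabla cg)) => xy.
rewrite -mulrDr !normrM ler_wpM2l// [leRHS]ger0_norm; last by apply: addr_ge0; exact: sqr_ge0.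
exact: rdot_le.
Qed.

Lemma asum_qd2 (k : X -> R) f g : Cc f -> asum (fun x => k x * rdot (f x) (g x)).
Proof.
move=> /CcP[s us fs]; apply: (asum_supp us) => x xs.
by rewrite fs// /rdot /= !mul0r addr0 mulr0.
Qed.

Lemma qdD f g h : Cc f -> Cc g -> Cc h -> qd (f + g) h = qd f h + qd g h.
Proof.
move=> cf cg ch; rewrite /qd [RHS]addrACA -mulrDr.
rewrite -(rsumD (asum_qd1 cf ch) (asum_qd1 cg ch)) -(rsumD (asum_qd2 _ _ cf) (asum_qd2 _ _ cg)).
congr (_ * _ + _); congr rsum; apply/funext => x.
  by rewrite nablaD rdotD mulrDr.
by rewrite fctE rdotD mulrDr.
Qed.

Lemma qdZ (t : R) f h : Cc f -> Cc h -> qd (t%:C%C *: f) h = t * qd f h.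
Proof.
move=> cf ch; rewrite /qd [RHS]mulrDr [X in _ = X + _]mulrCA.
rewrite -(rsumZ t (asum_qd1 cf ch)) -(rsumZ t (asum_qd2 _ _ cf)).
congr (_ * _ + _); congr rsum; apply/funext => x.
  by rewrite nablaZ rdotZ mulrCA.
by rewrite fctE rdotZ mulrCA.
Qed.

Lemma qdC f g : qd f g = qd g f.
Proof.
rewrite /qd; congr (_ * _ + _); congr rsum; apply/funext => x; rewrite rdotC//.
Qed.

Lemma qdii f g : qd ('i%C *: f) ('i%C *: g) = qd f g.
Proof.
rewrite /qd; congr (_ * _ + _); congr rsum; apply/funext => x.
  by rewrite !nablaZ rdotii.
by rewrite !fctE rdotii.
Qed.

Lemma Cc_l2 f : Cc f -> lp m 2 f.
Proof. by apply: Cc_lp. Qed.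

(** The sign of [a] is left open: a positive shift gives the energy form of the resolvent equation,
    a negative one the form of $H_2-r$ in the spectral gap argument. *)
Lemma energy_rform (a : R) : (forall f, Cc f -> 0 <= qd f f + a * dot m f f) ->
  rform Cc (fun f g => qd f g + a * dot m f g).
Proof.
move=> h; have D := dot_rform m_gt0; split.
- exact: Cc0.
- exact: CcD.
- exact: CcZ.
- move=> f g k cf cg ck; rewrite qdD// (rfD D); try exact: Cc_l2.
  by ring.
- move=> t f k cf ck; rewrite qdZ// (rfZ D); try exact: Cc_l2.
  by ring.
- by move=> f g cf cg; rewrite qdC (rfC D)//; exact: Cc_l2.
- exact: h.
Qed.

Lemma qd_rform : form_positive G -> rform Cc qd.
Proof.
move=> Qpos; have := @energy_rform 0; rewrite (_ : (fun f g => _) = qd).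
  by apply=> f cf; rewrite mul0r addr0 -qformE; exact: Qpos.
by apply/funext => f; apply/funext => g; rewrite mul0r addr0.
Qed.

End qform.

(** * The closed form and its operator *)

Section closure.
Variables (R : realType) (X : choiceType) (m : X -> R).
Hypothesis m_gt0 : forall x, 0 < m x.
Variable G : magnetic_schrodinger_graph R X.
Hypothesis Q_pos : form_positive G.
Notation V := (X -> R[i]).
Implicit Types (f g h : V) (u v : nat -> V).
Notation L := (lp m 2).
Notation N := (nrm m 2).
Notation dot := (dot m).
Notation qd := (qd G).
Notation s f := (Num.sqrt (qd f f)).

Let p1 : 1 <= 2 :> R. Proof. by rewrite ler1n. Qed.
Let p0 : 0 < 2 :> R. Proof. by []. Qed.
Let rq := qd_rform m_gt0 Q_pos.
Let rd := dot_rform m_gt0.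
Let CcL f : Cc f -> L f. Proof. exact: Cc_l2. Qed.

(** The square root obeys the triangle inequality, which makes form-Cauchy sequences manageable. *)
Lemma Q_cauchyP u : (forall n, Cc (u n)) ->
  (Q_cauchy G u <-> forall e : R, 0 < e -> exists M, forall i j,
     (M <= i)%N -> (M <= j)%N -> s (u i - u j) < e).
Proof.
move=> cu; have ge0 i j : 0 <= qd (u i - u j) (u i - u j).
  by apply: (rf_ge0 rq); apply: CcB.
split=> H e e0.
- have [M HM] := H (e ^+ 2) (exprn_gt0 _ e0); exists M => i j Mi Mj.
  have := HM i j Mi Mj; rewrite qformE ger0_norm ?ge0// => h.
  by rewrite -[ltRHS]ger0_norm ?ltW// -sqrtr_sqr ltr_sqrt// exprn_gt0.
- have e1 : 0 < Num.sqrt e by rewrite sqrtr_gt0.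
  have [M HM] := H _ e1; exists M => i j Mi Mj.
  by have := HM i j Mi Mj; rewrite qformE ger0_norm ?ge0// ltr_sqrt.
Qed.

Lemma Q_cauchy_bounded u : (forall n, Cc (u n)) -> Q_cauchy G u ->
  exists2 B, 0 <= B & \forall n \near \oo, s (u n) <= B.
Proof.
move=> cu /(Q_cauchyP cu)/(_ 1 ltr01)[M HM].
exists (s (u M) + 1); first by rewrite addr_ge0 ?sqrtr_ge0.
exists M => // n /= Mn.
have := rf_triangle rq (CcB (cu n) (cu M)) (cu M); rewrite subrK.
by have := HM n M Mn (leqnn M); lra.
Qed.

Lemma lp_cvgP u f : (forall n, L (u n)) -> L f ->
  lp_cvg m 2 u f <-> N (u n - f) @[n --> \oo] --> (0 : R).
Proof.
move=> lu lf; rewrite /lp_cvg -(@lpnorm_cvg0 _ _ m _ \oo _ 2 (fun n => u n - f)) //.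
by apply: nearW => n; have [] := lpB m_gt0 p1 (lu n) lf.
Qed.

Lemma sqrt_prod_cvg0 (a b : nat -> R) (B : R) : (forall n, 0 <= a n) ->
  (forall n, 0 <= b n) -> a n @[n --> \oo] --> (0 : R) ->
  (\forall n \near \oo, b n <= B) -> a n * b n @[n --> \oo] --> (0 : R).
Proof.
move=> a0 b0 ha bB.
have h : a n * B @[n --> \oo] --> (0 : R) by rewrite -(mul0r B); exact: cvgMl.
apply: (squeeze_cvgr _ (cvg_cst 0) h); apply: filterS bB => n bn.
by rewrite mulr_ge0//= ler_wpM2l.
Qed.

Lemma dot_cvg u v f g : (forall n, L (u n)) -> (forall n, L (v n)) -> L f -> L g ->
  N (u n - f) @[n --> \oo] --> (0 : R) -> N (v n - g) @[n --> \oo] --> (0 : R) ->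
  dot (u n) (v n) @[n --> \oo] --> dot f g.
Proof.
move=> lu lv lf lg uf vg; apply/subr_cvg0/norm_cvg0P.
have luf n : L (u n - f) by have [] := lpB m_gt0 p1 (lu n) lf.
have lvg n : L (v n - g) by have [] := lpB m_gt0 p1 (lv n) lg.
have nv n : N (v n) <= N (v n - g) + N g.
  by have [_] := lpD m_gt0 p1 (lvg n) lg; rewrite subrK.
apply: (@cvg0_sq _ _ _ _ _ (fun n => N (u n - f) * (N (v n - g) + N g) + N f * N (v n - g))).
- by move=> n; exact: normr_ge0.
- move=> n.
  have -> : dot (u n) (v n) - dot f g = dot (u n - f) (v n) + dot f (v n - g).
    rewrite (rfB rd (lu n) lf (lv n)) (rfBr rd (lv n) lg lf).
    by move: (dot _ _) (dot _ _) (dot _ _) => a b c; ring.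
  apply: le_trans (ler_normD _ _) _; apply: lerD; last exact: (dot_CS m_gt0 lf (lvg n)).
  apply: le_trans (dot_CS m_gt0 (luf n) (lv n)) _.
  by apply: ler_wpM2l; [exact: nrm_ge0|exact: nv].
- apply: cvg0D.
    have k : N (v n - g) + N g @[n --> \oo] --> 0 + N g by apply: cvgD => //; exact: cvg_cst.
    by rewrite -[0 in X in _ --> X](mul0r (0 + N g)); exact: cvgM.
  by rewrite -[0 in X in _ --> X](mulr0 (N f)); exact: cvgMr.
Qed.

Lemma closure_approxB u v f g : L f -> L g ->
  closure_approx m G u f -> closure_approx m G v g ->
  closure_approx m G (fun n => u n - v n) (f - g).
Proof.
move=> lf lg [cu qu uf] [cv qv vg]; have cuv n : Cc (u n - v n) by exact: CcB.
split; first exact: cuv.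
- apply/Q_cauchyP => // e e0; have e2 : 0 < e / 2 by rewrite divr_gt0.
  have [M HM] := (Q_cauchyP cu).1 qu _ e2; have [M' HM'] := (Q_cauchyP cv).1 qv _ e2.
  exists (maxn M M') => i j; rewrite !geq_max => /andP[a b] /andP[c d].
  have := HM i j a c; have := HM' i j b d.
  have cNv : Cc (- (v i - v j)) by rewrite opprB; exact: CcB.
  have := rf_triangle rq (CcB (cu i) (cu j)) cNv.
  rewrite (rfN rq)//; last exact: CcB.
  rewrite (rfC rq) ?(rfN rq)//; try exact: CcB.
  rewrite opprK (_ : u i - u j + - (v i - v j) = u i - v i - (u j - v j)); first lra.
  by apply/funext => x; rewrite !fctE; ring.
- have [lfg _] := lpB m_gt0 p1 lf lg; apply/(lp_cvgP (fun n => CcL (cuv n)) lfg).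
  have h1 := (lp_cvgP (fun n => CcL (cu n)) lf).1 uf.
  have h2 := (lp_cvgP (fun n => CcL (cv n)) lg).1 vg.
  apply: (@cvg0_sq _ _ _ _ _ (fun n => N (u n - f) + N (v n - g))).
  + by move=> n; exact: nrm_ge0.
  + move=> n; have [l1 _] := lpB m_gt0 p1 (CcL (cu n)) lf.
    have [l2 _] := lpB m_gt0 p1 (CcL (cv n)) lg.
    have [_] := lpB m_gt0 p1 l1 l2.
    rewrite (_ : u n - f - (v n - g) = u n - v n - (f - g))//.
    by apply/funext => x; rewrite !fctE; ring.
  + exact: cvg0D.
Qed.

(** Homogeneity of the form is a premise because [qd] is linear over the reals only; it is verified
    separately for $i$ and for real scalars. *)
Lemma closure_approx_scale (a : R[i]) u f : L f ->
  (forall f, Cc f -> qd (a *: f) (a *: f) = cmod a ^+ 2 * qd f f) ->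
  closure_approx m G u f -> closure_approx m G (fun n => a *: u n) (a *: f).
Proof.
move=> lf qa [cu qu uf]; have cau n : Cc (a *: u n) by exact: CcZ.
split; first exact: cau.
- apply/Q_cauchyP => // e e0.
  have c1 : 0 < cmod a + 1 by rewrite ltr_wpDl ?cmod_ge0.
  have e2 : 0 < e / (cmod a + 1) by rewrite divr_gt0.
  have [M HM] := (Q_cauchyP cu).1 qu _ e2; exists M => i j Mi Mj.
  have := HM i j Mi Mj; rewrite -scalerBr qa; last exact: CcB.
  rewrite sqrtrM ?sqr_ge0// sqrtr_sqr.
  rewrite ger0_norm ?cmod_ge0// ltr_pdivlMr// mulrC; apply: le_lt_trans.
  by rewrite ler_wpM2r ?sqrtr_ge0// lerDl.
- have [laf _] := lpZ m_gt0 a p0 lf; apply/(lp_cvgP (fun n => CcL (cau n)) laf).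
  have h1 := (lp_cvgP (fun n => CcL (cu n)) lf).1 uf.
  have e n : N (a *: u n - a *: f) = cmod a * N (u n - f).
    have [l1 _] := lpB m_gt0 p1 (CcL (cu n)) lf.
    by rewrite -scalerBr (lpZ m_gt0 a p0 l1).2.
  under eq_fun do rewrite e.
  by rewrite -(mulr0 (cmod a)); exact: cvgMr.
Qed.

Lemma closure_approxi u f : L f -> closure_approx m G u f ->
  closure_approx m G (fun n => 'i%C *: u n) ('i%C *: f).
Proof.
move=> lf; apply: closure_approx_scale => // g _.
by rewrite qdii /= expr0n add0r expr1n sqrtr1 expr1n mul1r.
Qed.

Lemma closure_approx_cst f : Cc f -> closure_approx m G (fun=> f) f.
Proof.
move=> cf; split=> //.
- apply/Q_cauchyP => // e e0; exists 0%N => i j _ _.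
  by rewrite subrr (rf0 rq) ?sqrtr0//; exact: Cc0.
- apply/lp_cvgP; [by move=> _; exact: CcL|exact: CcL|].
  by rewrite subrr (lp0 m_gt0 p0).2; exact: cvg_cst.
Qed.

Lemma qd_cvg u v f g : closure_approx m G u f -> closure_approx m G v g ->
  exists l : R, qd (u n) (v n) @[n --> \oo] --> l.
Proof.
move=> [cu qu _] [cv qv _]; apply: cauchy_real => e e0.
have [B B0 [M1 _ HB]] := Q_cauchy_bounded cu qu.
have [C C0 [M2 _ HC]] := Q_cauchy_bounded cv qv.
have c0 : 0 < B + C + 1 by rewrite ltr_wpDl ?addr_ge0.
have d0 : 0 < e / (B + C + 1) by rewrite divr_gt0.
have [M3 H3] := (Q_cauchyP cu).1 qu _ d0; have [M4 H4] := (Q_cauchyP cv).1 qv _ d0.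
exists (maxn (maxn M1 M2) (maxn M3 M4)) => i j.
rewrite !geq_max => /andP[/andP[a1 a2] /andP[a3 a4]] /andP[/andP[b1 b2] /andP[b3 b4]].
have -> : qd (u i) (v i) - qd (u j) (v j) = qd (u i - u j) (v i) + qd (u j) (v i - v j).
  by rewrite (rfB rq)// (rfBr rq)//; ring.
have h1 := rf_CS_sqrt rq (CcB (cu i) (cu j)) (cv i).
have h2 := rf_CS_sqrt rq (cu j) (CcB (cv i) (cv j)).
apply: le_lt_trans (ler_normD _ _) _.
have x1 := ltW (H3 i j a3 b3); have x2 := ltW (H4 i j a4 b4).
have x3 : s (v i) <= C := HC i a2; have x4 : s (u j) <= B := HB j b1.
have y1 : s (u i - u j) * s (v i) <= e / (B + C + 1) * C.
  by apply: ler_pM => //; exact: sqrtr_ge0.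
have y2 : s (u j) * s (v i - v j) <= B * (e / (B + C + 1)).
  by apply: ler_pM => //; exact: sqrtr_ge0.
have E : e / (B + C + 1) * C + B * (e / (B + C + 1)) + e / (B + C + 1) = e.
  rewrite (mulrC B) -mulrDr -[X in _ + X]mulr1 -mulrDr (addrC C) divfK// gt_eqF//.
lra.
Qed.

Section closable.
Hypothesis Q_closable : form_closable m G.

(** Closability enters here: the difference of two approximations of [f] is form-Cauchy and tends to
    0 in $\ell^2$. *)
Lemma qd_diff_cvg0 u u' f : L f -> closure_approx m G u f -> closure_approx m G u' f ->
  s (u n - u' n) @[n --> \oo] --> (0 : R).
Proof.
move=> lf au au'; have [cd qd' df] := closure_approxB lf lf au au'.
rewrite subrr in df.
have := Q_closable cd df qd'.
have e n : qform G (u n - u' n) = qd (u n - u' n) (u n - u' n) by rewrite qformE.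
under eq_fun do rewrite e.
move=> h; apply/dist0P => [n|d d0]; first exact: sqrtr_ge0.
have [|M HM] := (dist0P _).1 h (d ^+ 2) (exprn_gt0 _ d0).
  by move=> n; apply: (rf_ge0 rq); exact: cd.
exists M => n Mn; rewrite -[ltRHS]ger0_norm ?ltW// -sqrtr_sqr ltr_sqrt ?HM// exprn_gt0//.
Qed.

Lemma qd_cvg_unique u u' v v' f g (l : R) : L f -> L g ->
  closure_approx m G u f -> closure_approx m G u' f ->
  closure_approx m G v g -> closure_approx m G v' g ->
  qd (u n) (v n) @[n --> \oo] --> l -> qd (u' n) (v' n) @[n --> \oo] --> l.
Proof.
move=> lf lg au au' av av' h.
have d1 := qd_diff_cvg0 lf au au'; have d2 := qd_diff_cvg0 lg av av'.
have [cu qu _] := au; have [cv qv _] := av; have [cu' qu' _] := au'; have [cv' qv' _] := av'.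
have [B B0 HB] := Q_cauchy_bounded cu' qu'; have [C C0 HC] := Q_cauchy_bounded cv qv.
have k1 : s (u n - u' n) * s (v n) @[n --> \oo] --> (0 : R).
  by apply: sqrt_prod_cvg0 d1 HC => n; exact: sqrtr_ge0.
have k2 : s (v n - v' n) * s (u' n) @[n --> \oo] --> (0 : R).
  by apply: sqrt_prod_cvg0 d2 HB => n; exact: sqrtr_ge0.
have k : qd (u n) (v n) - qd (u' n) (v' n) @[n --> \oo] --> (0 : R).
  apply/norm_cvg0P; apply: (@cvg0_sq _ _ _ _ _
    (fun n => s (u n - u' n) * s (v n) + s (v n - v' n) * s (u' n))) => //.
    move=> n; have -> : qd (u n) (v n) - qd (u' n) (v' n) =
      qd (u n - u' n) (v n) + qd (v n - v' n) (u' n).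
      by rewrite !(rfB rq)// (rfC rq (cv n) (cu' n)) (rfC rq (cv' n) (cu' n)); ring.
    apply: le_trans (ler_normD _ _) _; apply: lerD; apply: (rf_CS_sqrt rq) => //; exact: CcB.
  exact: cvg0D.
have e n : qd (u' n) (v' n) = qd (u n) (v n) - (qd (u n) (v n) - qd (u' n) (v' n)).
  by rewrite subKr.
under eq_fun do rewrite e.
by rewrite -[l]subr0; exact: cvgB.
Qed.

(** The limits exist, so the default value of [xget] in [Qbar] is not taken, and by uniqueness any
    pair of approximations computes it. *)
Lemma QbarP u v f g : L f -> L g -> closure_approx m G u f -> closure_approx m G v g ->
  (qd (u n) (v n) @[n --> \oo] --> complex.Re (Qbar m G f g)) /\
  (qd (u n) ('i%C *: v n) @[n --> \oo] --> complex.Im (Qbar m G f g)).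
Proof.
move=> lf lg au av; have avi := closure_approxi lg av.
have [a ha] := qd_cvg au av; have [b hb] := qd_cvg au avi.
have [lig _] := lpZ m_gt0 'i%C p0 lg.
set A := [set z | exists u v, [/\ closure_approx m G u f, closure_approx m G v g &
    cmod (Q G (u n) (v n) - z) @[n --> \oo] --> (0 : R)]].
have [u' [v' [au' av' hz]]] : A (Qbar m G f g).
  rewrite /Qbar; apply: (@xgetPex _ _ A); exists (Complex a b), u, v; split=> //.
  apply: (@cvg0_sq _ _ _ _ _ (fun n => `|qd (u n) (v n) - a| + `|qd (u n) ('i%C *: v n) - b|)).
  - by move=> n; exact: cmod_ge0.
  - by move=> n; rewrite QE; exact: cmod_le.
  - by apply: cvg0D; exact: cvg_dist0.
have avi' := closure_approxi lg av'.
have h1 : qd (u' n) (v' n) @[n --> \oo] --> complex.Re (Qbar m G f g).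
  apply/subr_cvg0/norm_cvg0P; apply: cvg0_sq hz => // n.
  by have := Re_dist (Q G (u' n) (v' n)) (Qbar m G f g); rewrite QE.
have h2 : qd (u' n) ('i%C *: v' n) @[n --> \oo] --> complex.Im (Qbar m G f g).
  apply/subr_cvg0/norm_cvg0P; apply: cvg0_sq hz => // n.
  by have := Im_dist (Q G (u' n) (v' n)) (Qbar m G f g); rewrite QE.
split; first exact: (qd_cvg_unique lf lg au' au av' av).
exact: (qd_cvg_unique lf lig au' au avi' avi).
Qed.

Lemma H2_cvg f h g u v : H2 m G f h -> closure_approx m G u f -> L g ->
  closure_approx m G v g -> qd (u n) (v n) @[n --> \oo] --> dot h g.
Proof.
move=> [[lf _] lh H] au lg av.
have [h1 _] := QbarP lf lg au av.
by rewrite H in h1; [rewrite Re_l2dot in h1|split=> //; exists v].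
Qed.

(** Real parts suffice: the imaginary part of the defining identity is the real one for $ig$, which
    again belongs to the domain. *)
Lemma H2_intro f h u : L f -> L h -> closure_approx m G u f ->
  (forall g v, L g -> closure_approx m G v g -> qd (u n) (v n) @[n --> \oo] --> dot h g) ->
  H2 m G f h.
Proof.
move=> lf lh au H; split=> //; first by split=> //; exists u.
move=> g [lg [v av]]; have [h1 h2] := QbarP lf lg au av.
have [lig _] := lpZ m_gt0 'i%C p0 lg.
have e1 := cvg_unique (@Rhausdorff R) h1 (H g v lg av).
have e2 := cvg_unique (@Rhausdorff R) h2 (H _ _ lig (closure_approxi lg av)).
by rewrite l2dotE -e1 -e2; case: (Qbar _ _ _ _).
Qed.

Lemma H2_lp f h : H2 m G f h -> L f /\ L h.
Proof. by case=> [[lf _] lh _]. Qed.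

Lemma H2B f h f' h' : H2 m G f h -> H2 m G f' h' -> H2 m G (f - f') (h - h').
Proof.
move=> H H'; have [lf lh] := H2_lp H; have [lf' lh'] := H2_lp H'.
have [lff _] := lpB m_gt0 p1 lf lf'; have [lhh _] := lpB m_gt0 p1 lh lh'.
have [[_ [u au]] _ _] := H; have [[_ [u' au']] _ _] := H'.
have auu := closure_approxB lf lf' au au'.
apply: (H2_intro lff lhh auu) => g v lg av.
have [cu _ _] := au; have [cu' _ _] := au'; have [cv _ _] := av.
rewrite (rfB rd)//.
have e n : qd (u n - u' n) (v n) = qd (u n) (v n) - qd (u' n) (v n) by rewrite (rfB rq).
under eq_fun do rewrite e.
exact: cvgB (H2_cvg H au lg av) (H2_cvg H' au' lg av).
Qed.

Lemma H2Z (t : R) f h : H2 m G f h -> H2 m G (t%:C%C *: f) (t%:C%C *: h).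
Proof.
move=> H; have [lf lh] := H2_lp H.
have [ltf _] := lpZ m_gt0 t%:C%C p0 lf; have [lth _] := lpZ m_gt0 t%:C%C p0 lh.
have [[_ [u au]] _ _] := H; have [cu _ _] := au.
have aut : closure_approx m G (fun n => t%:C%C *: u n) (t%:C%C *: f).
  apply: closure_approx_scale => // k ck.
  rewrite cmod_real real_normK ?num_real// (rfZ rq)//; last exact: CcZ.
  by rewrite (rfZr rq)// mulrA -expr2.
apply: (H2_intro ltf lth aut) => g v lg av; have [cv _ _] := av.
rewrite (rfZ rd)//.
have e n : qd (t%:C%C *: u n) (v n) = t * qd (u n) (v n) by rewrite (rfZ rq).
under eq_fun do rewrite e.
exact: cvgMr (H2_cvg H au lg av).
Qed.

Lemma H2_ge0 f h : H2 m G f h -> 0 <= dot h f.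
Proof.
move=> H; have [lf lh] := H2_lp H; have [[_ [u au]] _ _] := H; have [cu _ _] := au.
apply: (cvgr_to_ge (H2_cvg H au lf au)); apply: nearW => n.
exact: (rf_ge0 rq).
Qed.

End closable.
End closure.

(** * Galerkin approximation of the resolvent *)

Section solvable.
Variables (R : realType) (V : lmodType R[i]) (W : V -> Prop) (B : V -> V -> R).
Hypothesis rB : rform W B.

Hypothesis B_def : forall f, W f -> B f f = 0 -> f = 0.

Definition rlinear (l : V -> R) := forall f g (t : R), W f -> W g ->
  l (f + t%:C%C *: g) = l f + t * l g.

(** The Riesz representation property of [B] on [K]. *)
Definition solvable (K : V -> Prop) := forall l, rlinear l ->
  exists2 u, K u & forall f, K f -> B u f = l f.

(** One Gram-Schmidt step over the reals: [w] represents $B(e,\cdot)$ on [K], so $e-w$ is orthogonal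
    to [K], and a multiple of it corrects the solution on [K]. If $B(e-w,e-w)=0$, then $e=w$ already
    lies in [K]. *)
Lemma solvable_line (K : V -> Prop) e : (forall f, K f -> W f) ->
  (forall f g (t : R), K f -> K g -> K (f + t%:C%C *: g)) ->
  W e -> solvable K ->
  solvable (fun f => exists2 g, K g & exists t : R, f = g + t%:C%C *: e).
Proof.
move=> KW KD We sK l ll.
have Be : rlinear (B e).
  move=> f g t Wf Wg; rewrite (rfDr rB)//; last exact: (rfWZ rB).
  by rewrite (rfZr rB).
have [w Kw wP] := sK _ Be; have [u0 Ku0 u0P] := sK _ ll.
have Ww := KW _ Kw; have Wu0 := KW _ Ku0.
have We' := rfWB rB We Ww.
have Bew f : K f -> B (e - w) f = 0.
  by move=> Kf; rewrite (rfB rB)// ?wP ?subrr//; exact: KW.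
have [z|nz] := eqVneq (B (e - w) (e - w)) 0.
  have ew : e = w by apply/eqP; rewrite -subr_eq0; apply/eqP; exact: B_def.
  exists u0; first by exists u0 => //; exists 0; rewrite scale0r addr0.
  move=> f [g Kg [t ->]]; rewrite u0P ?ll//; first exact: KW.
  by apply: KD => //; rewrite ew.
(* Since $B(e-w,e)=B(e-w,e-w)$, this [c] gives $B(u,e)=l(e)$, while values on [K] stay as they
   were. *)
pose c := (l e - B u0 e) / B (e - w) (e - w).
exists (u0 + c%:C%C *: (e - w)).
  exists (u0 + (- c)%:C%C *: w); first exact: KD.
  by exists c; rewrite scalerBr rmorphN scaleNr; rewrite -addrA (addrC (- _)).
move=> f [g Kg [t ->]]; have Wg := KW _ Kg.
have Wte : W (t%:C%C *: e) by exact: (rfWZ rB).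
have Wce : W (c%:C%C *: (e - w)) by exact: (rfWZ rB).
have Bee : B (e - w) e = B (e - w) (e - w).
  by rewrite (rfBr rB We Ww We') (Bew _ Kw) subr0.
have WDg : W (g + t%:C%C *: e) by exact: (rfWD rB).
rewrite (rfD rB)// (rfZ rB)// ll// !(rfDr rB)// !(rfZr rB)//.
rewrite u0P// (Bew _ Kg) Bee add0r mulrCA /c divfK//.
by ring.
Qed.
End solvable.

Section galerkin.
Variables (R : realType) (X : choiceType) (m : X -> R).
Hypothesis m_gt0 : forall x, 0 < m x.
Variable G : magnetic_schrodinger_graph R X.
Hypothesis Q_pos : form_positive G.
Notation V := (X -> R[i]).
Implicit Types (f g h : V) (u v : nat -> V).
Notation L := (lp m 2).
Notation N := (nrm m 2).
Notation dot := (dot m).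
Notation qd := (qd G).

Let p1 : 1 <= 2 :> R. Proof. by rewrite ler1n. Qed.
Let p0 : 0 < 2 :> R. Proof. by []. Qed.
Let rq := qd_rform m_gt0 Q_pos.
Let rd := dot_rform m_gt0.
Let CcL f : Cc f -> L f. Proof. exact: Cc_l2. Qed.

Definition supp_in (K : seq X) f := forall x, x \notin K -> f x = 0.

Lemma supp_in_Cc K f : supp_in K f -> Cc f.
Proof.
move=> h; apply/CcP; exists (undup K); first exact: undup_uniq.
by move=> x; rewrite mem_undup; exact: h.
Qed.

Lemma supp_in_sub (K K' : seq X) f : {subset K <= K'} -> supp_in K f -> supp_in K' f.
Proof. by move=> KK h x; apply: contraNeq => fx; apply: KK; apply: contraNT fx => /h ->. Qed.

Section alpha.
Variable a : R.
Hypothesis a0 : 0 < a.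
Let E f g := qd f g + a * dot f g.

Lemma E_rform : rform Cc E.
Proof.
apply: energy_rform => // f cf; rewrite addr_ge0 ?(rf_ge0 rq)// mulr_ge0 ?(ltW a0)//.
by rewrite (rf_ge0 rd)//; exact: CcL.
Qed.
Let rE := E_rform.

Lemma E_ge f : Cc f -> a * N f ^+ 2 <= E f f.
Proof.
move=> cf; rewrite /E dot_nrm//; last exact: CcL.
by rewrite lerDr (rf_ge0 rq).
Qed.

Lemma E_def f : Cc f -> E f f = 0 -> f = 0.
Proof.
move=> cf E0; have := E_ge cf; rewrite E0 pmulr_rle0// => h.
apply: (nrm_eq0 m_gt0 p0 (CcL cf)); apply/eqP.
by rewrite -sqrf_eq0 eq_le h sqr_ge0.
Qed.

(** Over the reals a new point contributes two lines, spanned by its indicator and by $i$ times it,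
    so [solvable_line] is applied twice per point. *)
Lemma supp_in_cons x K f : supp_in (x :: K) f <->
  exists2 g, (exists2 g', supp_in K g' & exists t : R, g = g' + t%:C%C *: (fun y => (y == x)%:R)) &
  exists t : R, f = g + t%:C%C *: ('i%C *: (fun y => (y == x)%:R)).
Proof.
split=> [h|].
  exists ((fun y => if y == x then 0 else f y) + (complex.Re (f x))%:C%C *: (fun y => (y == x)%:R)).
    exists (fun y => if y == x then 0 else f y); last by exists (complex.Re (f x)).
    by move=> y yK; case: eqVneq => // yx; apply: h; rewrite inE negb_or yx.
  exists (complex.Im (f x)); apply/funext => y; rewrite !fctE -![_ *: _]/(_ * _).
  case: eqVneq => [->|_]; last by rewrite !mulr0 !addr0.
  by rewrite !mulr1 add0r {1}[f x]complexE mulrC.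
move=> [g [g' hg' [t ->]] [t' ->]] y; rewrite inE negb_or => /andP[yx yK].
by rewrite !fctE -![_ *: _]/(_ * _) (negPf yx) hg'// !mulr0 !addr0.
Qed.

Lemma galerkin_finite K : solvable Cc E (supp_in K).
Proof.
have lin K' f g (t : R) : supp_in K' f -> supp_in K' g -> supp_in K' (f + t%:C%C *: g).
  by move=> hf hg x xK; rewrite !fctE hf// hg// scaler0 addr0.
elim: K => [|x K IH].
  move=> l ll; exists 0; first by move=> x.
  move=> f hf; have -> : f = 0 by apply/funext => x; exact: hf.
  have := ll 0 0 1 (Cc0 _ _) (Cc0 _ _); rewrite scaler0 addr0 mul1r.
  rewrite (rf0 rE (Cc0 _ _)); lra.
have dC : Cc ((fun y => (y == x)%:R) : V).
  by apply: (@supp_in_Cc [:: x]) => y; rewrite inE => /negPf ->.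
have h1 := @solvable_line _ _ Cc E rE E_def (supp_in K) _ (@supp_in_Cc K) (lin K) dC IH.
have h2 := @solvable_line _ _ Cc E rE E_def _ ('i%C *: (fun y => (y == x)%:R)) _ _ (CcZ _ dC) h1.
move=> l ll; have [||u uK uP] := h2 _ _ l ll.
- by move=> f [g Kg [t ->]]; apply: CcD; [exact: supp_in_Cc Kg|exact: CcZ].
- move=> f g t [f' Kf' [r ->]] [g' Kg' [r' ->]].
  exists (f' + t%:C%C *: g'); first exact: lin.
  exists (r + t * r'); rewrite rmorphD rmorphM scalerDr scalerDl scalerA.
  by rewrite addrACA.
by exists u; [exact/supp_in_cons|move=> f /supp_in_cons/uP].
Qed.

(* [X] may be uncountable: instead of an exhaustion, pick finite sets [K n] whose energies
   [<g, u_(K n)>] approach the supremum over all finite sets; by monotonicity of the energy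
   in [K], enlarging [K n] then moves the solution by at most [r n] in the form norm. *)
Lemma galerkin g : L g -> exists (u : nat -> V) (r : nat -> R),
  [/\ r n @[n --> \oo] --> (0 : R), forall n, 0 <= r n,
   forall n, exists2 K, supp_in K (u n) & forall f, supp_in K f -> E (u n) f = dot g f,
   forall i j, Num.sqrt (E (u i - u j) (u i - u j)) <= r i + r j &
   forall n f, Cc f -> `|E (u n) f - dot g f| <= r n * Num.sqrt (E f f)].
Proof.
move=> lg; have ld : rlinear Cc (dot g).
  move=> f h t cf ch; have [lf lh] := (CcL cf, CcL ch).
  have lth : L (t%:C%C *: h) := rfWZ rd _ lh.
  by rewrite (rfDr rd lf lth lg) (rfZr rd t lh lg).
have [u uP] : exists u : seq X -> V, forall K, supp_in K (u K) /\
    forall f, supp_in K f -> E (u K) f = dot g f.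
  have h K : exists w, supp_in K w /\ forall f, supp_in K f -> E w f = dot g f.
    by have [w h1 h2] := galerkin_finite K ld; exists w.
  by have [u H] := choice h; exists u.
have cu K : Cc (u K) by have [h _] := uP K; exact: supp_in_Cc h.
pose e K := dot g (u K).
have eE K : e K = E (u K) (u K) by have [h1 h2] := uP K; rewrite h2.
(* From $a\|u_K\|^2\le E(u_K,u_K)=\langle g,u_K\rangle\le\|g\|\,\|u_K\|$. *)
have eb K : e K <= (N g ^+ 2) / a.
  have h1 : e K <= N g * N (u K).
    exact: le_trans (ler_norm _) (dot_CS m_gt0 lg (CcL (cu K))).
  have h2 := E_ge (cu K); rewrite -eE in h2.
  have := nrm_ge0 m 2 g; have := nrm_ge0 m 2 (u K).
  move: h1 h2; move: (N g) (N (u K)) (e K) => x y z h1 h2 y0 x0.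
  have h3 : a * y <= x.
    have [->|yn] := eqVneq y 0; first by rewrite mulr0.
    have yp : 0 < y by rewrite lt_neqAle eq_sym yn.
    rewrite -(ler_pM2r yp) -mulrA -expr2; exact: le_trans h2 h1.
  rewrite ler_pdivlMr//; apply: le_trans (_ : x * y * a <= _); first by rewrite ler_wpM2r// ltW.
  by rewrite -mulrA expr2 ler_wpM2l// mulrC.
pose A := [set e K | K in [set: seq X]].
have hA : has_sup A.
  by split; [exists (e [::]), [::]|exists ((N g ^+ 2) / a) => _ [K _ <-]; exact: eb].
have hK n : exists K, sup A - n.+1%:R^-1 < e K.
  have n0 : 0 < n.+1%:R^-1 :> R by rewrite invr_gt0.
  by have [_ [K _ <-] h] := sup_adherent n0 hA; exists K.
have [K KP] := choice hK.
have eS K' : e K' <= sup A by apply: sup_ubound; [case: hA|exists K'].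
(* Galerkin orthogonality: $E(u_{K_2},u_{K_1})=e(K_1)$, so the squared distance is $e(K_2)-e(K_1)$.
   This is why [r n] below is the square root of the energy gap $1/(n+1)$. *)
have mono K1 K2 : {subset K1 <= K2} -> E (u K2 - u K1) (u K2 - u K1) <= sup A - e K1.
  move=> sub; rewrite (rf_sqB rE)//.
  have -> : E (u K2) (u K1) = e K1.
    have [s1 _] := uP K1; have [_ h2] := uP K2.
    by rewrite h2//; exact: supp_in_sub s1.
  rewrite -(eE K1) -(eE K2); have := eS K2.
  by move: (e K1) (e K2) (sup A) => x y z h; lra.
pose r n : R := Num.sqrt n.+1%:R^-1.
have close n K2 : {subset K n <= K2} ->
    Num.sqrt (E (u K2 - u (K n)) (u K2 - u (K n))) <= r n.
  move=> sub; rewrite /r ler_wsqrtr//; apply: le_trans (mono _ _ sub) _.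
  by rewrite lerBlDr -lerBlDl; exact/ltW/KP.
exists (fun n => u (K n)), r; split.
- apply/dist0P => [n|d d0]; first exact: sqrtr_ge0.
  exists (Num.bound (d ^- 2)) => n hn.
  have h : d ^- 2 < n.+1%:R.
    apply: lt_le_trans (archi_boundP _) _; first by rewrite invr_ge0 sqr_ge0.
    by rewrite ler_nat (leq_trans hn).
  rewrite -[ltRHS]ger0_norm ?ltW// -sqrtr_sqr ltr_sqrt ?exprn_gt0//.
  by rewrite invf_plt ?posrE// exprn_gt0.
- by move=> n; exact: sqrtr_ge0.
- by move=> n; exists (K n); have [] := uP (K n).
(* The sets [K n] are not nested, so two solutions are compared through the one on the union. *)
- move=> i j; set K2 := K i ++ K j.
  have si : {subset K i <= K2} by move=> x xi; rewrite mem_cat xi.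
  have sj : {subset K j <= K2} by move=> x xj; rewrite mem_cat xj orbT.
  have := rf_triangle rE (CcB (cu K2) (cu (K j))) (CcB (cu (K i)) (cu K2)).
  rewrite (rf_sqBC rE (cu (K i)) (cu K2)).
  rewrite (_ : u K2 - u (K j) + (u (K i) - u K2) = u (K i) - u (K j)); last first.
    by apply/funext => x; rewrite !fctE; ring.
  by have := close i K2 si; have := close j K2 sj; lra.
- move=> n f cf; have /CcP[S uS fS] := cf; set K2 := K n ++ S.
  have sn : {subset K n <= K2} by move=> x xi; rewrite mem_cat xi.
  have fK2 : supp_in K2 f.
    by move=> x; rewrite mem_cat negb_or => /andP[_ /fS].
  have [_ /(_ f fK2) <-] := uP K2.
  rewrite distrC -(rfB rE)//.
  apply: le_trans (rf_CS_sqrt rE (CcB (cu K2) (cu (K n))) cf) _.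
  by rewrite ler_wpM2r ?sqrtr_ge0// close.
Qed.

Hypothesis Q_closable : form_closable m G.

Lemma resolvent_exists g : L g -> exists (u : nat -> V) (f : V),
  [/\ H2 m G f (g - a%:C%C *: f), forall n, L (u n - f),
   N (u n - f) @[n --> \oo] --> (0 : R) &
   forall n, exists2 K, supp_in K (u n) & forall h, supp_in K h -> E (u n) h = dot g h].
Proof.
move=> lg; have [u [r [r0 rge uK ud ur]]] := galerkin lg.
have cu n : Cc (u n) by have [K h _] := uK n; exact: supp_in_Cc h.
have lu n : L (u n) := CcL (cu n).
have small (d : R) : 0 < d -> exists M, forall i j, (M <= i)%N -> (M <= j)%N -> r i + r j < d.
  move=> d0; have d2 : 0 < d / 2 by rewrite divr_gt0.
  have [M HM] := (dist0P rge).1 r0 _ d2; exists M => i j Mi Mj.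
  by have := HM i Mi; have := HM j Mj; lra.
have sq f : Cc f -> Num.sqrt a * N f <= Num.sqrt (E f f).
  move=> cf; rewrite -[N f]ger0_norm ?nrm_ge0// -sqrtr_sqr -sqrtrM ?(ltW a0)// ler_wsqrtr//.
  exact: E_ge.
have sqq f : Cc f -> Num.sqrt (qd f f) <= Num.sqrt (E f f).
  move=> cf; rewrite ler_wsqrtr// lerDl mulr_ge0 ?(ltW a0)//; apply: (rf_ge0 rd); exact: CcL.
have sa : 0 < Num.sqrt a by rewrite sqrtr_gt0.
have cauN : nrm_cauchy m 2 u.
  move=> d d0; have [M HM] := small _ (mulr_gt0 sa d0); exists M => i j Mi Mj.
  rewrite -(ltr_pM2l sa); apply: le_lt_trans (HM i j Mi Mj).
  apply: le_trans (ud i j); apply: sq; exact: CcB.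
have cauQ : Q_cauchy G u.
  apply/(Q_cauchyP m_gt0 Q_pos cu) => d d0; have [M HM] := small _ d0; exists M => i j Mi Mj.
  apply: le_lt_trans (HM i j Mi Mj); apply: le_trans (ud i j); apply: sqq; exact: CcB.
have [f lf cf] := lp_complete m_gt0 p1 lu cauN.
have luf n : L (u n - f) by have [] := lpB m_gt0 p1 (lu n) lf.
have [laf _] := lpZ m_gt0 a%:C%C p0 lf; have [lh _] := lpB m_gt0 p1 lg laf.
have auf : closure_approx m G u f.
  split; [exact: cu|exact: cauQ|]; apply/(lp_cvgP m_gt0 lu lf); exact: cf.
exists u, f; split; [|exact: luf|exact: cf|exact: uK].
apply: (H2_intro m_gt0 Q_pos Q_closable lf lh auf) => k v lk av.
have [cv qv vk] := av; have lv n : L (v n) := CcL (cv n).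
have vk' := (lp_cvgP m_gt0 lv lk).1 vk.
have d1 := dot_cvg m_gt0 lu lv lf lk cf vk'.
have lgc : N (g - g) @[n --> \oo] --> (0 : R).
  by rewrite subrr (lp0 m_gt0 p0).2; exact: cvg_cst.
have d2 := @dot_cvg R X m m_gt0 (fun=> g) v g k (fun=> lg) lv lg lk lgc vk'.
(* The residual of [u n] on [v n] is at most [r n] times the energy norm of [v n], which stays
   bounded because [v] is form-Cauchy and converges in $\ell^2$. *)
have rE' : r n * Num.sqrt (E (v n) (v n)) @[n --> \oo] --> (0 : R).
  have [B B0 [M1 _ HB]] := Q_cauchy_bounded m_gt0 Q_pos cv qv.
  have d3 := dot_cvg m_gt0 lv lv lk lk vk' vk'.
  have [C [M2 _ HC]] : exists C, \forall n \near \oo, dot (v n) (v n) <= C.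
    have [M _ HM] := (cvgrPdist_lt _ _).1 d3 1 ltr01; exists (dot k k + 1); exists M => // n Mn.
    by have := HM n Mn; rewrite /= ltr_norml => /andP[]; lra.
  apply: (@sqrt_prod_cvg0 _ _ _ (Num.sqrt (B ^+ 2 + a * C))) => //.
  exists (maxn M1 M2) => // n /=; rewrite geq_max => /andP[h1 h2].
  rewrite ler_wsqrtr// /E; apply: lerD; last by rewrite ler_pM2l// HC.
  have q0 : 0 <= qd (v n) (v n) by exact: (rf_ge0 rq).
  by rewrite -(sqr_sqrtr q0) ler_sqr ?nnegrE ?sqrtr_ge0// HB.
have d4 : E (u n) (v n) - dot g (v n) @[n --> \oo] --> (0 : R).
  apply/norm_cvg0P; apply: cvg0_sq rE' => n; first exact: normr_ge0.
  exact: ur.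
have e n : qd (u n) (v n) = (E (u n) (v n) - dot g (v n)) + (dot g (v n) - a * dot (u n) (v n)).
  by rewrite /E; ring.
under eq_fun do rewrite e.
rewrite (rfB rd lg laf lk) (rfZ rd a lf lk) -(add0r (dot g k - a * dot f k)).
apply: cvgD; first exact: d4.
apply: cvgB; first exact: d2.
by apply: cvgMr; exact: d1.
Qed.

(** From $a\|f\|^2\le\langle(H_2+a)f,f\rangle$. It yields uniqueness of the resolvent and, after
    rescaling, contractivity. *)
Lemma resolvent_unique f h : H2 m G f h -> a * N f <= N (h + a%:C%C *: f).
Proof.
move=> H; have [lf lh] := H2_lp H; have h0 := H2_ge0 m_gt0 Q_pos Q_closable H.
have [laf _] := lpZ m_gt0 a%:C%C p0 lf; have [ls _] := lpD m_gt0 p1 lh laf.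
have := dot_CS m_gt0 ls lf; rewrite (rfD rd lh laf lf) (rfZ rd a lf lf) dot_nrm// => h1.
have {h1} := le_trans (ler_norm _) h1.
have := nrm_ge0 m 2 f; have := nrm_ge0 m 2 (h + a%:C%C *: f).
move: (N f) (N _) (dot h f) h0 => x y z z0 y0 x0 h2.
have [->|xn] := eqVneq x 0; first by rewrite mulr0.
have xp : 0 < x by rewrite lt_neqAle eq_sym xn.
by rewrite -(ler_pM2r xp) -mulrA -expr2; apply: le_trans h2; rewrite lerDr.
Qed.

End alpha.
End galerkin.

(** * The bottom of the spectrum and the resolvent *)

Lemma sum3_lt (R : realFieldType) (a b c d e : R) :
  0 < e -> a <= b + c -> b <= d -> c < e / 4 -> d < e / 4 -> a + d < e.
Proof. lra. Qed.

Section spectral.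
Variables (R : realType) (X : choiceType) (m : X -> R).
Hypothesis m_gt0 : forall x, 0 < m x.
Variable G : magnetic_schrodinger_graph R X.
Hypothesis Q_pos : form_positive G.
Hypothesis Q_closable : form_closable m G.
Notation V := (X -> R[i]).
Implicit Types (f g : V) (h t : R) (u v : nat -> V).
Notation L := (lp m 2).
Notation N := (nrm m 2).
Notation dot := (dot m).
Notation qd := (qd G).

Let p1 : 1 <= 2 :> R. Proof. by rewrite ler1n. Qed.
Let p0 : 0 < 2 :> R. Proof. by []. Qed.
Let rq := qd_rform m_gt0 Q_pos.
Let rd := dot_rform m_gt0.
Let CcL f : Cc f -> L f. Proof. exact: Cc_l2. Qed.

(* With [T = (H - r)^-1] and [A] the form of [H - r], Cauchy-Schwarz gives
   [|f|^4 = A(T f, f)^2 <= <f, T f> A(f, f) <= |T| |f|^2 A(f, f)]. *)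
Lemma resolvent_gap (r : R) : (forall f, Cc f -> r * dot f f <= qd f f) ->
  resolvent_set m (H2 m G) (r%:C%C) ->
  exists2 d, 0 < d & forall f, Cc f -> (r + d) * dot f f <= qd f f.
Proof.
move=> rle [T Tb [TH _]]; have [TL _ [K K0 KP]] := bounded_operatorP Tb.
have K1 : 0 < K + 1 by rewrite ltr_wpDl.
exists (K + 1)^-1; first by rewrite invr_gt0.
have rA : rform Cc (fun f g => qd f g + (- r) * dot f g).
  by apply: energy_rform => // f cf; rewrite mulNr subr_ge0; exact: rle.
move=> f cf; have lf := CcL cf.
have H := TH f lf; set g := T f in H.
have [lg lh] := H2_lp H.
have [[_ [u au]] _ _] := H; have [cu qu ug] := au; have lu n : L (u n) := CcL (cu n).
have ug' := (lp_cvgP m_gt0 lu lg).1 ug.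
have lfc : N (f - f) @[n --> \oo] --> (0 : R).
  by rewrite subrr (lp0 m_gt0 p0).2; exact: cvg_cst.
have [lrg _] := lpZ m_gt0 r%:C%C p0 lg.
have hE : (fun x => f x + r%:C%C * g x) = f + r%:C%C *: g by [].
rewrite hE in H lh.
(* $Tf$ is accessible only through its approximations, so Cauchy-Schwarz is applied to [u n] and [f]
   and passed to the limit. *)
have a1 : qd (u n) f + (- r) * dot (u n) f @[n --> \oo] --> dot f f.
  have e : dot f f = dot (f + r%:C%C *: g) f + (- r) * dot g f.
    by rewrite (rfD rd lf lrg lf) (rfZ rd r lg lf); ring.
  rewrite e; apply: cvgD.
    exact: (H2_cvg m_gt0 Q_pos Q_closable H au lf (closure_approx_cst m_gt0 Q_pos cf)).
  apply: cvgMr.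
  exact: (@dot_cvg R X m m_gt0 u (fun=> f) g f lu (fun=> lf) lg lf ug' lfc).
have a2 : qd (u n) (u n) + (- r) * dot (u n) (u n) @[n --> \oo] --> dot f g.
  have e : dot f g = dot (f + r%:C%C *: g) g + (- r) * dot g g.
    by rewrite (rfD rd lf lrg lg) (rfZ rd r lg lg); ring.
  rewrite e; apply: cvgD; first exact: (H2_cvg m_gt0 Q_pos Q_closable H au lg au).
  by apply: cvgMr; exact: (dot_cvg m_gt0 lu lu lg lg ug' ug').
set A := qd f f + (- r) * dot f f.
have a3 : dot f f * dot f f <= dot f g * A.
  have b1 : (qd (u n) f + (- r) * dot (u n) f) * (qd (u n) f + (- r) * dot (u n) f)
      @[n --> \oo] --> dot f f * dot f f by exact: cvgM.
  have b2 : (qd (u n) (u n) + (- r) * dot (u n) (u n)) * A @[n --> \oo] --> dot f g * A.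
    exact: cvgMl.
  apply: (le_cvg_to b1 b2); apply: nearW => n.
  by have := rf_CS rA (cu n) cf; rewrite expr2.
have A0 : 0 <= A by exact: (rf_ge0 rA).
have a4 : dot f g <= (K + 1) * dot f f.
  apply: le_trans (ler_norm _) _; apply: le_trans (dot_CS m_gt0 lf lg) _.
  rewrite dot_nrm// expr2 mulrCA ler_wpM2l ?nrm_ge0//.
  apply: le_trans (KP f lf) _; rewrite ler_wpM2r ?nrm_ge0// lerDl//.
have D0 : 0 <= dot f f by exact: (rf_ge0 rd).
suff h : (K + 1)^-1 * dot f f <= A by move: h; rewrite /A mulrDl; lra.
rewrite mulrC ler_pdivrMr//.
have [->|Dn] := eqVneq (dot f f) 0; first by rewrite mulr_ge0// ltW.
have Dp : 0 < dot f f by rewrite lt_neqAle eq_sym Dn.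
rewrite -(ler_pM2r Dp); apply: (le_trans a3).
apply: le_trans (ler_wpM2r A0 a4) _.
by rewrite le_eqVlt; apply/orP; left; apply/eqP; ring.
Qed.

(** The largest lower bound [sup A] of the form belongs to the spectrum, since otherwise
    [resolvent_gap] would enlarge it. Hence it cannot lie below $\lambda_2$. *)
Lemma lambda2_le f : Cc f -> lambda2 m G * dot f f <= qd f f.
Proof.
move=> cf; have D0 : 0 <= dot f f by apply: (rf_ge0 rd); exact: CcL.
have q0 : 0 <= qd f f by exact: (rf_ge0 rq).
have [l0|l0] := leP (lambda2 m G) 0; first by apply: le_trans q0; exact: mulr_le0_ge0.
rewrite leNgt; apply/negP => bad.
have Dp : 0 < dot f f.
  by rewrite lt_neqAle D0 andbT eq_sym; apply/eqP => D; move: bad; rewrite D mulr0 ltNge q0.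
pose A := [set r : R | forall f, Cc f -> r * dot f f <= qd f f].
have ubA r : A r -> r <= qd f f / dot f f by move=> /(_ f cf); rewrite ler_pdivlMr.
have hA : has_sup A.
  split; last by exists (qd f f / dot f f) => r /ubA.
  by exists 0 => g cg; rewrite mul0r; exact: (rf_ge0 rq).
have supA : A (sup A).
  move=> g cg; have G0 : 0 <= dot g g by apply: (rf_ge0 rd); exact: CcL.
  have [->|Gn] := eqVneq (dot g g) 0; first by rewrite mulr0 (rf_ge0 rq).
  have Gp : 0 < dot g g by rewrite lt_neqAle eq_sym Gn.
  rewrite -ler_pdivlMr//; apply: ge_sup; first by case: hA.
  by move=> r /(_ g cg); rewrite ler_pdivlMr.
have sl : sup A < lambda2 m G.
  apply: (@le_lt_trans _ _ (qd f f / dot f f)); last by rewrite ltr_pdivrMr.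
  by apply: ge_sup; [case: hA|move=> r /ubA].
have rs : resolvent_set m (H2 m G) ((sup A)%:C%C).
  apply: contrapT => ns.
  (* [inf] takes the value 0 on a set without infimum, which $\lambda_2>0$ excludes. *)
  have hI : has_inf [set r : R | spectrum m (H2 m G) (r%:C)%C].
    by apply: contrapT => h; move: l0; rewrite /lambda2 inf_out// ltxx.
  have : lambda2 m G <= sup A by apply: ge_inf => //; case: hI.
  by rewrite leNgt sl.
have [d d0 dP] := resolvent_gap supA rs.
have : sup A + d <= sup A by apply: sup_ubound => //; case: hA.
by rewrite gerDl leNgt d0.
Qed.

(* [resolv h g] is $(1+hH)^{-1}g$. *)
Definition resolv (h : R) g : V :=
  xget 0 [set f | H2 m G f ((h^-1)%:C%C *: (g - f))].

(** The Galerkin solutions are kept along with the resolvent, as the $\ell^p$ estimate is proved on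
    them. *)
Lemma resolv_ex h g : 0 < h -> L g -> exists (u : nat -> V) f,
  [/\ H2 m G f ((h^-1)%:C%C *: (g - f)), forall n, L (u n - f),
    N (u n - f) @[n --> \oo] --> (0 : R) &
    forall n, exists2 K, supp_in K (u n) & forall k, supp_in K k ->
      qd (u n) k + h^-1 * dot (u n) k = dot ((h^-1)%:C%C *: g) k].
Proof.
move=> h0 lg; have [lhg _] := lpZ m_gt0 (h^-1)%:C%C p0 lg.
have hV : 0 < h^-1 by rewrite invr_gt0.
have [u [f [H H1 H2' H3]]] := resolvent_exists m_gt0 Q_pos hV Q_closable lhg.
by exists u, f; split; [rewrite scalerBr; exact: H|exact: H1|exact: H2'|exact: H3].
Qed.

Lemma resolvP h g : 0 < h -> L g -> H2 m G (resolv h g) ((h^-1)%:C%C *: (g - resolv h g)).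
Proof.
move=> h0 lg; have [u [f [H _ _ _]]] := resolv_ex h0 lg.
by apply: (@xgetPex _ _ [set f | H2 m G f ((h^-1)%:C%C *: (g - f))]); exists f.
Qed.

Lemma scale_real (a b : R) f : a%:C%C *: (b%:C%C *: f) = (a * b)%:C%C *: f.
Proof. by rewrite scalerA rmorphM. Qed.

Lemma resolv_norm h f g : 0 < h -> L g -> H2 m G f ((h^-1)%:C%C *: (g - f)) -> N f <= N g.
Proof.
move=> h0 lg H; have hV : 0 < h^-1 by rewrite invr_gt0.
have := resolvent_unique m_gt0 Q_pos h^-1 Q_closable H.
rewrite -scalerDr subrK (lpZ m_gt0 _ p0 lg).2 cmod_real gtr0_norm//.
by rewrite ler_pM2l.
Qed.

Lemma resolv_uniq h f g : 0 < h -> L g -> H2 m G f ((h^-1)%:C%C *: (g - f)) -> resolv h g = f.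
Proof.
move=> h0 lg H; have H' := resolvP h0 lg.
have HB := H2B m_gt0 Q_pos Q_closable H' H.
have [lf _] := H2_lp H; have [lr _] := H2_lp H'.
have [l0 n0] := lp0 m_gt0 p0.
have [ld _] := lpB m_gt0 p1 lr lf.
apply/eqP; rewrite -subr_eq0; apply/eqP; apply: (nrm_eq0 m_gt0 p0 ld).
apply/eqP; rewrite eq_le nrm_ge0 andbT -n0; apply: (resolv_norm h0 l0).
rewrite -scalerBr in HB; rewrite (_ : 0 - _ = g - resolv h g - (g - f))//.
by move: (resolv h g) => r; apply/funext => x; rewrite !fctE; ring.
Qed.

Lemma resolv_lp h f : 0 < h -> L f -> L (resolv h f) /\ N (resolv h f) <= N f.
Proof.
move=> h0 lf; have H := resolvP h0 lf; have [lr _] := H2_lp H.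
by split=> //; exact: resolv_norm H.
Qed.

Lemma resolvB h f g : 0 < h -> L f -> L g -> resolv h (f - g) = resolv h f - resolv h g.
Proof.
move=> h0 lf lg; have [lfg _] := lpB m_gt0 p1 lf lg.
apply: (resolv_uniq h0 lfg).
have := H2B m_gt0 Q_pos Q_closable (resolvP h0 lf) (resolvP h0 lg).
rewrite -scalerBr (_ : f - _ - (g - _) = f - g - (resolv h f - resolv h g))//.
by move: (resolv h f) (resolv h g) => r r'; apply/funext => x; rewrite !fctE; ring.
Qed.

Lemma resolvZ h (t : R) f : 0 < h -> L f -> resolv h (t%:C%C *: f) = t%:C%C *: resolv h f.
Proof.
move=> h0 lf; have [ltf _] := lpZ m_gt0 t%:C%C p0 lf.
apply: (resolv_uniq h0 ltf).
have := H2Z m_gt0 Q_pos Q_closable t (resolvP h0 lf).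
by rewrite scale_real mulrC -scale_real scalerBr.
Qed.

Lemma resolv_identity h t f : 0 < h -> 0 < t -> L f ->
  resolv t (resolv h f) - resolv h f = (t / h)%:C%C *: resolv t (resolv h f - f).
Proof.
move=> h0 t0 lf; have H := resolvP h0 lf; set w := resolv h f in H *.
have [lw lk] := H2_lp H; set k := _ *: _ in H lk.
have [ltk _] := lpZ m_gt0 t%:C%C p0 lk.
have [lwk _] := lpD m_gt0 p1 lw ltk.
(* With $k=H_2w$ this is $(1+tH_2)w=w+tk$; the identity then follows by linearity. *)
have e : resolv t (w + t%:C%C *: k) = w.
  apply: (resolv_uniq t0 lwk).
  suff -> : (t^-1)%:C%C *: (w + t%:C%C *: k - w) = k by exact: H.
  have t1 : t != 0 by rewrite gt_eqF.
  by clear -t1; move: w k => {}w {}k; rewrite addrC addKr scale_real mulVf// scale1r.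
have [lfw _] := lpB m_gt0 p1 lf lw; have [lwf _] := lpB m_gt0 p1 lw lf.
have e2 : w + t%:C%C *: k = w - (t / h)%:C%C *: (w - f).
  by rewrite /k scale_real -scalerN opprB.
have [l3 _] := lpZ m_gt0 (t / h)%:C%C p0 lwf.
rewrite e2 resolvB// resolvZ// in e.
by rewrite -{2}e subKr.
Qed.

(** With $w=(1+hH_2)^{-1}f$ and $b=w-f$, testing the equation by $b$ gives
    $\|b\|^2/h=-Q(w,b)=-Q(b)-\mathrm{Re}\,Q(f,b)\le Q(f)/4$, the last step by completing the
    square. *)
Lemma resolv_strong_Cc h f : 0 < h -> Cc f ->
  N (resolv h f - f) ^+ 2 <= h * (qd f f / 4).
Proof.
move=> h0 cf; have lf := CcL cf; have H := resolvP h0 lf; set w := resolv h f in H *.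
have [lw lk] := H2_lp H; have [[_ [u au]] _ _] := H; have [cu _ _] := au.
have [lwf _] := lpB m_gt0 p1 lw lf.
have auf := closure_approxB m_gt0 Q_pos lw lf au (closure_approx_cst m_gt0 Q_pos cf).
have c1 := H2_cvg m_gt0 Q_pos Q_closable H au lwf auf.
have e : dot ((h^-1)%:C%C *: (f - w)) (w - f) = - (h^-1 * N (w - f) ^+ 2).
  have [lfw _] := lpB m_gt0 p1 lf lw.
  have e0 : dot (f - w) (w - f) = - dot (w - f) (w - f) by rewrite -(rfN rd lwf lwf) opprB.
  by rewrite (rfZ rd h^-1 lfw lwf) e0 dot_nrm// mulrN.
rewrite e in c1.
have : - (qd f f / 4) <= - (h^-1 * N (w - f) ^+ 2).
  apply: (cvgr_to_ge c1); apply: nearW => n; set b := u n - f.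
  have cb : Cc b by exact: CcB.
  have e2 : qd (u n) b = qd b b + qd f b by rewrite -(rfD rq)//; rewrite /b subrK.
  have := rf_CS_sqrt rq cf cb; rewrite ler_norml => /andP[h1 _].
  have q1 : 0 <= qd f f by exact: (rf_ge0 rq).
  have q2 : 0 <= qd b b by exact: (rf_ge0 rq).
  rewrite e2 -[X in - (X / 4)](sqr_sqrtr q1) -[X in _ <= X + _](sqr_sqrtr q2).
  move: h1; move: (Num.sqrt (qd f f)) (Num.sqrt (qd b b)) (qd f b) => x y z h1.
  have := sqr_ge0 (y - x / 2); rewrite sqrrB expr_div_n; lra.
by rewrite lerN2 mulrC ler_pdivrMr// mulrC.
Qed.

Lemma resolv_strong f e : L f -> 0 < e ->
  exists2 d, 0 < d & forall h, 0 < h -> h < d -> N (resolv h f - f) < e.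
Proof.
move=> lf e0; have e4 : 0 < e / 4 by rewrite divr_gt0.
have [g [cg _ lfg ng]] := Cc_dense m_gt0 p0 lf e4.
have lg := CcL cg; have q0 : 0 <= qd g g by exact: (rf_ge0 rq).
have c0 : 0 < qd g g / 4 + 1 by rewrite ltr_wpDl// divr_ge0.
exists ((e / 4) ^+ 2 / (qd g g / 4 + 1)); first by rewrite divr_gt0// exprn_gt0.
move=> h h0 hd.
have [lr _] := resolv_lp h0 lg; have [lrf _] := resolv_lp h0 lf.
have [ld nd] := resolv_lp h0 lfg; have [l1 _] := lpB m_gt0 p1 lr lg.
have k1 : N (resolv h g - g) < e / 4.
  rewrite -ltr_sqr ?nnegrE ?nrm_ge0 ?(ltW e4)//.
  apply: le_lt_trans (resolv_strong_Cc h0 cg) _.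
  move: hd; rewrite ltr_pdivlMr//; apply: le_lt_trans.
  by rewrite ler_wpM2l ?(ltW h0)// lerDl.
have [l2 n2] := lpD m_gt0 p1 ld l1; have [l3 n3] := lpB m_gt0 p1 l2 lfg.
have -> : resolv h f - f = (resolv h (f - g) + (resolv h g - g)) - (f - g).
  rewrite resolvB//; move: (resolv h f) (resolv h g) => x y.
  by apply/funext => z; rewrite !fctE; ring.
by apply: (le_lt_trans n3); exact: (sum3_lt e0 n2 nd k1 ng).
Qed.

(** * The resolvent and the given semigroup *)

Section gen.
Variable S : R -> V -> V.
Hypothesis S_exp : exp_semigroup m (H2 m G) S.
Let SC0 : C0_semigroup m 2 S. Proof. by case: S_exp. Qed.

Lemma generatorP f (h : V) : L f -> L h -> H2 m G f h <->
  (forall e, 0 < e -> exists2 d, 0 < d & forall t, 0 < t -> t < d ->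
     N ((t^-1)%:C%C *: (S t f - f) + h) < e).
Proof.
move=> lf lh; have [_ /(_ f h lf lh) ->] := S_exp.
apply: (@right0P R X m (fun t => (t^-1)%:C%C *: (S t f - f) + h)) => t t0.
have [l1 _] := lpB m_gt0 p1 (semig_lp SC0 (ltW t0) lf) lf.
have [l2 _] := lpZ m_gt0 (t^-1)%:C%C p0 l1.
by have [] := lpD m_gt0 p1 l2 lh.
Qed.

(** $S_t$ commutes with the difference quotients of the semigroup and is bounded, hence preserves
    their limit. *)
Lemma semig_H2 t f (h : V) : 0 <= t -> H2 m G f h -> H2 m G (S t f) (S t h).
Proof.
move=> t0 H; have [lf lh] := H2_lp H.
have lSf := semig_lp SC0 t0 lf; have lSh := semig_lp SC0 t0 lh.
apply/generatorP => // e e0.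
have Tb : bounded_operator m 2 (S t) by have [h' _ _ _] := SC0; exact: h'.
have [TL Tl [K K0 KP]] := bounded_operatorP Tb.
have K1 : 0 < K + 1 by rewrite ltr_wpDl.
have eK : 0 < e / (K + 1) by rewrite divr_gt0.
have [d d0 D] := (generatorP lf lh).1 H _ eK; exists d => // s s0 sd.
have lSs := semig_lp SC0 (ltW s0) lf.
have [l1 _] := lpB m_gt0 p1 lSs lf.
have -> : (s^-1)%:C%C *: (S s (S t f) - S t f) + S t h =
    S t ((s^-1)%:C%C *: (S s f - f) + h).
  rewrite Tl// (linB m_gt0 p1 Tl)//.
  by rewrite -(semigD SC0 (ltW s0) t0 lf) -(semigD SC0 t0 (ltW s0) lf) (addrC s).
have [l2 _] := lpZ m_gt0 (s^-1)%:C%C p0 l1; have [l3 _] := lpD m_gt0 p1 l2 lh.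
apply: (le_lt_trans (KP _ l3)).
have h1 := D s s0 sd.
apply: (@le_lt_trans _ _ (K * (e / (K + 1)))); first by rewrite ler_wpM2l// ltW.
by rewrite mulrCA gtr_pMr// ltr_pdivrMr// mul1r ltrDl.
Qed.

Lemma resolv_comm h t f : 0 < h -> 0 <= t -> L f -> resolv h (S t f) = S t (resolv h f).
Proof.
move=> h0 t0 lf; apply: (resolv_uniq h0 (semig_lp SC0 t0 lf)).
have H := resolvP h0 lf; have [lr lk] := H2_lp H.
have [l1 _] := lpB m_gt0 p1 lf lr.
have Tb : bounded_operator m 2 (S t) by have [h' _ _ _] := SC0; exact: h'.
have [_ Tl _] := bounded_operatorP Tb.
by rewrite -(linB m_gt0 p1 Tl lf lr) -(linZ m_gt0 p1 Tl _ l1); exact: semig_H2.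
Qed.

Lemma resolv_gen h f : 0 < h -> L f -> forall e, 0 < e ->
  exists2 d, 0 < d & forall t, 0 < t -> t < d ->
    N (S t (resolv h f) - resolv h f - (t / h)%:C%C *: (resolv h f - f)) <= t * e.
Proof.
move=> h0 lf e e0; have H := resolvP h0 lf; have [lr lk] := H2_lp H.
have [d d0 D] := (generatorP lr lk).1 H e e0; exists d => // t t0 td.
have [l1 _] := lpB m_gt0 p1 (semig_lp SC0 (ltW t0) lr) lr.
have [l2 _] := lpZ m_gt0 (t^-1)%:C%C p0 l1; have [l3 _] := lpD m_gt0 p1 l2 lk.
have -> : S t (resolv h f) - resolv h f - (t / h)%:C%C *: (resolv h f - f) =
   t%:C%C *: ((t^-1)%:C%C *: (S t (resolv h f) - resolv h f) + (h^-1)%:C%C *: (f - resolv h f)).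
  have t1 : t != 0 by rewrite gt_eqF.
  by rewrite [RHS]scalerDr !scale_real mulfV// scale1r -(opprB (resolv h f) f) scalerN.
rewrite (lpZ m_gt0 _ p0 l3).2 cmod_real gtr0_norm// ler_wpM2l ?(ltW t0)// ltW//.
exact: D.
Qed.

Lemma euler_resolv t f : 0 < t -> L f ->
  N (S t f - iter n.+1 (resolv (t / n.+1%:R)) f) @[n --> \oo] --> (0 : R).
Proof.
move=> t0 lf; apply: (euler_formula m_gt0 p1 SC0 _ _ _ _ _ _ t0 lf).
- exact: resolv_lp.
- exact: resolvB.
- exact: resolv_comm.
- exact: resolv_strong.
- exact: resolv_gen.
- exact: resolv_identity.
Qed.

End gen.
End spectral.

(** * The Stroock-Varopoulos inequality *)

Section pointwise.
Variable R : realType.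
Implicit Types (x y k p : R) (z w : R[i]).

(** This is $2\sinh x$. *)
Definition sh x : R := expR x - expR (- x).

Lemma sh_ge0 x : 0 <= x -> 0 <= sh x.
Proof. by move=> x0; rewrite subr_ge0 ler_expR; lra. Qed.

Lemma shN x : sh (- x) = - sh x.
Proof. by rewrite /sh opprK opprB. Qed.

Lemma ch_le x y : 0 <= y -> y <= x -> expR y + expR (- y) <= expR x + expR (- x).
Proof.
move=> y0 yx; rewrite -subr_ge0.
have -> : expR x + expR (- x) - (expR y + expR (- y)) =
    (expR x - expR y) * (1 - expR (- x) * expR (- y)).
  have ex := expRxMexpNx_1 x; have ey := expRxMexpNx_1 y.
  transitivity (expR x + expR (- x) * (expR y * expR (- y)) - expR y -
    (expR x * expR (- x)) * expR (- y)); last by ring.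
  by rewrite ex ey; ring.
apply: mulr_ge0; first by rewrite subr_ge0 ler_expR.
by rewrite subr_ge0 -expRD -(@expR0 R) ler_expR; lra.
Qed.

(** The difference vanishes at 0 and has derivative $2k(\cosh t-\cosh kt)\ge0$. *)
Lemma sh_scale k x : 0 <= k -> k <= 1 -> 0 <= x -> sh (k * x) <= k * sh x.
Proof.
move=> k0 k1 x0; rewrite -subr_ge0.
pose g := fun t : R => k * (expR t - expR (- t)) - (expR (k * t) - expR (- (k * t))).
have dg (t : R) : is_derive t 1 g
   (k * (expR t + expR (- t)) - k * (expR (k * t) + expR (- (k * t)))).
  rewrite /g; apply: is_derive_eq.
  by rewrite -![_ *: _]/(_ * _); ring.
have g0 : g 0 = 0 by rewrite /g !mulr0 !oppr0 !subrr mulr0 subrr.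
rewrite -[X in X <= _]g0.
apply: (@ger0_derive1_ndecr R g 0 x) => //.
- move=> t t0x; rewrite derive1E; have := dg t => /@derive_val ->.
  have /andP[t0 _] : 0 < t < x by move: t0x; rewrite in_itv.
  rewrite -mulrBr mulr_ge0// subr_ge0; apply: ch_le.
    by rewrite mulr_ge0// ltW.
  by rewrite ger_pMl.
- apply: derivable_within_continuous => t _; exact: (@ex_derive _ _ _ _ _ _ _ (dg t)).
Qed.

Lemma sh_scale_sqr k x : `|k| <= 1 -> sh (k * x) ^+ 2 <= k ^+ 2 * sh x ^+ 2.
Proof.
move=> k1.
have shabs y : sh y ^+ 2 = sh `|y| ^+ 2.
  by have [y0|y0] := leP 0 y; [rewrite ger0_norm|rewrite ltr0_norm// shN sqrrN].
rewrite shabs (shabs x) normrM -(real_normK (num_real k)) -exprMn.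
rewrite ler_sqr ?nnegrE ?sh_ge0 ?mulr_ge0 ?sh_ge0//.
exact: sh_scale.
Qed.

Lemma sh_sqr x : sh x ^+ 2 = expR (2 * x) + expR (- (2 * x)) - 2.
Proof.
have ex := expRxMexpNx_1 x.
have -> : 2 * x = x + x by ring.
rewrite opprD !expRD /sh sqrrB -mulr_natl ex; ring.
Qed.

Lemma powR_expR (r p : R) : 0 < r -> r `^ p = expR (p * ln r).
Proof. by move=> r0; rewrite /powR gt_eqF. Qed.

(* Writing [r = exp a], [s = exp b], the claim becomes
   [sinh (k x) ^ 2 <= k ^ 2 sinh x ^ 2] with [x = p(a-b)/4] and [k = (p-2)/p]. *)
Lemma stroock_varopoulos_real (p r s t : R) : 1 <= p -> 0 < r -> 0 < s -> t <= r * s ->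
  4 * ((p - 1) / p ^+ 2) * (r `^ p + s `^ p - 2 * (r `^ (p / 2 - 1) * s `^ (p / 2 - 1)) * t) <=
  r `^ p + s `^ p - (r `^ (p - 2) + s `^ (p - 2)) * t.
Proof.
move=> p1 r0 s0 trs; have p0 : 0 < p by lra.
set a := ln r; set b := ln s; pose k := (p - 2) / p; pose x := p * (a - b) / 4.
have k1 : `|k| <= 1.
  by rewrite ler_norml ler_pdivlMr// ler_pdivrMr//; lra.
have pn : p != 0 by rewrite gt_eqF.
(* This is where the constant $C_p$ comes from. *)
have hC : 4 * ((p - 1) / p ^+ 2) = 1 - k ^+ 2 by rewrite /k; field.
have := sh_scale_sqr x k1; rewrite !sh_sqr.
have ra : r = expR a by rewrite lnK.
have sb : s = expR b by rewrite lnK.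
pose A := expR (p * (a + b) / 2).
have A0 : 0 < A by exact: expR_gt0.
(* In the application $t=\mathrm{Re}(z\overline w)$, so [th] is the cosine of the angle between $z$
   and $w$; [A] is the geometric mean of $r^p$ and $s^p$. *)
pose th := t / (r * s).
have rs0 : 0 < r * s by exact: mulr_gt0.
have th1 : th <= 1 by rewrite ler_pdivrMr// mul1r.
have tE : t = th * (expR a * expR b) by rewrite -ra -sb divfK// gt_eqF.
set P := expR (2 * x); set P' := expR (- (2 * x)).
set Q := expR (2 * (k * x)); set Q' := expR (- (2 * (k * x))).
have e1 : r `^ p = A * P by rewrite powR_expR// -expRD; congr expR; rewrite /x -/a; field.
have e2 : s `^ p = A * P' by rewrite powR_expR// -expRD; congr expR; rewrite /x -/b; field.
have e3 : r `^ (p - 2) * (expR a * expR b) = A * Q.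
  by rewrite powR_expR// -!expRD; congr expR; rewrite /x /k -/a; field.
have e4 : s `^ (p - 2) * (expR a * expR b) = A * Q'.
  by rewrite powR_expR// -!expRD; congr expR; rewrite /x /k -/b; field.
have e5 : r `^ (p / 2 - 1) * s `^ (p / 2 - 1) * (expR a * expR b) = A.
  by rewrite !powR_expR// -!expRD; congr expR; rewrite -/a -/b; field.
move=> h.
have hQ : 0 <= Q + Q' - 2 by rewrite -sh_sqr sqr_ge0.
rewrite hC -subr_ge0.
(* The gap splits into the hyperbolic inequality, which is the case of equal phases, and a
   nonnegative multiple of $1-$[th]. *)
have -> : r `^ p + s `^ p - (r `^ (p - 2) + s `^ (p - 2)) * t -
  (1 - k ^+ 2) * (r `^ p + s `^ p - 2 * (r `^ (p / 2 - 1) * s `^ (p / 2 - 1)) * t) =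
  A * (k ^+ 2 * (P + P' - 2) - (Q + Q' - 2) + (1 - th) * ((Q + Q' - 2) + 2 * k ^+ 2)).
  rewrite e1 e2 tE.
  transitivity (A * P + A * P' - th * (r `^ (p - 2) * (expR a * expR b)) -
      th * (s `^ (p - 2) * (expR a * expR b)) - (1 - k ^+ 2) * (A * P + A * P' -
    2 * th * (r `^ (p / 2 - 1) * s `^ (p / 2 - 1) * (expR a * expR b)))); first by ring.
  by rewrite e3 e4 e5; ring.
apply: mulr_ge0; first exact: ltW.
have k2 : 0 <= k ^+ 2 by exact: sqr_ge0.
apply: addr_ge0; first by rewrite subr_ge0.
by apply: mulr_ge0; [rewrite subr_ge0|apply: addr_ge0 => //; exact: mulr_ge0].
Qed.

(** $z|z|^{p-1}$, of modulus $|z|^p$. Exponent $p-1$ produces the test function, exponent $p/2$ the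
    function $v$. *)
Definition signed_pow p z : R[i] := (cmod z `^ (p - 1))%:C%C * z.

Lemma signed_pow0 p : signed_pow p 0 = 0.
Proof. by rewrite /signed_pow mulr0. Qed.

Lemma cmod_signed_pow p z : 0 < p -> cmod (signed_pow p z) = cmod z `^ p.
Proof.
move=> p0; rewrite /signed_pow Normc.normcM cmod_real ger0_norm ?powR_ge0// mulrC.
by rewrite mulr_powRB1// cmod_ge0.
Qed.

(** Equivariance under phases, by which the magnetic gradient of a signed power reduces to the
    inequality for two complex numbers. *)
Lemma signed_powM p (o z : R[i]) : cmod o = 1 -> signed_pow p (o * z) = o * signed_pow p z.
Proof. by move=> o1; rewrite /signed_pow Normc.normcM o1 mul1r; ring. Qed.

Lemma rdot_comb (k l : R) z w :
  rdot (z - w) (k%:C%C * z - l%:C%C * w) =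
  k * cmod z ^+ 2 + l * cmod w ^+ 2 - (k + l) * rdot z w.
Proof. by rewrite -!rdotzz; case: z w => [a b] [c d]; rewrite /rdot /=; ring. Qed.

Lemma rdot_comb2 (k l : R) z w :
  rdot (k%:C%C * z - l%:C%C * w) (k%:C%C * z - l%:C%C * w) =
  k ^+ 2 * cmod z ^+ 2 + l ^+ 2 * cmod w ^+ 2 - 2 * (k * l) * rdot z w.
Proof. by rewrite -!rdotzz; case: z w => [a b] [c d]; rewrite /rdot /=; ring. Qed.

Lemma rdot_signed_pow p z : 1 < p -> rdot z (signed_pow (p - 1) z) = cmod z `^ p.
Proof.
move=> p1; rewrite rdotC /signed_pow rdotZ rdotzz.
have [z0|z0] := eqVneq (cmod z) 0.
  by rewrite z0 expr0n mulr0 powR0// gt_eqF//; lra.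
have zp : 0 < cmod z by rewrite lt_neqAle eq_sym z0 cmod_ge0.
rewrite -powR_mulrn ?cmod_ge0// -powRD; last by rewrite z0 implybT.
by congr powR; ring.
Qed.

Lemma Cp_le1 p : 0 < p -> 4 * ((p - 1) / p ^+ 2) <= 1.
Proof.
move=> p0; rewrite mulrA ler_pdivrMr ?exprn_gt0// mul1r.
have := sqr_ge0 (p - 2); rewrite sqrrB; lra.
Qed.

Lemma stroock_varopoulos p z w : 1 < p ->
  4 * ((p - 1) / p ^+ 2) * rdot (signed_pow (p / 2) z - signed_pow (p / 2) w)
    (signed_pow (p / 2) z - signed_pow (p / 2) w) <=
  rdot (z - w) (signed_pow (p - 1) z - signed_pow (p - 1) w).
Proof.
move=> p1; have p0 : 0 < p by lra.
have p2 : 0 < p / 2 by rewrite divr_gt0.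
have half (y : R[i]) : cmod (signed_pow (p / 2) y) ^+ 2 = cmod y `^ p.
  rewrite cmod_signed_pow// -powR_mulrn ?powR_ge0// -powRrM.
  by congr powR; rewrite divfK.
(* If $z$ or $w$ vanishes, the logarithmic substitution breaks down, and the claim is just
   $C_p\le1$. *)
have degen (y : R[i]) : 4 * ((p - 1) / p ^+ 2) * cmod (signed_pow (p / 2) y) ^+ 2 <=
    rdot y (signed_pow (p - 1) y).
  rewrite half rdot_signed_pow//; rewrite -[leRHS]mul1r ler_wpM2r ?powR_ge0//.
  exact: Cp_le1.
have [->|z0] := eqVneq z 0.
  rewrite !signed_pow0 !sub0r rdotzz normcN.
  have -> : rdot (- w) (- signed_pow (p - 1) w) = rdot w (signed_pow (p - 1) w).
    by case: w (signed_pow _ w) => [a b] [c d]; rewrite /rdot /=; ring.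
  exact: degen.
have [->|w0] := eqVneq w 0.
  by rewrite !signed_pow0 !subr0 rdotzz; exact: degen.
have cpos (y : R[i]) : y != 0 -> 0 < cmod y.
  move=> y0; rewrite lt_neqAle cmod_ge0 andbT eq_sym; apply: contra_neq y0.
  exact: Normc.eq0_normc.
have zp := cpos z z0; have wp := cpos w w0.
have sq (y : R[i]) (q : R) : y != 0 -> cmod y `^ q * cmod y ^+ 2 = cmod y `^ (q + 2).
  move=> yn; have y0 := cpos y yn; rewrite -powR_mulrn ?cmod_ge0// -powRD//.
  by rewrite (gt_eqF y0) implybT.
have sq2 (y : R[i]) : y != 0 -> (cmod y `^ (p / 2 - 1)) ^+ 2 * cmod y ^+ 2 = cmod y `^ p.
  move=> y0; rewrite -(powR_mulrn 2 (powR_ge0 _ _)) -powRrM sq//; congr powR.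
  by rewrite mulrBl divfK// mul1r subrK.
rewrite /signed_pow rdot_comb2 rdot_comb !sq2// !sq//.
rewrite (_ : p - 1 - 1 + 2 = p); last by ring.
rewrite (_ : p - 1 - 1 = p - 2); last by ring.
apply: stroock_varopoulos_real => //; first exact: ltW.
exact: le_trans (ler_norm _) (rdot_norm _ _).
Qed.

End pointwise.

(** * The $\ell^p$ bounds *)

Lemma form_arith1 (R : realFieldType) (k a b c : R) : k * a <= b ->
  k * (2^-1 * a + c) + (1 - k) * c <= 2^-1 * b + c.
Proof. lra. Qed.

Lemma form_arith2 (R : realFieldType) (k M C a b c d l : R) :
  k * c + (1 - k) * b <= a -> (1 - k) * - (M * c + C * d) <= (1 - k) * b ->
  (k - M * (1 - k)) * (l * d) <= (k - M * (1 - k)) * c ->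
  ((k - M * (1 - k)) * l - C * (1 - k)) * d <= a.
Proof. lra. Qed.

Lemma form_arith3 (R : realFieldType) (k a b : R) :
  a <= k * b + (1 - k) * a -> k * a <= k * b.
Proof. lra. Qed.

Section pbound.
Variables (R : realType) (X : choiceType) (m : X -> R).
Hypothesis m_gt0 : forall x, 0 < m x.
Variable G : magnetic_schrodinger_graph R X.
Hypothesis Q_pos : form_positive G.
Hypothesis Q_closable : form_closable m G.
Variables M C : R.
Hypothesis c_bounded : form_bounded m G M C.
Notation V := (X -> R[i]).
Implicit Types (f g u : V) (h t : R).
Notation dot := (dot m).
Notation qd := (qd G).

Let q1 : 1 <= 2 :> R. Proof. by rewrite ler1n. Qed.
Let q0 : 0 < 2 :> R. Proof. by []. Qed.
Let rq := qd_rform m_gt0 Q_pos.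
Let rd := dot_rform m_gt0.
Let CcL f : Cc f -> lp m 2 f. Proof. exact: Cc_l2. Qed.

Lemma elec_neg_le f : Cc f ->
  rsum (fun x => elec_neg G x * rdot (f x) (f x)) <= M * qd f f + C * dot f f.
Proof.
move=> cf; set g : V := fun x => (Num.sqrt (elec_neg G x / m x))%:C%C * f x.
have cg : Cc g by apply: (Cc_sub cf) => x fx; rewrite /g fx mulr0.
have := c_bounded cf; rewrite /= -/g (lpE (CcL cg)) (lpE (CcL cf)).
rewrite -!EFinM -EFinD lee_fin -!expr2 -(dot_nrm m_gt0 (CcL cg)) -(dot_nrm m_gt0 (CcL cf)).
rewrite qformE; apply: le_trans.
rewrite le_eqVlt; apply/orP; left; apply/eqP; congr rsum; apply/funext => x.
have e0 : 0 <= elec_neg G x by rewrite /elec_neg oppr_ge0 ge_min lexx orbT.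
rewrite /g rdotZ rdotC rdotZ mulrA mulrA -(mulrA (m x)) -expr2 sqr_sqrtr.
  by rewrite mulrC mulrCA divff ?mulr1 ?(mulrC (rdot _ _))// gt_eqF.
by rewrite divr_ge0// ltW.
Qed.

Section exponent.
Variable p : R.
Hypothesis p1 : 1 < p.
Let p0 : 0 < p. Proof. exact: lt_trans p1. Qed.
Let Cp := 4 * ((p - 1) / p ^+ 2).
Hypothesis Cp_ge : 0 <= Cp - M * (1 - Cp).
Let Dp := (Cp - M * (1 - Cp)) * lambda2 m G - C * (1 - Cp).

Lemma Cc_signed_pow (q : R) f : Cc f -> Cc (fun x => signed_pow q (f x)).
Proof. by move=> cf; apply: (Cc_sub cf) => x ->; rewrite signed_pow0. Qed.

Lemma nabla_signed_pow (q : R) f xy : nabla G (fun x => signed_pow q (f x)) xy =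
  signed_pow q (f xy.1) - signed_pow q (magn G xy.1 xy.2 * f xy.2).
Proof. by rewrite /nabla signed_powM// magn_cmod. Qed.

Lemma rdot_half (z : R[i]) :
  rdot (signed_pow (p / 2) z) (signed_pow (p / 2) z) = rdot z (signed_pow (p - 1) z).
Proof.
rewrite rdot_signed_pow// rdotzz cmod_signed_pow ?divr_gt0//.
by rewrite -powR_mulrn ?powR_ge0// -powRrM divfK.
Qed.

Lemma qd_signed_pow f : Cc f ->
  Dp * dot (fun x => signed_pow (p / 2) (f x)) (fun x => signed_pow (p / 2) (f x)) <=
  qd f (fun x => signed_pow (p - 1) (f x)).
Proof.
move=> cf; set v : V := fun x => signed_pow (p / 2) (f x).
set w : V := fun x => signed_pow (p - 1) (f x).
have cv : Cc v by exact: Cc_signed_pow. have cw : Cc w by exact: Cc_signed_pow.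
have Cp1 : 0 <= 1 - Cp by rewrite subr_ge0; exact: Cp_le1.
have h1 : Cp * rsum (fun xy : X * X => edge G xy.1 xy.2 * rdot (nabla G v xy) (nabla G v xy)) <=
    rsum (fun xy : X * X => edge G xy.1 xy.2 * rdot (nabla G f xy) (nabla G w xy)).
  rewrite -(rsumZ _ (asum_qd1 G cv cv)); apply: ler_rsum.
  - exact: asumZ (asum_qd1 G cv cv).
  - exact: asum_qd1.
  - move=> xy; rewrite mulrCA; apply: ler_wpM2l; first exact: edge_ge0.
    by rewrite !nabla_signed_pow; exact: stroock_varopoulos.
have h2 : rsum (fun x => elec G x * rdot (f x) (w x)) = rsum (fun x => elec G x * rdot (v x) (v x)).
  by congr rsum; apply/funext => x; rewrite rdot_half.
have h3 : - (M * qd v v + C * dot v v) <= rsum (fun x => elec G x * rdot (v x) (v x)).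
  apply: (@le_trans _ _ (- rsum (fun x => elec_neg G x * rdot (v x) (v x)))).
    by rewrite lerN2; exact: elec_neg_le.
  rewrite -(rsumN (asum_qd2 _ _ cv)); apply: ler_rsum.
  - exact: asumN (asum_qd2 _ _ cv).
  - exact: asum_qd2.
  - move=> x; rewrite -mulNr; apply: ler_wpM2r; first by rewrite rdotzz sqr_ge0.
    by rewrite /elec_neg opprK ge_min lexx.
have h4 := lambda2_le m_gt0 Q_pos Q_closable cv.
(* The edge part gains the factor $C_p$, but the potential part is reproduced exactly, as
   $\mathrm{Re}(f\overline w)=|v|^2$ pointwise; its surplus $1-C_p$ is what form boundedness has to
   absorb. *)
have h5 : Cp * qd v v + (1 - Cp) * rsum (fun x => elec G x * rdot (v x) (v x)) <= qd f w.
  rewrite [in leRHS]/qd h2 {1}/qd.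
  exact: form_arith1.
have h6 := ler_wpM2l Cp1 h3; have h7 := ler_wpM2l Cp_ge h4.
exact: form_arith2 h5 h6 h7.
Qed.

Lemma galerkin_lp (a : R) (K : seq X) g u : 0 < a + Dp -> lp m p g -> supp_in K u ->
  (forall k, supp_in K k -> qd u k + a * dot u k = dot g k) ->
  nrm m p u <= nrm m p g / (a + Dp).
Proof.
set b := a + Dp => b0 lg uK ug.
have cu : Cc u by exact: supp_in_Cc uK.
set v : V := fun x => signed_pow (p / 2) (u x).
set w : V := fun x => signed_pow (p - 1) (u x).
have cv : Cc v by exact: Cc_signed_pow. have cw : Cc w by exact: Cc_signed_pow.
have wK : supp_in K w by move=> x /uK ux; rewrite /w ux signed_pow0.
have mpow (f : V) x : 0 <= m x * cmod (f x) `^ p.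
  by apply: mulr_ge0; [exact: ltW|exact: powR_ge0].
have rv x : rdot (v x) (v x) = cmod (u x) `^ p by rewrite rdot_half rdot_signed_pow.
pose P := rsum (fun x => m x * cmod (u x) `^ p).
have sP : asum (fun x => m x * cmod (u x) `^ p).
  have := asum_dot m_gt0 (CcL cv) (CcL cv).
  by rewrite (_ : (fun x => _) = fun x => m x * cmod (u x) `^ p)//; apply/funext => x; rewrite rv.
have dv : dot v v = P by congr rsum; apply/funext => x; rewrite rv.
have du : dot u w = P by congr rsum; apply/funext => x; rewrite rdot_signed_pow.
have h1 := qd_signed_pow cu; rewrite -/v -/w dv in h1.
have h2 := ug w wK; rewrite du in h2.
have h3 : b * P <= dot g w by rewrite -h2 /b mulrDl addrC lerD2r.
(* Dividing by [b] first lets Young's inequality be used with its standard constants: $P\le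
   p^{-1}\|g'\|_p^p+(1-p^{-1})P$, and the last term is absorbed. *)
pose g' : V := (b^-1)%:C%C *: g.
have [lg' ng'] := lpZ m_gt0 (b^-1)%:C%C p0 lg.
rewrite -/g' cmod_real gtr0_norm ?invr_gt0// in lg' ng'.
have sG : asum (fun x => m x * cmod (g' x) `^ p).
  exists (nrm m p g' `^ p) => s us; apply: le_trans (nrm_sum m_gt0 p0 lg' us).
  by apply: ler_sum => x _; rewrite ger0_norm.
pose q := p / (p - 1).
have p10 : 0 < p - 1 by rewrite subr_gt0.
have q00 : 0 < q by rewrite divr_gt0.
have qV : q^-1 = 1 - p^-1 by rewrite /q; field; rewrite !gt_eqF.
have young x : rdot (g x) (w x) <= b * (p^-1 * cmod (g' x) `^ p + q^-1 * cmod (u x) `^ p).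
  apply: le_trans (ler_norm _) _; apply: le_trans (rdot_norm _ _) _.
  have -> : cmod (g x) = b * cmod (g' x).
    rewrite /g' fctE -[_ *: _]/(_ * _) Normc.normcM cmod_real gtr0_norm ?invr_gt0//.
    by rewrite mulrA mulfV ?mul1r// gt_eqF.
  rewrite -mulrA ler_wpM2l ?(ltW b0)// /w cmod_signed_pow//.
  have pq1 : p^-1 + q^-1 = 1 by rewrite qV; ring.
  have := @conjugate_powR R (cmod (g' x)) (cmod (u x) `^ (p - 1)) p q
    (cmod_ge0 _) (powR_ge0 _ _) p0 q00 pq1.
  rewrite -powRrM (_ : (p - 1) * q = p); last by rewrite /q mulrCA mulfV ?mulr1 ?gt_eqF.
  by rewrite mulrC (mulrC q^-1) (mulrC p^-1) mulrC.
have h4 : dot g w <= b * (p^-1 * rsum (fun x => m x * cmod (g' x) `^ p) + q^-1 * P).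
  rewrite -(rsumZ _ sG) -(rsumZ _ sP) -(rsumD (asumZ _ sG) (asumZ _ sP)).
  rewrite -(rsumZ b (asumD (asumZ _ sG) (asumZ _ sP))); apply: ler_rsum.
  - have [s us ws] := (CcP w).1 cw; apply: (asum_supp us) => x /ws ->.
    by rewrite /rdot/= !mulr0 addr0 mulr0.
  - exact: asumZ (asumD (asumZ _ sG) (asumZ _ sP)).
  - move=> x; rewrite (mulrCA p^-1) (mulrCA q^-1) -mulrDr (mulrCA b).
    by apply: ler_wpM2l; [exact: ltW|exact: young].
have h5 : P <= rsum (fun x => m x * cmod (g' x) `^ p).
  have := le_trans h3 h4; rewrite (ler_pM2l b0) qV => /form_arith3.
  by rewrite ler_pM2l// invr_gt0.
rewrite mulrC -ng'.
have [|_ //] := (nrm_leP m_gt0 u p0 (nrm_ge0 m p g')).2.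
move=> s us; apply: (@le_trans _ _ P).
  by rewrite /P rsum_nsum//; exact: nsum_sum.
apply: le_trans h5 _; apply: rsum_le => // s' us'.
apply: le_trans (nrm_sum m_gt0 p0 lg' us').
by apply: ler_sum => x _; rewrite ger0_norm.
Qed.

(** The Galerkin solutions converge in $\ell^2$, hence pointwise, and Fatou's lemma transfers their
    $\ell^p$ bound. *)
Lemma resolv_lp_bound h g : 0 < h -> 0 < 1 + h * Dp -> lp m 2 g -> lp m p g ->
  lp m p (resolv m G h g) /\ nrm m p (resolv m G h g) <= nrm m p g / (1 + h * Dp).
Proof.
move=> h0 hD l2g lpg; have [u [f [H luf uf uK]]] := resolv_ex m_gt0 Q_pos Q_closable h0 l2g.
rewrite (resolv_uniq m_gt0 Q_pos Q_closable h0 l2g H).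
have hV : 0 < h^-1 by rewrite invr_gt0.
have hh : h^-1 + Dp = h^-1 * (1 + h * Dp) by rewrite mulrDr mulr1 mulKf// gt_eqF.
have hD' : 0 < h^-1 + Dp by rewrite hh mulr_gt0.
have [lhg nhg] := lpZ m_gt0 (h^-1)%:C%C p0 lpg.
apply: (@lp_fatou R X m m_gt0 nat \oo _ p u f (fun=> nrm m p g / (1 + h * Dp)) _ p0).
- by move=> n; have [K uK' _] := uK n; apply: Cc_lp => //; exact: supp_in_Cc uK'.
- apply: nearW => n; have [K uK' uE] := uK n.
  apply: le_trans (galerkin_lp hD' lhg uK' uE) _.
  rewrite nhg cmod_real gtr0_norm// hh invfM mulrACA (mulrC h^-1) invrK mulfV ?gt_eqF//.
  by rewrite mul1r.
- exact: cvg_cst.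
- by move=> x; exact: (nrm_cvg_pt m_gt0 x q0 luf uf).
Qed.

Lemma iter_resolv_bound h g n : 0 < h -> 0 < 1 + h * Dp -> lp m 2 g -> lp m p g ->
  [/\ lp m 2 (iter n (resolv m G h) g), lp m p (iter n (resolv m G h) g) &
  nrm m p (iter n (resolv m G h) g) <= (1 + h * Dp)^-1 ^+ n * nrm m p g].
Proof.
move=> h0 hD l2g lpg; elim: n => [|n [l2 l1 IH]] /=; first by rewrite expr0 mul1r.
have [k1 k2] := resolv_lp_bound h0 hD l2 l1.
have [k3 _] := resolv_lp m_gt0 Q_pos Q_closable h0 l2.
split=> //; apply: (le_trans k2).
rewrite mulrC exprS -mulrA ler_wpM2l// invr_ge0 ltW//.
Qed.

Variable S : R -> V -> V.
Hypothesis S_exp : exp_semigroup m (H2 m G) S.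

Lemma semig_lp_bound t f : 0 <= t -> lp m 2 f -> lp m p f ->
  lp m p (S t f) /\ nrm m p (S t f) <= expR (- Dp * t) * nrm m p f.
Proof.
have [SC0 _] := S_exp.
rewrite le_eqVlt => /predU1P[<-|t0] l2f lpf.
  by rewrite (semig0 SC0 l2f) mulr0 expR0 mul1r.
(* $D_p$ may be negative; starting Euler's products at index $N$ keeps every $1+hD_p$ positive. *)
pose N := Num.bound (t * `|Dp|).
have tN : t * `|Dp| < N%:R by apply: archi_boundP; exact: mulr_ge0 (ltW t0) _.
pose y n : R := t / (n + N).+1%:R * Dp.
have n0 n : 0 < (n + N).+1%:R :> R by [].
have tn n : 0 < t / (n + N).+1%:R by rewrite divr_gt0.
have y1 n : 0 < 1 + y n.
  suff : `|y n| < 1 by rewrite ltr_norml => /andP[]; lra.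
  rewrite /y !normrM normfV (gtr0_norm t0) (gtr0_norm (n0 n)) mulrAC ltr_pdivrMr// mul1r.
  by apply: lt_le_trans tN _; rewrite ler_nat leqW// leq_addl.
pose w n : V := iter (n + N).+1 (resolv m G (t / (n + N).+1%:R)) f.
have wP n : [/\ lp m 2 (w n), lp m p (w n) &
    nrm m p (w n) <= (1 + y n)^-1 ^+ (n + N).+1 * nrm m p f].
  exact: (iter_resolv_bound _ (tn n) (y1 n)).
(* From $(1+y)^{-1}=1-y/(1+y)\le e^{-y/(1+y)}$, valid for either sign of $y$, and
   $(n+N+1)y_n=tD_p$. *)
have eb n : (1 + y n)^-1 ^+ (n + N).+1 <= expR (- (t * Dp) / (1 + y n)).
  have -> : - (t * Dp) / (1 + y n) = (- (y n / (1 + y n))) *+ (n + N).+1.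
    have <- : y n * (n + N).+1%:R = t * Dp by rewrite /y mulrAC divfK.
    by rewrite -[RHS]mulr_natr !mulNr (mulrAC (y n)).
  rewrite -mulr_natl expRM_natl; apply: lerXn2r;
    rewrite ?nnegrE ?invr_ge0 ?expR_ge0// ?(ltW (y1 n))//.
  apply: le_trans (expR_ge1Dx _).
  rewrite (_ : 1 + - (y n / (1 + y n)) = (1 + y n)^-1)//.
  by field; rewrite gt_eqF.
have y_cvg : y n @[n --> \oo] --> (0 : R).
  have h1 : (n.+1%:R^-1 : R) @[n --> \oo] --> (0 : R) by exact: cvg_harmonic.
  have h2 : ((n + N).+1%:R^-1 : R) @[n --> \oo] --> (0 : R).
    by rewrite (cvg_shiftn N (fun n => n.+1%:R^-1 : R)).
  rewrite -[0 in X in _ --> X](mul0r (t * Dp)).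
  rewrite (_ : y = fun n => (n + N).+1%:R^-1 * (t * Dp)); first exact: cvgMl.
  by apply/funext => n; rewrite /y; ring.
have B_cvg : expR (- (t * Dp) / (1 + y n)) * nrm m p f @[n --> \oo] --> expR (- Dp * t) * nrm m p f.
  apply: cvgMl.
  have k : - (t * Dp) / (1 + y n) @[n --> \oo] --> - Dp * t.
    rewrite (_ : - Dp * t = - (t * Dp) / (1 + 0)); last by rewrite addr0 divr1; ring.
    apply: cvgMr; apply: cvgV; first by rewrite addr0 oner_neq0.
    by apply: cvgD => //; exact: cvg_cst.
  have c : {for - Dp * t, continuous (@expR R)} by exact: continuous_expR.
  exact: (cvg_comp _ _ k c).
have lS := semig_lp SC0 (ltW t0) l2f.
have lw n : lp m 2 (w n - S t f) by have [l _ _] := wP n; have [] := lpB m_gt0 q1 l lS.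
have w_cvg : nrm m 2 (w n - S t f) @[n --> \oo] --> (0 : R).
  have := euler_resolv m_gt0 Q_pos Q_closable S_exp t0 l2f.
  rewrite -(cvg_shiftn N).
  have e n : nrm m 2 (S t f - w n) = nrm m 2 (w n - S t f).
    by rewrite -opprB (lpN m_gt0 q0 (lw n)).2.
  by under eq_fun do rewrite e.
apply: (@lp_fatou R X m m_gt0 nat \oo _ p w (S t f) _ _ p0 _ _ B_cvg).
- by move=> n; have [] := wP n.
- apply: nearW => n; have [_ _ h] := wP n; apply: (le_trans h).
  by rewrite ler_wpM2r ?nrm_ge0.
- by move=> x; exact: (nrm_cvg_pt m_gt0 x q0 lw w_cvg).
Qed.

End exponent.
End pbound.

(** * Extension to $\ell^p$ *)

Section extension.
Variables (R : realType) (X : choiceType) (m : X -> R).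
Hypothesis m_gt0 : forall x, 0 < m x.
Notation V := (X -> R[i]).
Implicit Types (f g : V) (u v : nat -> V).
Variable p : R.
Hypothesis p1 : 1 <= p.
Let p0 : 0 < p. Proof. exact: lt_le_trans p1. Qed.
Let q0 : 0 < 2 :> R. Proof. by []. Qed.
Let q1 : 1 <= 2 :> R. Proof. by rewrite ler1n. Qed.
Notation L := (lp m p).
Notation L2 := (lp m 2).
Notation N := (nrm m p).

Definition nrm_cvg u f := N (u n - f) @[n --> \oo] --> (0 : R).

Lemma nrm_cvg_uniq u f g : (forall n, L (u n)) -> L f -> L g ->
  nrm_cvg u f -> nrm_cvg u g -> f = g.
Proof.
move=> lu lf lg uf ug; have [lfg _] := lpB m_gt0 p1 lf lg.
apply/eqP; rewrite -subr_eq0; apply/eqP; apply: (nrm_eq0 m_gt0 p0 lfg).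
apply/eqP; rewrite eq_le nrm_ge0 andbT.
apply: (cvgr_to_ge (cvg0D ug uf)); apply: nearW => n.
have [l1 _] := lpB m_gt0 p1 (lu n) lf; have [l2 _] := lpB m_gt0 p1 (lu n) lg.
have [_] := lpB m_gt0 p1 l2 l1.
by rewrite (_ : u n - g - (u n - f) = f - g)//; apply/funext => x; rewrite !fctE; ring.
Qed.

Lemma nrm_cvg_lin (a : R[i]) u v f g : (forall n, L (u n)) -> (forall n, L (v n)) ->
  L f -> L g -> nrm_cvg u f -> nrm_cvg v g ->
  nrm_cvg (fun n => a *: u n + v n) (a *: f + g).
Proof.
move=> lu lv lf lg uf vg.
have luf n : L (u n - f) by have [] := lpB m_gt0 p1 (lu n) lf.
have lvg n : L (v n - g) by have [] := lpB m_gt0 p1 (lv n) lg.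
apply: (@cvg0_sq _ _ _ _ _ (fun n => cmod a * N (u n - f) + N (v n - g))).
- by move=> n; exact: nrm_ge0.
- move=> n; have [l1 n1] := lpZ m_gt0 a p0 (luf n).
  have [_] := lpD m_gt0 p1 l1 (lvg n); rewrite n1.
  rewrite (_ : a *: (u n - f) + (v n - g) = a *: u n + v n - (a *: f + g))//.
  by rewrite scalerBr; apply/funext => x; rewrite !fctE; ring.
- apply: cvg0D; last exact: vg.
  exact: (cvg0Z (cmod a) uf).
Qed.

Lemma nrm_cvg_cst f : nrm_cvg (fun=> f) f.
Proof. by rewrite /nrm_cvg subrr (lp0 m_gt0 p0).2; exact: cvg_cst. Qed.

Lemma lp_approx f : L f -> exists u, [/\ forall n, L2 (u n), forall n, L (u n) & nrm_cvg u f].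
Proof.
move=> lf; have h n : exists g, [/\ Cc g, L (f - g) & N (f - g) < n.+1%:R^-1].
  have n0 : 0 < n.+1%:R^-1 :> R by rewrite invr_gt0.
  by have [g [cg _ l k]] := Cc_dense m_gt0 p0 lf n0; exists g.
have [u uP] := choice h; exists u; split.
- by move=> n; have [c _ _] := uP n; exact: Cc_lp.
- by move=> n; have [c _ _] := uP n; exact: Cc_lp.
- apply: (@cvg0_sq _ _ _ _ _ (fun n => n.+1%:R^-1)).
  + by move=> n; exact: nrm_ge0.
  + move=> n; have [_ l k] := uP n.
    by rewrite -(opprB f) (lpN m_gt0 p0 l).2 ltW.
  + exact: cvg_harmonic.
Qed.

Section operator.
Variables (T : V -> V) (K : R).
Hypothesis T2 : forall f, L2 f -> L2 (T f).
Hypothesis Tlin : forall (a : R[i]) f g, L2 f -> L2 g -> T (a *: f + g) = a *: T f + T g.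
Hypothesis K0 : 0 <= K.
Hypothesis TK : forall f, L2 f -> L f -> L (T f) /\ N (T f) <= K * N f.

(** The limit of [T] along any approximation of [f] in $\ell^p$ by functions of $\ell^2\cap\ell^p$;
    [lp_extP] shows existence and independence of the approximation. *)
Definition lp_ext f : V := xget 0 [set g | L g /\ exists u,
  [/\ forall n, L2 (u n), forall n, L (u n), nrm_cvg u f & nrm_cvg (fun n => T (u n)) g]].

Lemma ext_diff f g : L2 f -> L2 g -> L f -> L g -> N (T f - T g) <= K * N (f - g).
Proof.
move=> l2f l2g lf lg; have [l2 _] := lpB m_gt0 q1 l2f l2g.
have [l _] := lpB m_gt0 p1 lf lg; have [_] := TK l2 l.
by rewrite (linB m_gt0 q1 Tlin).
Qed.

Lemma lp_extP f : L f -> L (lp_ext f) /\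
  forall v, (forall n, L2 (v n)) -> (forall n, L (v n)) -> nrm_cvg v f ->
    nrm_cvg (fun n => T (v n)) (lp_ext f).
Proof.
move=> lf; have [] : [set g | L g /\ exists u, [/\ forall n, L2 (u n), forall n, L (u n),
    nrm_cvg u f & nrm_cvg (fun n => T (u n)) g]] (lp_ext f).
  rewrite /lp_ext; have [u [u2 up uf]] := lp_approx lf.
  have luf n : L (u n - f) by have [] := lpB m_gt0 p1 (up n) lf.
  have lT n : L (T (u n)) by have [] := TK (u2 n) (up n).
  have cau : nrm_cauchy m p (fun n => T (u n)).
    move=> e e0; have K1 : 0 < 2 * (K + 1) by rewrite mulr_gt0// ltr_wpDl.
    have d0 : 0 < e / (2 * (K + 1)) by rewrite divr_gt0.
    have [M HM] := (dist0P (fun n => nrm_ge0 m p (u n - f))).1 uf _ d0.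
    exists M => i j Mi Mj; apply: le_lt_trans (ext_diff (u2 i) (u2 j) (up i) (up j)) _.
    have [_] := lpB m_gt0 p1 (luf i) (luf j).
    rewrite (_ : u i - f - (u j - f) = u i - u j); last first.
      by apply/funext => x; rewrite !fctE; ring.
    move=> h; have h' : N (u i - u j) <= 2 * (e / (2 * (K + 1))).
      apply: (le_trans h); rewrite mulr_natl mulr2n.
      by apply: lerD; apply: ltW; exact: HM.
    apply: le_lt_trans (ler_wpM2l K0 h') _.
    have Kp : 0 < K + 1 by rewrite ltr_wpDl.
    have -> : K * (2 * (e / (2 * (K + 1)))) = e * (K / (K + 1)) by field; rewrite gt_eqF.
    by rewrite gtr_pMr// ltr_pdivrMr// mul1r ltrDl.
  have [g lg cg] := lp_complete m_gt0 p1 lT cau.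
  apply: (@xgetPex _ _ [set g | L g /\ exists u, [/\ forall n, L2 (u n), forall n, L (u n),
    nrm_cvg u f & nrm_cvg (fun n => T (u n)) g]]).
  by exists g; split => //; exists u.
move=> le [u [u2 up uf ug]]; split; first exact: le.
move=> v v2 vp vf.
apply: (@cvg0_sq _ _ _ _ _ (fun n => K * (N (v n - f) + N (u n - f)) + N (T (u n) - lp_ext f))).
- by move=> n; exact: nrm_ge0.
- move=> n; have [lT _] := TK (u2 n) (up n); have [lT' _] := TK (v2 n) (vp n).
  have [l1 _] := lpB m_gt0 p1 lT' lT; have [l2 _] := lpB m_gt0 p1 lT le.
  have [_] := lpD m_gt0 p1 l1 l2; rewrite addrA subrK => /le_trans; apply.
  apply: lerD => //; apply: le_trans (ext_diff (v2 n) (u2 n) (vp n) (up n)) _.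
  apply: ler_wpM2l => //.
  have [l3 _] := lpB m_gt0 p1 (vp n) lf; have [l4 _] := lpB m_gt0 p1 (up n) lf.
  have [_] := lpB m_gt0 p1 l3 l4.
  by rewrite (_ : v n - f - (u n - f) = v n - u n)//; apply/funext => x; rewrite !fctE; ring.
- apply: cvg0D; last exact: ug.
  exact: (cvg0Z K (cvg0D vf uf)).
Qed.

Lemma lp_ext_eq f : L2 f -> L f -> lp_ext f = T f.
Proof.
move=> l2f lf; have [le h] := lp_extP lf; have [lT _] := TK l2f lf.
apply: (@nrm_cvg_uniq (fun=> T f)) => //; last exact: nrm_cvg_cst.
by apply: (h (fun=> f)) => //; exact: nrm_cvg_cst.
Qed.

Lemma lp_ext_lin (a : R[i]) f g : L f -> L g ->
  lp_ext (a *: f + g) = a *: lp_ext f + lp_ext g.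
Proof.
move=> lf lg; have [u [u2 up uf]] := lp_approx lf; have [v [v2 vp vg]] := lp_approx lg.
have [laf _] := lpZ m_gt0 a p0 lf; have [ls _] := lpD m_gt0 p1 laf lg.
have [lef hf] := lp_extP lf; have [leg hg] := lp_extP lg; have [les hs] := lp_extP ls.
have [laef _] := lpZ m_gt0 a p0 lef; have [lse _] := lpD m_gt0 p1 laef leg.
have w2 n : L2 (a *: u n + v n).
  by have [l _] := lpZ m_gt0 a q0 (u2 n); have [] := lpD m_gt0 q1 l (v2 n).
have wp n : L (a *: u n + v n).
  by have [l _] := lpZ m_gt0 a p0 (up n); have [] := lpD m_gt0 p1 l (vp n).
have lTw n : L (T (a *: u n + v n)) by have [] := TK (w2 n) (wp n).
apply: (@nrm_cvg_uniq (fun n => T (a *: u n + v n)) _ _ lTw les lse).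
  by apply: (hs _ w2 wp); apply: (nrm_cvg_lin a up vp lf lg uf vg).
have e n : T (a *: u n + v n) = a *: T (u n) + T (v n) by exact: Tlin.
rewrite /nrm_cvg; under eq_fun do rewrite e.
have lTu n : L (T (u n)) by have [] := TK (u2 n) (up n).
have lTv n : L (T (v n)) by have [] := TK (v2 n) (vp n).
exact: (nrm_cvg_lin a lTu lTv lef leg (hf u u2 up uf) (hg v v2 vp vg)).
Qed.

Lemma lp_ext_bound f : L f -> N (lp_ext f) <= K * N f.
Proof.
move=> lf; have [le h] := lp_extP lf; have [u [u2 up uf]] := lp_approx lf.
have k : K * (N f + N (u n - f)) + N (T (u n) - lp_ext f) @[n --> \oo] --> K * N f.
  rewrite -(addr0 (K * N f)); apply: cvgD; last exact: h.
  apply: cvgMr; rewrite -[X in _ --> X](addr0 (N f)); apply: cvgD => //; exact: cvg_cst.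
apply: (cvgr_to_ge k); apply: nearW => n.
have [lT nT] := TK (u2 n) (up n); have [l1 _] := lpB m_gt0 p1 lT le.
have [_] := lpB m_gt0 p1 lT l1; rewrite subKr => /le_trans; apply.
rewrite lerD2r; apply: (le_trans nT); apply: ler_wpM2l => //.
have [l2 _] := lpB m_gt0 p1 (up n) lf.
by have [_] := lpD m_gt0 p1 lf l2; rewrite addrC subrK.
Qed.

Lemma lp_ext_bounded : bounded_operator m p lp_ext.
Proof.
split.
- by move=> f lf; have [] := lp_extP lf.
- by move=> a f g lf lg; exact: lp_ext_lin.
- exists K => f lf; have [le _] := lp_extP lf.
  by rewrite !lpE// -EFinM lee_fin; exact: lp_ext_bound.
Qed.

Lemma lp_ext_opnorm : (opnorm m p lp_ext <= K%:E)%E.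
Proof.
apply: ge_ereal_sup => _ [f /= f1 <-].
have lf : L f by apply: le_lt_trans f1 _; rewrite ltry.
have [le _] := lp_extP lf; rewrite lpE// lee_fin.
apply: le_trans (lp_ext_bound lf) _; rewrite -[leRHS]mulr1 ler_wpM2l//.
by rewrite -lee_fin -lpE.
Qed.

End operator.

(** * The extended semigroup and its strong continuity *)

Section semigroup.
Variables (S : R -> V -> V) (D : R).
Hypothesis SC0 : C0_semigroup m 2 S.
Hypothesis SD : forall t f, 0 <= t -> L2 f -> L f ->
  L (S t f) /\ N (S t f) <= expR (- D * t) * N f.

Let S2 t (t0 : 0 <= t) f (lf : L2 f) : L2 (S t f) := semig_lp SC0 t0 lf.
Let Slin t (t0 : 0 <= t) := semig_lin SC0 t0.
Let SK t (t0 : 0 <= t) f (l2f : L2 f) (lf : L f) := SD t0 l2f lf.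

Lemma semig_ext_bounded t : 0 <= t -> bounded_operator m p (lp_ext (S t)).
Proof. by move=> t0; apply: (lp_ext_bounded (Slin t0) (expR_ge0 _) (SK t0)). Qed.

(* On finitely supported functions, convergence on the support together with the bound on
   the whole norm leaves no mass outside the support. *)
Lemma semig_lp_right_Cc f : Cc f -> forall e, 0 < e ->
  exists2 d, 0 < d & forall t, 0 < t -> t < d -> N (S t f - f) < e.
Proof.
move=> cf; have l2f : L2 f by exact: Cc_lp. have lf : L f by exact: Cc_lp.
have [s us fs] := (CcP f).1 cf.
have m0 (g : V) x : 0 <= m x * cmod (g x) `^ p.
  by apply: mulr_ge0; [exact: ltW|exact: powR_ge0].
(* The absolute value makes membership and bounds hold for every [t], as the limit lemmas require,
   and changes nothing for $t>0$. *)
pose w (t : R) : V := S `|t| f.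
have w2 t : L2 (w t - f) by have [] := lpB m_gt0 q1 (S2 (normr_ge0 t) l2f) l2f.
have lw t : L (w t) by have [] := SD (normr_ge0 t) l2f lf.
have nw t : N (w t) <= expR (- D * `|t|) * N f by have [] := SD (normr_ge0 t) l2f lf.
have lwf t : L (w t - f) by have [] := lpB m_gt0 p1 (lw t) lf.
have wS t : 0 < t -> w t = S t f by move=> t0; rewrite /w gtr0_norm.
have w_cvg : nrm m 2 (w t - f) @[t --> (0 : R)^'+] --> (0 : R).
  apply/cvgr0Pnorm_lt => e e0; have [d d0 Hd] := semig_right m_gt0 q1 SC0 l2f e0.
  near=> t; rewrite ger0_norm ?nrm_ge0// wS//; apply: Hd => //.
pose mass (g : V) := \sum_(x <- s) m x * cmod (g x) `^ p.
have mass0 g : 0 <= mass g by apply: sumr_ge0 => x _; exact: m0.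
have mf : N f `^ p = mass f.
  apply/eqP; rewrite eq_le; apply/andP; split; last exact: nrm_sum.
  have [|_ h] := (nrm_leP m_gt0 f p0 (powR_ge0 (mass f) p^-1)).2.
    move=> s' us'; rewrite -powRrM mulVf ?gt_eqF// powRr1//.
    rewrite (bigID (fun x => x \in s))/= [X in _ + X]big1 ?addr0; last first.
      by move=> x /fs ->; rewrite Normc.normc0 powR0 ?gt_eqF ?mulr0.
    exact: (ler_sum_mem us us' (m0 f)).
  have -> : mass f = (mass f `^ p^-1) `^ p by rewrite -powRrM mulVf ?gt_eqF// powRr1.
  by rewrite ge0_ler_powR ?(ltW p0)// nnegrE ?nrm_ge0 ?powR_ge0.
(* The second summand bounds the mass of [w t] outside the support of [f]: the norm bound minus the
   mass on the support. Both terms of that difference tend to [mass f]. *)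
pose Phi t := mass (w t - f) + ((expR (- D * `|t|) * N f) `^ p - mass (w t)).
have split_sum t s' : uniq s' ->
    \sum_(x <- s') m x * cmod ((w t - f) x) `^ p <= Phi t.
  move=> us'; rewrite (bigID (fun x => x \in s))/=; apply: lerD.
    exact: (ler_sum_mem us us' (m0 (w t - f))).
  rewrite lerBrDl; rewrite (eq_bigr (fun x => m x * cmod (w t x) `^ p)); last first.
    by move=> x /fs fx; rewrite !fctE fx subr0.
  rewrite -big_filter -big_cat/=.
  have us'' : uniq (s ++ [seq x <- s' | x \notin s]).
    rewrite cat_uniq us filter_uniq//= andbT.
    by apply/hasPn => x; rewrite mem_filter => /andP[].
  apply: le_trans (nrm_sum m_gt0 p0 (lw t) us'') _.
  rewrite ge0_ler_powR ?(ltW p0) ?nnegrE ?nrm_ge0// mulr_ge0 ?nrm_ge0// expR_ge0//.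
have Phi0 t : 0 <= Phi t by have := split_sum t [::] isT; rewrite big_nil.
have PhiP t : N (w t - f) <= Phi t `^ p^-1.
  have [|//] := (nrm_leP m_gt0 (w t - f) p0 (powR_ge0 (Phi t) p^-1)).2.
  move=> s' us'; rewrite -powRrM mulVf ?gt_eqF// powRr1//; exact: split_sum.
have w_pt x : cmod (w t x - f x) @[t --> (0 : R)^'+] --> (0 : R).
  exact: (nrm_cvg_pt m_gt0 x q0 w2 w_cvg).
have c1 : mass (w t - f) @[t --> (0 : R)^'+] --> (0 : R).
  suff : mass (w t - f) @[t --> (0 : R)^'+] --> \sum_(x <- s) m x * 0 `^ p.
    by rewrite big1// => x _; rewrite powR0 ?mulr0// gt_eqF.
  apply: cvg_bigsum => x; apply: cvgMr; apply: (cvg_powR p0 _ (w_pt x)).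
  by move=> t; exact: cmod_ge0.
have c2 : mass (w t) @[t --> (0 : R)^'+] --> mass f.
  apply: cvg_bigsum => x; apply: cvgMr; apply: (cvg_powR p0).
    by move=> t; exact: cmod_ge0.
  exact: cmod_cvg (w_pt x).
have c3 : (expR (- D * `|t|) * N f) `^ p @[t --> (0 : R)^'+] --> mass f.
  rewrite -mf; apply: (cvg_powR p0).
    by move=> t; rewrite mulr_ge0 ?nrm_ge0 ?expR_ge0.
  rewrite -[X in _ --> X](mul1r (N f)); apply: cvgMl.
  have id0 : t @[t --> (0 : R)^'+] --> (0 : R) by apply: cvg_at_right_filter; exact: cvg_id.
  have k : - D * `|t| @[t --> (0 : R)^'+] --> - D * `|0 : R| by apply: cvgMr; exact: cvg_norm.
  rewrite normr0 mulr0 in k.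
  have c : {for 0, continuous (@expR R)} by exact: continuous_expR.
  by have := cvg_comp _ _ k c; rewrite expR0.
have cPhi : Phi t @[t --> (0 : R)^'+] --> (0 : R).
  suff : Phi t @[t --> (0 : R)^'+] --> 0 + (mass f - mass f) by rewrite subrr addr0.
  by apply: cvgD; [exact: c1|exact: cvgB].
have cPhi' : Phi t `^ p^-1 @[t --> (0 : R)^'+] --> (0 : R).
  have pV : 0 < p^-1 by rewrite invr_gt0.
  suff : Phi t `^ p^-1 @[t --> (0 : R)^'+] --> (0 : R) `^ p^-1 by rewrite powR0 ?gt_eqF.
  exact: cvg_powR.
have key : N (w t - f) @[t --> (0 : R)^'+] --> (0 : R).
  by apply: cvg0_sq cPhi' => t; [exact: nrm_ge0|exact: PhiP].
move=> e e0; have [d /= d0 Hd] := (cvgr0Pnorm_lt _).1 key e e0; exists d => // t t0 td.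
have := Hd t; rewrite /= sub0r normrN gtr0_norm// => /(_ td t0).
by rewrite (ger0_norm (nrm_ge0 _ _ _)) (wS t t0).
Unshelve. all: by end_near. Qed.

Lemma semig_ext_right f : L f -> forall e, 0 < e ->
  exists2 d, 0 < d & forall t, 0 < t -> t < d -> N (lp_ext (S t) f - f) < e.
Proof.
(* This bounds $e^{-Dt}$ for $t\le1$, hence the cap on [d] below. *)
move=> lf e e0; set K := expR `|D|.
have K0 : 0 < K by exact: expR_gt0.
have K1 : 0 < K + 2 by rewrite ltr_wpDl// ltW.
have eK : 0 < e / (K + 2) by rewrite divr_gt0.
have [g [cg _ lfg ng]] := Cc_dense m_gt0 p0 lf eK.
have l2g : L2 g by exact: Cc_lp. have lg : L g by exact: Cc_lp.
have [d d0 Hd] := semig_lp_right_Cc cg eK.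
exists (Num.min d 1); first by rewrite lt_min d0 ltr01.
move=> t t0; rewrite lt_min => /andP[td t1].
have tt := ltW t0; have tb := semig_ext_bounded tt.
have [bL bl _] := bounded_operatorP tb.
have b1 := lp_ext_bound (Slin tt) (expR_ge0 _) (SK tt) lfg.
have b2 : expR (- D * t) <= K.
  rewrite ler_expR; apply: le_trans (ler_norm _) _.
  by rewrite normrM normrN (gtr0_norm t0) ler_piMr// ltW.
have b3 := Hd t t0 td.
have eg := lp_ext_eq (Slin tt) (expR_ge0 _) (SK tt) l2g lg.
have [lSg _] := SK tt l2g lg; have [l1 _] := lpB m_gt0 p1 lSg lg.
have le := bL _ lfg.
have [l2 n2] := lpD m_gt0 p1 le l1; have [_ n3] := lpB m_gt0 p1 l2 lfg.
have -> : lp_ext (S t) f - f = lp_ext (S t) (f - g) + (S t g - g) - (f - g).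
  rewrite (linB m_gt0 p1 bl lf lg) eg.
  by apply/funext => x; rewrite !fctE; ring.
apply: (le_lt_trans n3).
have b4 : N (lp_ext (S t) (f - g)) <= K * (e / (K + 2)).
  apply: (le_trans b1); apply: ler_pM; [exact: expR_ge0|exact: nrm_ge0|exact: b2|exact: ltW].
have b5 : K * (e / (K + 2)) + e / (K + 2) + e / (K + 2) = e.
  by field; rewrite gt_eqF.
rewrite -[ltRHS]b5; apply: ltrD => //; apply: (le_lt_trans n2); exact: ler_ltD.
Qed.

Lemma semig_ext_C0 : C0_semigroup m p (fun t => lp_ext (S t)).
Proof.
split.
- by move=> t t0; exact: semig_ext_bounded.
- move=> f lf; have z : (0 : R) <= 0 by [].
  have [lE h] := lp_extP (Slin z) (expR_ge0 _) (SK z) lf.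
  have [u [u2 up uf]] := lp_approx lf.
  have e n : S 0 (u n) = u n by exact: (semig0 SC0 (u2 n)).
  have := h u u2 up uf; rewrite /nrm_cvg; under eq_fun do rewrite e.
  by move=> h'; exact: (nrm_cvg_uniq up lE lf h' uf).
- move=> s t s0 t0 f lf; have st0 : 0 <= s + t by exact: addr_ge0.
  have [l1 h1] := lp_extP (Slin t0) (expR_ge0 _) (SK t0) lf.
  have [l2 h2] := lp_extP (Slin s0) (expR_ge0 _) (SK s0) l1.
  have [l3 h3] := lp_extP (Slin st0) (expR_ge0 _) (SK st0) lf.
  have [u [u2 up uf]] := lp_approx lf.
  have v2 n : L2 (S t (u n)) by exact: S2.
  have vp n : L (S t (u n)) by have [] := SK t0 (u2 n) (up n).
  have k := h2 _ v2 vp (h1 u u2 up uf); have k' := h3 u u2 up uf.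
  have e n : S (s + t) (u n) = S s (S t (u n)) by exact: (semigD SC0 s0 t0 (u2 n)).
  have k2 : nrm_cvg (fun n => S s (S t (u n))) (lp_ext (S (s + t)) f).
    by rewrite /nrm_cvg; under eq_fun do rewrite -e; exact: k'.
  apply: (nrm_cvg_uniq _ l3 l2 k2 k) => n.
  by have [] := SK s0 (v2 n) (vp n).
- move=> f lf; apply/(right0P (h := fun t => lp_ext (S t) f - f)); last exact: semig_ext_right.
  move=> t t0; have [bL _ _] := bounded_operatorP (semig_ext_bounded (ltW t0)).
  by have [] := lpB m_gt0 p1 (bL _ lf) lf.
Qed.

End semigroup.
End extension.

(* The quadratic inequality is $C_p \ge M/(M+1)$ after clearing denominators. *)
Lemma exponent_interval (R : rcfType) (M p : R) : 0 < M ->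
  p \in `[2 * ((M + 1) / M) - 2 * (Num.sqrt (M + 1) / M),
          2 * ((M + 1) / M) + 2 * (Num.sqrt (M + 1) / M)] ->
  1 < p /\ 0 <= 4 * ((p - 1) / p ^+ 2) - M * (1 - 4 * ((p - 1) / p ^+ 2)).
Proof.
move=> M0; rewrite in_itv/= => /andP[h1 h2].
have s2 : Num.sqrt (M + 1) ^+ 2 = M + 1 by rewrite sqr_sqrtr// addr_ge0// ltW.
(* The endpoints have sum and product both equal to $4(M+1)/M$, so this is $(p-p_-)(p_+-p)\ge0$
   multiplied by $M$. *)
have quad : M * p ^+ 2 <= 4 * (M + 1) * (p - 1).
  have h : 0 <= (p - (2 * ((M + 1) / M) - 2 * (Num.sqrt (M + 1) / M))) *
      (2 * ((M + 1) / M) + 2 * (Num.sqrt (M + 1) / M) - p).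
    by rewrite mulr_ge0// subr_ge0.
  have := mulr_ge0 (ltW M0) h.
  have -> : M * ((p - (2 * ((M + 1) / M) - 2 * (Num.sqrt (M + 1) / M))) *
      (2 * ((M + 1) / M) + 2 * (Num.sqrt (M + 1) / M) - p)) =
    4 * (M + 1) * p - M * p ^+ 2 - 4 * ((M + 1) ^+ 2 - Num.sqrt (M + 1) ^+ 2) / M.
    by field; rewrite gt_eqF.
  rewrite s2 (_ : 4 * ((M + 1) ^+ 2 - (M + 1)) / M = 4 * (M + 1)); first lra.
  by field; rewrite gt_eqF.
(* The quadratic inequality itself forces this: its left side is positive for $p\ne0$, and $p=0$
   violates it. *)
have p1 : 1 < p.
  have [pz|pn] := eqVneq p 0; first by move: quad; rewrite pz expr0n/= mulr0; nra.
  have p2 : 0 < p ^+ 2 by rewrite lt_neqAle sqr_ge0 andbT eq_sym sqrf_eq0.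
  have := lt_le_trans (mulr_gt0 M0 p2) quad.
  by rewrite pmulr_rgt0 ?subr_gt0// mulr_gt0// addr_gt0.
split=> //; have p2 : 0 < p ^+ 2 by rewrite exprn_gt0// (lt_trans ltr01).
have -> : 4 * ((p - 1) / p ^+ 2) - M * (1 - 4 * ((p - 1) / p ^+ 2)) =
  (4 * (M + 1) * (p - 1) - M * p ^+ 2) / p ^+ 2.
  by field; rewrite gt_eqF// (lt_trans ltr01).
by rewrite divr_ge0 ?subr_ge0// ltW.
Qed.

Theorem theorem3p1 (R : realType) (X : choiceType) (m : X -> R)
    (m_gt0 : forall x, 0 < m x)
    (G : magnetic_schrodinger_graph R X)
    (Q_pos : form_positive G) (Q_closable : form_closable m G)
    (M C : R) (M_gt0 : 0 < M) (C_ge0 : 0 <= C)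
    (c_bounded : form_bounded m G M C)
    (S2 : R -> (X -> R[i]) -> X -> R[i])
    (S2_exp : exp_semigroup m (H2 m G) S2) :
  forall p : R,
    p \in `[2 * ((M + 1) / M) - 2 * (Num.sqrt (M + 1) / M),
            2 * ((M + 1) / M) + 2 * (Num.sqrt (M + 1) / M)] ->
    let Cp := 4 * ((p - 1) / p ^+ 2) in
    let Dp := (Cp - M * (1 - Cp)) * lambda2 m G - C * (1 - Cp) in
    (forall t : R, 0 <= t ->
       exists T : (X -> R[i]) -> X -> R[i],
         [/\ bounded_operator m p T,
             forall f, lp m 2 f -> lp m p f -> T f = S2 t f
           & (opnorm m p T <= (expR (- Dp * t))%:E)%E]) /\
    (exists Sp : R -> (X -> R[i]) -> X -> R[i],
       C0_semigroup m p Sp /\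
       forall t : R, 0 <= t ->
         forall f, lp m 2 f -> lp m p f -> Sp t f = S2 t f).
Proof.
move=> p /(exponent_interval M_gt0)[p1 Cp_ge]; cbv zeta.
have [SC0 _] := S2_exp.
have SD := semig_lp_bound m_gt0 Q_pos Q_closable c_bounded p1 Cp_ge S2_exp.
have p1' := ltW p1.
split; last first.
  exists (fun t => lp_ext m p (S2 t)); split; first exact: (semig_ext_C0 m_gt0 p1' SC0 SD).
  move=> t t0 f l2f lf.
  exact: (lp_ext_eq m_gt0 p1' (semig_lin SC0 t0) (expR_ge0 _) (fun f => SD t f t0)).
move=> t t0; exists (lp_ext m p (S2 t)); split.
- exact: (semig_ext_bounded m_gt0 p1' SC0 SD t0).
- move=> f l2f lf.
  exact: (lp_ext_eq m_gt0 p1' (semig_lin SC0 t0) (expR_ge0 _) (fun f => SD t f t0)).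
- exact: (lp_ext_opnorm m_gt0 p1' (semig_lin SC0 t0) (expR_ge0 _) (fun f => SD t f t0)).
Qed.
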